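(* Let $\mathbb D$ be the open unit disc in $\mathbb C$, let $S_1:A^2_{(0,1)}(\mathbb D)\to L^2(\mathbb D)$ be the canonical solution operator to $\overline\partial$ restricted to $(0,1)$-forms with coefficients in the Bergman space, and let $u_n(z)=\left[(n+1)/\pi\right]^{1/2}z^n$, $n\in\mathbb N_0$, be the standard orthonormal basis of $A^2(\mathbb D)$. Then $$\sum_{n=0}^\infty\|S_1(u_n\,d\overline z)\|^2<\infty,$$ and consequently $S_1:A^2_{(0,1)}(\mathbb D)\to L^2(\mathbb D)$ is a Hilbert-Schmidt operator.
   Context: $\lambda$ is Lebesgue measure on $\mathbb C$ and $\|\cdot\|$ is the norm of $L^2(\mathbb D)=L^2(\mathbb D,\lambda)$. $A^2(\mathbb D)$ is the Bergman space of holomorphic functions on $\mathbb D$ that are square integrable with respect to $\lambda$. $A^2_{(0,1)}(\mathbb D)$ is the space of forms $g\,d\overline z$ with $g\in A^2(\mathbb D)$, identified as a Hilbert space with $A^2(\mathbb D)$ via $g\,d\overline z\leftrightarrow g$. The canonical solution operator assigns to $g\,d\overline z$ the unique $S_1(g\,d\overline z)\in L^2(\mathbb D)$ with $\frac{\partial}{\partial\overline z}S_1(g\,d\overline z)=g$ and $S_1(g\,d\overline z)\perp A^2(\mathbb D)$; equivalently, $S_1(g\,d\overline z)=\overline z g-P(\overline z g)$, where $P:L^2(\mathbb D)\to A^2(\mathbb D)$ is the orthogonal projection. *)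

(* Defs.v *)
From HB Require Import structures.
From mathcomp Require Import all_boot all_order all_algebra.
From mathcomp Require Import complex ring lra.
From mathcomp Require Import all_classical all_reals all_analysis.
From mathcomp Require Import measurable_realfun.

Set Implicit Arguments.
Unset Strict Implicit.
Unset Printing Implicit Defensive.
Import Order.TTheory GRing.Theory Num.Theory.
Import numFieldNormedType.Exports.
Import ComplexField.Normc.
Local Open Scope classical_set_scope.
Local Open Scope complex_scope.
Local Open Scope ring_scope.

(* MathComp-Analysis, for an arbitrary [R : realType]; the complex numbers are
   [R[i]].  A complex function is a total map [R[i] -> R[i]] of which only the
   values on the open unit disc matter; L^2 functions are represented by such
   maps, and equality in L^2 is [eqL2]. *)

Section Bergman.
Variable R : realType.
Local Notation Re := complex.Re.
Local Notation Im := complex.Im.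
Implicit Types (f g h k p : R[i] -> R[i]) (z : R[i]).

Definition cplx (w : R * R) : R[i] := w.1 +i* w.2.

Definition reim (f : R[i] -> R[i]) : (R * R -> R) * (R * R -> R) :=
  (fun w => Re (f (cplx w)), fun w => Im (f (cplx w))).

(* C is identified with R^2 through [cplx]; [measurableTypeR R] is [R] with its
   Borel sigma-algebra.  Requiring Borel rather than Lebesgue measurability
   does not change L^2, since every Lebesgue measurable function is a.e. equal
   to a Borel one. *)
Local Notation plane := (measurableTypeR R * measurableTypeR R)%type.

Definition leb2 : {measure set plane -> \bar R} :=
  (@lebesgue_measure R \x @lebesgue_measure R)%E.

Definition disc : set plane := [set w | normc (cplx w) < 1].

(* [R[i]^o] is [R[i]] as a normed space over itself: [derivable _ z 1] is the
   existence of the complex derivative at [z]. *)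
Definition holomorphic f :=
  forall z, normc z < 1 -> derivable (f : R[i]^o -> R[i]^o) z 1.

Definition inL2 f := [/\ measurable_fun disc (reim f).1,
  measurable_fun disc (reim f).2 &
  (\int[leb2]_(w in disc) (normc (f (cplx w)) ^+ 2)%:E < +oo)%E].

Definition normL2 f : \bar R :=
  sqrte (\int[leb2]_(w in disc) (normc (f (cplx w)) ^+ 2)%:E)%E.

Definition eqL2 f g :=
  {ae leb2, forall w, disc w -> f (cplx w) = g (cplx w)}.

Definition inner f g : R[i] := let fg z := f z * (g z)^* in
  (\int[leb2]_(w in disc) (reim fg).1 w) +i*
  (\int[leb2]_(w in disc) (reim fg).2 w).

Definition inA2 f := holomorphic f /\ inL2 f.

Definition is_bergman_proj f p :=
  inA2 p /\ forall k, inA2 k -> inner (fun z => f z - p z) k = 0.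

(* The orthogonal projection of [f] onto the Bergman space; by continuity of
   holomorphic functions its values on the disc are uniquely determined. *)
Definition bergman_proj f : R[i] -> R[i] :=
  xget (fun=> 0 : R[i]) [set p | is_bergman_proj f p].

(* The canonical solution operator, a (0,1)-form [g dzbar] being given by its
   coefficient [g].  [canonical_solutionP] below relates this formula to the
   description of [S1 g] as the solution of [dbar h = g] orthogonal to A^2. *)
Definition S1 g : R[i] -> R[i] :=
  fun z => z^* * g z - bergman_proj (fun z => z^* * g z) z.

(* Wirtinger derivative (d/dx + i d/dy) / 2. *)
Definition dbar h z : R[i] :=
  let d v := 'D_v (reim h).1 (Re z, Im z) +i*
     'D_v (reim h).2 (Re z, Im z) in
  2^-1 * (d ((1, 0) : R * R) + 'i%C * d ((0, 1) : R * R)).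

Definition real_differentiable h z :=
  differentiable (reim h).1 (Re z, Im z) /\
  differentiable (reim h).2 (Re z, Im z).

(* The derivative is taken classically; no solution is lost, since a weak
   solution [h] of [dbar h = g] differs from [zbar g] by a weakly, hence a.e.,
   holomorphic function. *)
Definition is_canonical_solution g h :=
  [/\ inL2 h,
      forall z, normc z < 1 -> real_differentiable h z /\ dbar h z = g z &
      forall k, inA2 k -> inner h k = 0].

Definition bergman_basis (n : nat) : R[i] -> R[i] :=
  fun z => (Num.sqrt (n.+1%:R / pi))%:C * z ^+ n.

(* Bases are indexed by [nat]: A^2 is separable and infinite-dimensional. *)
Definition orthonormal_basis (e : nat -> R[i] -> R[i]) :=
  [/\ forall n, inA2 (e n),
      forall m n, inner (e m) (e n) = (m == n)%:R &
      forall f, inA2 f -> (forall n, inner f (e n) = 0) -> eqL2 f (fun=> 0)].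

(* [T] is a bounded linear operator from A^2 to L^2 with finite Hilbert-Schmidt
   norm; that norm does not depend on the orthonormal basis. *)
Definition hilbert_schmidt (T : (R[i] -> R[i]) -> R[i] -> R[i]) :=
  [/\ forall f, inA2 f -> inL2 (T f),
      forall (a : R[i]) f g, inA2 f -> inA2 g ->
        eqL2 (T (fun z => a * f z + g z)) (fun z => a * T f z + T g z),
      exists M : R, forall f, inA2 f -> (normL2 (T f) <= M%:E * normL2 f)%E &
      exists2 e, orthonormal_basis e &
        (\sum_(0 <= n <oo) normL2 (T (e n)) ^+ 2 < +oo)%E].

Definition lin2 (a b : R) (h : R * R) : R := a * h.1 + b * h.2.

Lemma lin2_linear a b : linear (lin2 a b).
Proof. by move=> k [x y] [x' y']; rewrite /lin2/= /GRing.scale/=; ring. Qed.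

HB.instance Definition _ a b :=
  GRing.isLinear.Build R (R * R)%type R _ (lin2 a b) (lin2_linear a b).

Lemma lin2_continuous a b : continuous (lin2 a b).
Proof.
move=> w; rewrite /lin2; apply: cvgD; apply: cvgM.
- exact: cvg_cst.
- exact: cvg_fst.
- exact: cvg_cst.
- exact: cvg_snd.
Qed.

(* First-order approximation at [w] with partial derivatives [a] and [b]. *)
Definition approx2 (U : R * R -> R) w (a b : R) := forall e : R, 0 < e ->
  exists2 d : R, 0 < d & forall h : R * R, `|h| < d ->
    `|U (h + w) - U w - lin2 a b h| <= e * `|h|.

Lemma approx2_eqo (U : R * R -> R) (w : R * R) a b : approx2 U w a b <->
  (U \o shift w = cst (U w) + lin2 a b +o_ (0 : R * R) id).
Proof.
split=> [H|H].
  apply/eqaddoP => e e0; have [d d0 Hd] := H _ e0.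
  apply/(@nbhs_norm0P R (R * R)%type); exists d => // h /= hd.
  by have := Hd h hd; rewrite /= !opprD !addrA.
move=> e e0; move/eqaddoP: H => /(_ _ e0) /(@nbhs_norm0P R (R * R)%type) [d /= d0 Hd].
by exists d => // h hd; have := Hd h hd; rewrite /= !opprD !addrA.
Qed.

Lemma approx2P (U : R * R -> R) (w : R * R) : differentiable U w ->
  approx2 U w ('D_((1,0) : R * R) U w) ('D_((0,1) : R * R) U w).
Proof.
move=> dU; apply/approx2_eqo.
have -> : lin2 ('D_((1,0) : R * R) U w) ('D_((0,1) : R * R) U w) = 'd U w :> (_ -> _).
  apply/funext => h; rewrite /lin2 !deriveE//.
  rewrite -[X in X + _]mulrC -[X in _ + X]mulrC.
  rewrite -[X in X + _]/(h.1 *: _) -[X in _ + X]/(h.2 *: _) -!linearZ -linearD.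
  by congr ('d U w _); case: h => x y; congr pair => /=; rewrite /GRing.scale /=; ring.
by have [_ ->] := (diff_locallyP w U).1 dU.
Qed.

Lemma approx2_diff (U : R * R -> R) (w : R * R) a b : approx2 U w a b ->
  [/\ differentiable U w, 'D_((1,0) : R * R) U w = a &
      'D_((0,1) : R * R) U w = b].
Proof.
move=> /approx2_eqo H.
have dE := diff_unique (@lin2_continuous a b) H.
have dU : differentiable U w.
  apply/diff_locallyP; rewrite dE; split => //; exact: lin2_continuous.
split=> //; rewrite deriveE// dE /lin2/=.
all: rewrite -[LHS]/(a * _ + b * _) /=; ring.
Qed.

(* f (z + h) = f z + a h + b hbar + o(h): real differentiability at [z], with
   Wirtinger derivatives [a] and [b]. *)
Definition approxC f z (a b : R[i]) := forall e : R, 0 < e ->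
  exists2 d : R, 0 < d & forall h : R[i], normc h < d ->
    normc (f (z + h) - f z - a * h - b * h^*) <= e * normc h.

Lemma normcCE (x : R[i]) : `|x| = (normc x)%:C.
Proof. by []. Qed.

Lemma normcge0 (x : R[i]) : 0 <= normc x.
Proof. by case: x => x y; exact: sqrtr_ge0. Qed.

Lemma normc_le_add (x y : R) : normc (x +i* y) <= `|x| + `|y|.
Proof.
rewrite -[leRHS]ger0_norm ?addr_ge0// -sqrtr_sqr ler_sqrt ?sqr_ge0//.
rewrite sqrrD !real_normK ?num_real// -addrA [X in _ <= _ + X]addrC addrA.
by rewrite lerDl mulrn_wge0// mulr_ge0.
Qed.

Lemma normc_ge_max (x y : R) : `|(x, y) : R * R| <= normc (x +i* y).
Proof.
rewrite prod_normE/= ge_max -!sqrtr_sqr !ler_sqrt ?lerDl ?lerDr ?sqr_ge0//.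
all: by rewrite addr_ge0 ?sqr_ge0.
Qed.

Lemma normc_le_max (x y : R) : normc (x +i* y) <= 2 * `|(x, y) : R * R|.
Proof.
apply: le_trans (normc_le_add x y) _.
by rewrite prod_normE/= mulr_natl mulr2n lerD// le_max lexx ?orbT.
Qed.

Lemma cplx_shift (x y s t : R) :
  (x +i* y) + (s +i* t) = cplx ((s, t) + (x, y)) :> R[i].
Proof. by rewrite /cplx/= [s + x]addrC [t + y]addrC. Qed.

Lemma dbar_coord (ux uy vx vy : R) :
  2^-1 * ((ux +i* vx) + 'i%C * (uy +i* vy)) =
  ((ux - vy) / 2) +i* ((vx + uy) / 2) :> R[i].
Proof.
apply: (@mulfI _ 2); first by rewrite pnatr_eq0.
rewrite mulrA mulfV ?pnatr_eq0// mul1r mulr_natl mulr2n.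
by apply/eqP; rewrite eq_complex/=; apply/andP; split; apply/eqP; field.
Qed.

Lemma real_differentiable_approxC f z : real_differentiable f z ->
  exists a, approxC f z a (dbar f z).
Proof.
case: z => x y [/approx2P HU /approx2P HV]; rewrite /dbar; cbv zeta; rewrite dbar_coord.
set ux := ('D_(1, 0) (reim f).1 _) in HU *.
set uy := ('D_(0, 1) (reim f).1 _) in HU *.
set vx := ('D_(1, 0) (reim f).2 _) in HV *.
set vy := ('D_(0, 1) (reim f).2 _) in HV *.
exists (((ux + vy) / 2) +i* ((vx - uy) / 2)).
move=> e e0; have e20 : 0 < e / 2 by rewrite divr_gt0.
have [d1 d10 H1] := HU _ e20; have [d2 d20 H2] := HV _ e20.
exists (Num.min d1 d2); first by rewrite lt_min d10.
move: H1 H2 => /= H1 H2 [s t]; rewrite lt_min => /andP[hd1 hd2].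
have m := normc_ge_max s t.
have {}H1 := H1 (s, t) (le_lt_trans m hd1).
have {}H2 := H2 (s, t) (le_lt_trans m hd2).
set F := (X in normc X).
have -> : F = (Re F) +i* (Im F) by case: F.
apply: le_trans (normc_le_add _ _) _.
have -> : Re F = Re (f (cplx ((s, t) + (x, y)))) - Re (f (cplx (x, y))) - lin2 ux uy (s, t).
  rewrite /F cplx_shift -[_ +i* y]/(cplx (x, y)).
  by case: (f _) (f _) => [A1 A2] [B1 B2]; rewrite /lin2/=; field.
have -> : Im F = Im (f (cplx ((s, t) + (x, y)))) - Im (f (cplx (x, y))) - lin2 vx vy (s, t).
  rewrite /F cplx_shift -[_ +i* y]/(cplx (x, y)).
  by case: (f _) (f _) => [A1 A2] [B1 B2]; rewrite /lin2/=; field.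
have := lerD H1 H2 => /le_trans; apply.
rewrite -mulrDl -splitr ler_wpM2l// ltW//.
Qed.

Lemma approxC_real f z a b : approxC f z a b ->
  real_differentiable f z /\ dbar f z = b.
Proof.
case: z a b => x y [a1 a2] [b1 b2] H.
have HU : approx2 (reim f).1 (x, y) (a1 + b1) (b2 - a2).
  move=> e e0; have [d d0 Hd] := H (e / 2) (divr_gt0 e0 (ltr0n _ 2)).
  exists (d / 2); rewrite ?divr_gt0// => -[s t] hd.
  have n2 := normc_le_max s t.
  have /Hd : normc (s +i* t) < d.
    by apply: le_lt_trans n2 _; rewrite mulrC -ltr_pdivlMr.
  have /(ler_wpM2l (ltW (divr_gt0 e0 (ltr0n _ 2)))) := n2.
  move=> /[swap] /le_trans /[apply].
  rewrite mulrA divfK ?pnatr_eq0//; apply: le_trans.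
  set F := (X in normc X); have -> : F = (Re F) +i* (Im F) by case: F.
  apply: le_trans (normc_ge_max _ _); rewrite prod_normE le_max/=.
  apply/orP; left; rewrite le_eqVlt; apply/orP; left; apply/eqP; congr `|_|.
  rewrite /F cplx_shift -[_ +i* y]/(cplx (x, y)) /=.
  by case: (f _) (f _) => [A1 A2] [B1 B2]; rewrite /lin2/=; ring.
have HV : approx2 (reim f).2 (x, y) (a2 + b2) (a1 - b1).
  move=> e e0; have [d d0 Hd] := H (e / 2) (divr_gt0 e0 (ltr0n _ 2)).
  exists (d / 2); rewrite ?divr_gt0// => -[s t] hd.
  have n2 := normc_le_max s t.
  have /Hd : normc (s +i* t) < d.
    by apply: le_lt_trans n2 _; rewrite mulrC -ltr_pdivlMr.
  have /(ler_wpM2l (ltW (divr_gt0 e0 (ltr0n _ 2)))) := n2.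
  move=> /[swap] /le_trans /[apply].
  rewrite mulrA divfK ?pnatr_eq0//; apply: le_trans.
  set F := (X in normc X); have -> : F = (Re F) +i* (Im F) by case: F.
  apply: le_trans (normc_ge_max _ _); rewrite prod_normE le_max/=.
  apply/orP; right; rewrite le_eqVlt; apply/orP; left; apply/eqP; congr `|_|.
  rewrite /F cplx_shift -[_ +i* y]/(cplx (x, y)) /=.
  by case: (f _) (f _) => [A1 A2] [B1 B2]; rewrite /lin2/=; ring.
have [dU Ux Uy] := approx2_diff HU; have [dV Vx Vy] := approx2_diff HV.
split; first by split.
rewrite /dbar; cbv zeta; rewrite dbar_coord Ux Uy Vx Vy.
by congr (_ +i* _); field.
Qed.

Lemma derivable_approxC f z : derivable (f : R[i]^o -> R[i]^o) z 1 <->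
  exists a, approxC f z a 0.
Proof.
split.
  move=> /cvg_ex[/= a /cvgrPdist_le H]; exists a => e e0.
  have : 0 < (e%:C : R[i]) by rewrite ltcR.
  move=> /H; rewrite near_withinE/= => /(@nbhs_norm0P _ R[i]^o)[/= [d d'] d0 Hd].
  move: d0; rewrite ltcE/= => /andP[/eqP di d0]; exists d => // h hd.
  have [->|h0] := eqVneq h 0.
    by rewrite addr0 subrr !(mulr0, mul0r, subr0) normc0 mulr0.
  have /= := Hd h; rewrite di normcCE ltcR => /(_ hd h0).
  rewrite normcCE lecR => {}Hd.
  rewrite mul0r subr0 -normcN.
  have -> : - (f (z + h) - f z - a * h) = (a - h^-1 *: ((f (h *: (1 : R[i]^o) + z) - f z) : R[i]^o)) * h.
    rewrite /GRing.scale/= mulr1 mulrBl [h^-1 * _]mulrC mulfVK// [h + z]addrC; ring.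
  by rewrite normcM ler_wpM2r// normcge0.
case=> a H; apply/cvg_ex; exists a => /=; apply/cvgrPdist_le => -[e e'].
rewrite ltcE/= => /andP[/eqP -> e0]; have [d d0 Hd] := H e e0.
rewrite near_withinE; apply/(@nbhs_norm0P _ R[i]^o); exists (d%:C) => /=.
  by rewrite ltcR.
move=> h /=; rewrite normcCE ltcR => hd h0; rewrite normcCE lecR.
have := Hd h hd; rewrite mul0r subr0 -normcN.
have -> : - (f (z + h) - f z - a * h) = (a - h^-1 *: ((f (h *: (1 : R[i]^o) + z) - f z) : R[i]^o)) * h.
  rewrite /GRing.scale/= mulr1 mulrBl [h^-1 * _]mulrC mulfVK// [h + z]addrC; ring.
rewrite normcM ler_pM2r// lt_neqAle normcge0 andbT eq_sym.
by apply: contra h0 => /eqP/eq0_normc ->.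
Qed.

Lemma approxCB f g z a b a' b' : approxC f z a b -> approxC g z a' b' ->
  approxC (fun z => f z - g z) z (a - a') (b - b').
Proof.
move=> Hf Hg e e0; have e20 : 0 < e / 2 by rewrite divr_gt0.
have [d1 d10 H1] := Hf _ e20; have [d2 d20 H2] := Hg _ e20.
exists (Num.min d1 d2); first by rewrite lt_min d10.
move=> h; rewrite lt_min => /andP[/H1 {}H1 /H2 {}H2].
have := lerD H1 H2; rewrite -mulrDl -splitr; apply: le_trans.
move: (f (z + h)) (f z) (g (z + h)) (g z) => fh f0 gh g0.
set r1 := (X in normc X + _); set r2 := (X in _ + normc X).
have -> : fh - gh - (f0 - g0) - (a - a') * h - (b - b') * h^* = r1 + (- r2).
  by rewrite /r1 /r2; ring.
by apply: le_trans (le_normcD _ _) _; rewrite normcN.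
Qed.

Lemma approxC_conjM g z a : approxC g z a 0 ->
  approxC (fun z => z^* * g z) z (z^* * a) (g z).
Proof.
move=> Hg e e0; pose M := normc z + normc a + 1 + 1.
have n0 := normcge0.
have M0 : 0 < M by rewrite /M !(ltr_wpDl, addr_ge0).
have [d1 d10 H1] := Hg _ (divr_gt0 e0 M0).
have [d2 d20 H2] := Hg _ ltr01.
exists (Num.min (Num.min d1 d2) (e / M)).
  by rewrite !lt_min d10 d20 divr_gt0.
move=> h; rewrite !lt_min => /andP[/andP[/H1 {}H1 /H2 {}H2] he].
move: H1 H2; rewrite !mul0r !subr0 mul1r.
have -> : (z + h)^* * g (z + h) - z^* * g z - z^* * a * h - g z * h^* =
   z^* * (g (z + h) - g z - a * h) + h^* * ((g (z + h) - g z - a * h) + a * h).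
  by rewrite rmorphD/=; ring.
move: (g (z + h) - g z - a * h) => r H1 H2.
apply: le_trans (le_normcD _ _) _; rewrite !normcM.
have nJ (x : R[i]) : normc x^* = normc x by case: x => x y; rewrite /normc/= sqrrN.
rewrite !nJ.
have H3 : normc (r + a * h) <= (1 + normc a) * normc h.
  by apply: le_trans (le_normcD _ _) _; rewrite normcM mulrDl mul1r lerD.
have H4 : normc z * normc r <= normc z * (e / M * normc h) by rewrite ler_wpM2l.
have H5 : normc h * normc (r + a * h) <= e / M * ((1 + normc a) * normc h).
  by rewrite ler_pM// ltW.
apply: le_trans (lerD H4 H5) _.
have -> : normc z * (e / M * normc h) + e / M * ((1 + normc a) * normc h) =
  e * normc h * ((M - 1) / M) by rewrite /M; field; rewrite -/M gt_eqF.
by rewrite ler_piMr ?mulr_ge0 ?(ltW e0)// ler_pdivrMr// mul1r lerBlDr lerDl.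
Qed.

Lemma measurable_disc : measurable disc.
Proof.
have sq1 (t : R) : (Num.sqrt t < 1) = (t < 1).
  by rewrite -[X in _ < X]sqrtr1 ltr_sqrt// sqrtr1.
have -> : disc = [set: plane] `&`
    (fun w : plane => w.1 ^+ 2 + w.2 ^+ 2) @^-1` `]-oo, 1[.
  apply/seteqP; split=> -[x y];
    by rewrite /disc/= in_itv/= sq1 => // -[].
have : measurable_fun [set: plane] (fun w : plane => w.1 ^+ 2 + w.2 ^+ 2).
  by apply: measurable_funD; apply: measurable_funX.
apply => //; exact: measurable_itv.
Qed.

Lemma normc_sqE (x : R[i]) : normc x ^+ 2 = Re x ^+ 2 + Im x ^+ 2.
Proof. by case: x => x y; rewrite /normc sqr_sqrtr ?addr_ge0 ?sqr_ge0. Qed.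

Lemma measurable_normc2 f : measurable_fun disc (reim f).1 ->
  measurable_fun disc (reim f).2 ->
  measurable_fun disc (fun w => (normc (f (cplx w)) ^+ 2)%:E).
Proof.
move=> m1 m2; apply/measurable_EFinP.
under eq_fun do rewrite normc_sqE.
by apply: measurable_funD; apply: measurable_funX.
Qed.

Lemma inL2_conjM g : inL2 g -> inL2 (fun z => z^* * g z).
Proof.
case=> m1 m2 gfin.
have c1 : measurable_fun disc (fst : plane -> R) by exact: measurable_funTS.
have c2 : measurable_fun disc (snd : plane -> R) by exact: measurable_funTS.
have n1 : measurable_fun disc (reim (fun z => z^* * g z)).1.
  refine (eq_measurable_fun (fun w : plane => w.1 * (reim g).1 w + w.2 * (reim g).2 w : R) _ _).
    by move=> [x y] _ /=; case: (g _) => a b /=; ring.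
  by apply: measurable_funD; apply: measurable_funM.
have n2 : measurable_fun disc (reim (fun z => z^* * g z)).2.
  refine (eq_measurable_fun (fun w : plane => w.1 * (reim g).2 w - w.2 * (reim g).1 w : R) _ _).
    by move=> [x y] _ /=; case: (g _) => a b /=; ring.
  by apply: measurable_funB; apply: measurable_funM.
split=> //; apply: le_lt_trans gfin; apply: ge0_le_integral => //.
- exact: measurable_disc.
- by move=> w _; rewrite lee_fin sqr_ge0.
- exact: (@measurable_normc2 (fun z => z^* * g z)).
- exact: (@measurable_normc2 g).
move=> w wD; rewrite lee_fin normcM exprMn ler_piMl ?sqr_ge0//.
have -> : normc (cplx w)^* = normc (cplx w) by case: w {wD} => x y; rewrite /normc/= sqrrN.
by rewrite expr_le1 ?normcge0// ltW.
Qed.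

Lemma inL2B f g : inL2 f -> inL2 g -> inL2 (fun z => f z - g z).
Proof.
move=> [f1 f2 ffin] [g1 g2 gfin].
have n1 : measurable_fun disc (reim (fun z => f z - g z)).1.
  refine (eq_measurable_fun (fun w : plane => (reim f).1 w - (reim g).1 w : R) _ _).
    by move=> w _ /=; case: (f _) (g _) => a b [].
  exact: measurable_funB.
have n2 : measurable_fun disc (reim (fun z => f z - g z)).2.
  refine (eq_measurable_fun (fun w : plane => (reim f).2 w - (reim g).2 w : R) _ _).
    by move=> w _ /=; case: (f _) (g _) => a b [].
  exact: measurable_funB.
have mD := measurable_disc.
have mf := measurable_normc2 f1 f2; have mg := measurable_normc2 g1 g2.
split=> //; apply: (@le_lt_trans _ _
  (\int[leb2]_(w in disc) (2%:E * ((normc (f (cplx w)) ^+ 2)%:E +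
                          (normc (g (cplx w)) ^+ 2)%:E)))%E).
  apply: ge0_le_integral => //.
  - by move=> w _; rewrite lee_fin sqr_ge0.
  - exact: (@measurable_normc2 (fun z => f z - g z)).
  - by apply: emeasurable_funM => //; apply: emeasurable_funD.
  move=> w _; rewrite -EFinD -EFinM lee_fin !normc_sqE.
  case: (f _) (g _) => a b [c d] /=.
  have := sqr_ge0 (a + c); have := sqr_ge0 (b + d); lra.
rewrite ge0_integralZl//; first last.
- by move=> w _; rewrite -EFinD lee_fin addr_ge0 ?sqr_ge0.
- exact: emeasurable_funD.
rewrite ge0_integralD//; first last.
- by move=> w _; rewrite lee_fin sqr_ge0.
- by move=> w _; rewrite lee_fin sqr_ge0.
apply: lte_mul_pinfty; [by rewrite lee_fin|exact: isT|exact: (lte_add_pinfty ffin gfin)].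
Qed.

Lemma canonical_solutionP g h : inA2 g ->
  is_canonical_solution g h <->
  is_bergman_proj (fun z => z^* * g z) (fun z => z^* * g z - h z).
Proof.
move=> [gh gL]; have zgL := inL2_conjM gL.
have gW z : normc z < 1 -> exists a, approxC g z a 0.
  by move=> /gh /derivable_approxC.
have subKf : (fun z => z^* * g z - (z^* * g z - h z)) = h.
  by apply/funext => z; rewrite subKr.
split=> [[hL hd ho]|[[hh hL] ho]].
  split=> [|k kA]; last by rewrite [X in inner X _]subKf; exact: ho.
  split; last exact: inL2B.
  move=> z z1; apply/derivable_approxC.
  have [a Ha] := gW _ z1; have [hr hb] := hd _ z1.
  have [a' Ha'] := real_differentiable_approxC hr.
  exists (z^* * a - a').
  by have := approxCB (approxC_conjM Ha) Ha'; rewrite hb subrr.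
split.
- by rewrite -subKf; exact: inL2B.
- move=> z z1; have [a Ha] := gW _ z1.
  have /derivable_approxC[a' Ha'] := hh z z1.
  have := approxCB (approxC_conjM Ha) Ha'.
  by rewrite subKf subr0 => /approxC_real.
- by move=> k kA; rewrite -[in LHS]subKf; exact: ho.
Qed.

Lemma S1_canonical_solution g : inA2 g ->
  (exists p, is_bergman_proj (fun z => z^* * g z) p) ->
  is_canonical_solution g (S1 g).
Proof.
move=> gA [p Hp]; apply/(canonical_solutionP _ gA).
have -> : (fun z => z^* * g z - S1 g z) = bergman_proj (fun z => z^* * g z).
  by apply/funext => z; rewrite /S1 subKr.
exact: (@xgetPex _ (fun=> 0 : R[i]) [set p | is_bergman_proj _ p]) (ex_intro _ p Hp).
Qed.
End Bergman.

(* Main.v *)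
From HB Require Import structures.
From mathcomp Require Import all_boot all_order all_algebra.
From mathcomp Require Import complex ring lra.
From mathcomp Require Import all_classical all_reals all_analysis.
From mathcomp Require Import measurable_realfun.
Require Import Defs.

(* Fix f holomorphic on the disc and |c| < 1.  Deforming the circle |w| = |z| to
   the point |z|^2 c, which amounts to Goursat's lemma for a closed form on a
   rectangle, gives
     mean over |w| = |z| of f(w) / (1 - c wbar) = f(|z|^2 c),
   because w - |z|^2 c = w (1 - c wbar) on that circle.  Lebesgue measure on the
   plane is rotation invariant and |z|^2 is uniformly distributed on the disc, so
     int_D f(w) / (1 - c wbar) = pi int_0^1 f(t c) dt.
   If f is orthogonal to all monomials, the left-hand side vanishes for every c by
   the geometric series, and differentiating the primitive of t |-> f(t c) yields
   f = 0: the monomials are complete.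

   The kernel 1 / (pi (1 - z wbar)^2) then defines the orthogonal projection: its
   expansion in powers of wbar shows that the integral operator is the pointwise
   limit of the Fourier sums, and Fatou's lemma upgrades this to convergence in L^2.
   Finally ||S1 u_n||^2 is the squared distance of zbar u_n to A^2, at most
   1 / ((n + 1) (n + 2)). *)

Set Implicit Arguments.
Unset Strict Implicit.
Unset Printing Implicit Defensive.
Import Order.TTheory GRing.Theory Num.Theory.
Import numFieldNormedType.Exports.
Import ComplexField.Normc.
Local Open Scope classical_set_scope.
Local Open Scope complex_scope.
Local Open Scope ring_scope.

(** * Complex-valued integrals *)

(** Holomorphy is bare complex differentiability at each point of the disc; neither continuity of
    the derivative nor power series are presupposed. Hence Goursat's bisection, and hence the
    parametrisation Z = c' + exp(s) (w - c') of the deformation, with c' = |z|^2 c: in the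
    coordinates (s, t) the form f(Z) dZ / (Z - c') has the regular coefficients f(Z) and i f(Z) / (1
    - c wbar), and the centre is reached only in the limit s -> -oo.

    [bergman_proj] is a choice with default value 0, so the content behind [S1] is that every L^2
    function has a projection. No completeness of A^2 enters: the kernel integral is holomorphic by
    direct differentiation, and Fatou's lemma, which asks for no prior bound on its norm, places it
    in L^2.

    In the radial change of variables the area of the disc is at first an unknown constant; a
    Gaussian test function identifies it as pi.

    The bound on ||S1 u_n||^2 is (n + 1) / (n + 2) - n / (n + 1), the squared norm of zbar u_n minus
    that of its projection. *)

Section ComplexNumbers.
Variable R : realType.
Local Notation Re := complex.Re.
Local Notation Im := complex.Im.
Implicit Types (x y z : R[i]) (r : R).

Lemma complex_ext x y : Re x = Re y -> Im x = Im y -> x = y.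
Proof. by case: x y => a b [c d] /= -> ->. Qed.

Lemma ReD x y : Re (x + y) = Re x + Re y. Proof. by case: x y => a b []. Qed.
Lemma ImD x y : Im (x + y) = Im x + Im y. Proof. by case: x y => a b []. Qed.
Lemma ReN x : Re (- x) = - Re x. Proof. by case: x. Qed.
Lemma ImN x : Im (- x) = - Im x. Proof. by case: x. Qed.
Lemma ReM x y : Re (x * y) = Re x * Re y - Im x * Im y.
Proof. by case: x y => a b []. Qed.
Lemma ImM x y : Im (x * y) = Re x * Im y + Im x * Re y.
Proof. by case: x y => a b []. Qed.
Lemma ReJ x : Re (x^*) = Re x. Proof. by case: x. Qed.
Lemma ImJ x : Im (x^*) = - Im x. Proof. by case: x. Qed.
Lemma ReC r : Re (r%:C) = r. Proof. by []. Qed.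
Lemma ImC r : Im (r%:C) = 0. Proof. by []. Qed.

Lemma Re_i : Re ('i%C : R[i]) = 0. Proof. by []. Qed.
Lemma Im_i : Im ('i%C : R[i]) = 1. Proof. by []. Qed.
Lemma Re_pair (a b : R) : Re (a +i* b) = a. Proof. by []. Qed.
Lemma Im_pair (a b : R) : Im (a +i* b) = b. Proof. by []. Qed.

(** After [complex_ext], these rules turn an identity in R[i], conjugates included, into two real
    polynomial identities within reach of [ring]. *)
Definition reimE := (Re_i, Im_i, Re_pair, Im_pair,
  ReD, ImD, ReN, ImN, ReM, ImM, ReJ, ImJ, ReC, ImC).

Lemma normc_conj x : normc (x^*) = normc x.
Proof. by case: x => a b; rewrite /normc/= sqrrN. Qed.

Lemma normc_real r : normc r%:C = `|r|.
Proof. by rewrite /normc/= expr0n/= addr0 sqrtr_sqr. Qed.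

Lemma ler_normc_Re x : `|Re x| <= normc x.
Proof.
by case: x => a b; apply: le_trans (normc_ge_max a b); rewrite prod_normE/= le_max lexx.
Qed.

Lemma ler_normc_Im x : `|Im x| <= normc x.
Proof.
by case: x => a b; apply: le_trans (normc_ge_max a b); rewrite prod_normE/= le_max lexx orbT.
Qed.

Lemma normc_le_ReIm x : normc x <= `|Re x| + `|Im x|.
Proof. by case: x => a b; exact: normc_le_add. Qed.

Lemma normcX x n : normc (x ^+ n) = normc x ^+ n.
Proof. by elim: n => [|n ih]; rewrite ?expr0 ?normc1// !exprS normcM ih. Qed.

Lemma mul_conjc x : x * x^* = (normc x ^+ 2)%:C.
Proof.
apply: complex_ext; rewrite !reimE; last by ring.
by rewrite normc_sqE; ring.
Qed.

Lemma realCM r s : (r * s)%:C = r%:C * s%:C :> R[i].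
Proof. by apply: complex_ext; rewrite !reimE; ring. Qed.

Lemma le_normcB x y : normc (x - y) <= normc x + normc y.
Proof. by rewrite -[in leRHS](normcN y); exact: le_normcD. Qed.

Lemma ler_normcB x y : normc x - normc y <= normc (x - y).
Proof. by rewrite lerBlDr -[in leLHS](subrK y x); exact: le_normcD. Qed.

Lemma normc_gt0 x : (0 < normc x) = (x != 0).
Proof.
rewrite lt_def normcge0 andbT; apply/idP/idP; apply: contra.
  by move=> /eqP ->; rewrite normc0.
by move=> /eqP /eq0_normc ->.
Qed.

Lemma normc_distC x y : normc (x - y) = normc (y - x).
Proof. by rewrite -normcN opprB. Qed.

Lemma ler_dist_normc x y : `|normc x - normc y| <= normc (x - y).
Proof.
by rewrite ler_norml ler_normcB lerBrDr -lerBrDl opprK addrC -lerBlDr normc_distC ler_normcB.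
Qed.

End ComplexNumbers.

Section ComplexIntegral.
Variable R : realType.
Local Notation Re := complex.Re.
Local Notation Im := complex.Im.
Context d (T : measurableType d) (mu : {measure set T -> \bar R}) (D : set T).
Hypothesis mD : measurable D.
Implicit Types (F G : T -> R[i]) (g : T -> R) (c : R[i]).

(** Componentwise, so that [inner] is an instance by mere unfolding ([innerE]). *)
Definition cint F : R[i] :=
  (\int[mu]_(x in D) Re (F x)) +i* (\int[mu]_(x in D) Im (F x)).

Definition cintegrable F :=
  mu.-integrable D (EFin \o (fun x => Re (F x))) /\
  mu.-integrable D (EFin \o (fun x => Im (F x))).

Definition cmeasurable F :=
  measurable_fun D (fun x => Re (F x)) /\ measurable_fun D (fun x => Im (F x)).

Lemma eq_cint F G : (forall x, D x -> F x = G x) -> cint F = cint G.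
Proof.
by move=> FG; congr (_ +i* _); apply: eq_Rintegral => x /set_mem Dx; rewrite FG.
Qed.

Lemma eq_cintegrable F G : (forall x, D x -> F x = G x) ->
  cintegrable F -> cintegrable G.
Proof.
move=> FG [F1 F2]; split.
  by apply: eq_integrable F1 => // x /set_mem Dx /=; rewrite FG.
by apply: eq_integrable F2 => // x /set_mem Dx /=; rewrite FG.
Qed.

Lemma eq_cmeasurable F G : (forall x, D x -> F x = G x) ->
  cmeasurable F -> cmeasurable G.
Proof.
move=> FG [F1 F2]; split.
  by apply: eq_measurable_fun F1 => // x /set_mem Dx /=; rewrite FG.
by apply: eq_measurable_fun F2 => // x /set_mem Dx /=; rewrite FG.
Qed.

Lemma cintegrable_meas F : cintegrable F -> cmeasurable F.
Proof.
by move=> [/measurable_int/measurable_EFinP F1 /measurable_int/measurable_EFinP F2].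
Qed.

Lemma cmeasurableD F G : cmeasurable F -> cmeasurable G ->
  cmeasurable (fun x => F x + G x).
Proof.
move=> [F1 F2] [G1 G2]; split.
- by under eq_fun do rewrite ReD; exact: measurable_funD.
- by under eq_fun do rewrite ImD; exact: measurable_funD.
Qed.

Lemma cmeasurableB F G : cmeasurable F -> cmeasurable G ->
  cmeasurable (fun x => F x - G x).
Proof.
move=> [F1 F2] [G1 G2]; split.
- by under eq_fun do rewrite ReD ReN; exact: measurable_funB.
- by under eq_fun do rewrite ImD ImN; exact: measurable_funB.
Qed.

Lemma cmeasurableM F G : cmeasurable F -> cmeasurable G ->
  cmeasurable (fun x => F x * G x).
Proof.
move=> [F1 F2] [G1 G2]; split.
- under eq_fun do rewrite ReM.
  by apply: measurable_funB; apply: measurable_funM.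
- under eq_fun do rewrite ImM.
  by apply: measurable_funD; apply: measurable_funM.
Qed.

Lemma cmeasurableJ F : cmeasurable F -> cmeasurable (fun x => (F x)^*).
Proof.
move=> [F1 F2]; split.
- by under eq_fun do rewrite ReJ.
- by under eq_fun do rewrite ImJ; exact: measurableT_comp.
Qed.

Lemma cmeasurable_cst c : cmeasurable (fun=> c).
Proof. by split; exact: measurable_cst. Qed.

Lemma cmeasurableX F n : cmeasurable F -> cmeasurable (fun x => F x ^+ n).
Proof.
move=> mF; elim: n => [|n ih]; first exact: (cmeasurable_cst 1).
under (@eq_fun _ _ (fun x => F x ^+ n.+1)) do rewrite exprS.
exact: cmeasurableM.
Qed.

Lemma measurable_normc F : cmeasurable F -> measurable_fun D (fun x => normc (F x)).
Proof.
move=> [F1 F2].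
have -> : (fun x => normc (F x)) = (fun x => Num.sqrt (Re (F x) ^+ 2 + Im (F x) ^+ 2)).
  by apply/funext => x; case: (F x).
apply: (@measurableT_comp _ _ _ _ _ _ (Num.sqrt : R -> R)) => //.
  exact: (continuous_measurable_fun (@sqrt_continuous R)).
by apply: measurable_funD; apply: measurable_funX.
Qed.

Lemma cintegrable_dom F g : cmeasurable F -> mu.-integrable D (EFin \o g) ->
  (forall x, D x -> normc (F x) <= g x) -> cintegrable F.
Proof.
move=> [F1 F2] ig Fg; split.
- apply: le_integrable ig => //; first exact/measurable_EFinP.
  move=> x Dx /=; rewrite lee_fin; apply: le_trans (ler_normc_Re _) _.
  exact: le_trans (Fg x Dx) (ler_norm _).
- apply: le_integrable ig => //; first exact/measurable_EFinP.
  move=> x Dx /=; rewrite lee_fin; apply: le_trans (ler_normc_Im _) _.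
  exact: le_trans (Fg x Dx) (ler_norm _).
Qed.

Lemma cintegrable_normc F : cintegrable F ->
  mu.-integrable D (EFin \o (fun x => normc (F x))).
Proof.
move=> [F1 F2]; have [m1 m2] := cintegrable_meas (conj F1 F2).
apply: (@le_integrable _ _ _ mu D mD _ (EFin \o (fun x => `|Re (F x)| + `|Im (F x)|))).
- by apply/measurable_EFinP; exact: measurable_normc.
- move=> x _ /=; rewrite lee_fin ger0_norm ?normcge0//.
  exact: le_trans (normc_le_ReIm _) (ler_norm _).
- have -> : EFin \o (fun x => `|Re (F x)| + `|Im (F x)|) =
    (EFin \o (Num.norm \o (fun x => Re (F x)))) \+ (EFin \o (Num.norm \o (fun x => Im (F x)))).
    by apply/funext => x /=; rewrite EFinD.
  by apply: integrableD => //; exact: integrable_norm.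
Qed.

Lemma cintegrableD F G : cintegrable F -> cintegrable G ->
  cintegrable (fun x => F x + G x).
Proof.
move=> [F1 F2] [G1 G2]; split.
- by apply: eq_integrable (integrableD mD F1 G1) => // x _; rewrite /= ReD.
- by apply: eq_integrable (integrableD mD F2 G2) => // x _; rewrite /= ImD.
Qed.

Lemma cintD F G : cintegrable F -> cintegrable G ->
  cint (fun x => F x + G x) = cint F + cint G.
Proof.
move=> [F1 F2] [G1 G2]; rewrite /cint; apply: complex_ext => /=.
- by under eq_Rintegral do rewrite ReD; exact: RintegralD.
- by under eq_Rintegral do rewrite ImD; exact: RintegralD.
Qed.

Lemma cintegrableZ c F : cintegrable F -> cintegrable (fun x => c * F x).
Proof.
move=> iF; have mF := cintegrable_meas iF; have nF := cintegrable_normc iF.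
apply: (@cintegrable_dom _ (fun x => normc c * normc (F x))).
- exact: (cmeasurableM (cmeasurable_cst c)).
- exact: (integrableZl mD (normc c) nF).
- by move=> x _; rewrite normcM.
Qed.

Lemma cintZ c F : cintegrable F -> cint (fun x => c * F x) = c * cint F.
Proof.
move=> [F1 F2]; apply: complex_ext.
- rewrite ReM; transitivity (\int[mu]_(x in D) (Re c * Re (F x) - Im c * Im (F x))).
    by apply: eq_Rintegral => x _; rewrite ReM.
  rewrite (@RintegralB _ _ _ mu D (fun x => Re c * Re (F x)) (fun x => Im c * Im (F x)))//.
  + by rewrite (RintegralZl _ mD F1) (RintegralZl _ mD F2).
  + exact: (integrableZl mD (Re c) F1).
  + exact: (integrableZl mD (Im c) F2).
- rewrite ImM; transitivity (\int[mu]_(x in D) (Re c * Im (F x) + Im c * Re (F x))).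
    by apply: eq_Rintegral => x _; rewrite ImM.
  rewrite (@RintegralD _ _ _ mu D (fun x => Re c * Im (F x)) (fun x => Im c * Re (F x)))//.
  + by rewrite (RintegralZl _ mD F2) (RintegralZl _ mD F1).
  + exact: (integrableZl mD (Re c) F2).
  + exact: (integrableZl mD (Im c) F1).
Qed.

Lemma cintegrableB F G : cintegrable F -> cintegrable G ->
  cintegrable (fun x => F x - G x).
Proof.
move=> iF iG; apply: (@eq_cintegrable (fun x => F x + (-1) * G x)).
  by move=> x _; rewrite mulN1r.
by apply: cintegrableD => //; exact: cintegrableZ.
Qed.

Lemma cintB F G : cintegrable F -> cintegrable G ->
  cint (fun x => F x - G x) = cint F - cint G.
Proof.
move=> iF iG; rewrite (@eq_cint _ (fun x => F x + (-1) * G x)); last first.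
  by move=> x _; rewrite mulN1r.
by rewrite cintD// ?cintZ// ?mulN1r//; exact: cintegrableZ.
Qed.

Lemma cint0 : cint (fun=> 0) = 0.
Proof. by rewrite /cint /= Rintegral_cst// mul0r. Qed.

Lemma cintegrable0 : cintegrable (fun=> 0).
Proof. by split; exact: integrable0. Qed.

Lemma cintegrable_sum n (F : nat -> T -> R[i]) : (forall i, cintegrable (F i)) ->
  cintegrable (fun x => \sum_(i < n) F i x).
Proof.
move=> iF; elim: n => [|n ih].
  by apply: eq_cintegrable cintegrable0 => x _; rewrite big_ord0.
apply: eq_cintegrable (cintegrableD ih (iF n)) => x _.
by rewrite big_ord_recr.
Qed.

Lemma cint_sum n (F : nat -> T -> R[i]) : (forall i, cintegrable (F i)) ->
  cint (fun x => \sum_(i < n) F i x) = \sum_(i < n) cint (F i).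
Proof.
move=> iF; elim: n => [|n ih].
  by rewrite big_ord0 -[RHS]cint0; apply: eq_cint => x _; rewrite big_ord0.
rewrite big_ord_recr/= -ih -cintD//; last exact: cintegrable_sum.
by apply: eq_cint => x _; rewrite big_ord_recr.
Qed.

Lemma cintJ F : cintegrable F -> cint (fun x => (F x)^*) = (cint F)^*.
Proof.
move=> [F1 F2]; apply: complex_ext; rewrite ?ReJ ?ImJ /cint/=.
  by apply: eq_Rintegral => x _; rewrite ReJ.
under eq_Rintegral do rewrite ImJ -mulN1r.
by rewrite RintegralZl// mulN1r.
Qed.

(* The constant 2 is not sharp. *)
Lemma normc_cint_le F g : cmeasurable F -> mu.-integrable D (EFin \o g) ->
  (forall x, D x -> normc (F x) <= g x) ->
  normc (cint F) <= 2 * \int[mu]_(x in D) g x.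
Proof.
move=> mF ig Fg; have [F1 F2] := cintegrable_dom mF ig Fg.
apply: le_trans (normc_le_ReIm _) _; rewrite mulr_natl mulr2n /cint/=.
apply: lerD; (apply: le_trans (le_normr_Rintegral _ _) _ => //);
  apply: le_Rintegral => //; do ?exact: integrable_norm => //.
- by move=> x Dx; apply: le_trans (ler_normc_Re _) (Fg _ Dx).
- by move=> x Dx; apply: le_trans (ler_normc_Im _) (Fg _ Dx).
Qed.

End ComplexIntegral.

(** * Goursat's lemma for closed forms on a rectangle *)

Section SegmentIntegrals.
Variable R : realType.
Local Notation mu := (@lebesgue_measure R).
Implicit Types (f g : R -> R) (a b c x y : R).

Lemma continuous_segment_integrable f a b :
  (forall x, a <= x <= b -> {for x, continuous f}) ->
  mu.-integrable `[a, b] (EFin \o f).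
Proof.
move=> cf; apply: continuous_compact_integrable; first exact: segment_compact.
apply: continuous_in_subspaceT => x /set_mem /=; rewrite in_itv/= => xab.
exact: cf.
Qed.

Lemma Rintegral_segment_split f a b c : a <= c -> c <= b ->
  mu.-integrable `[a, b] (EFin \o f) ->
  \int[mu]_(x in `[a, b]) f x =
  \int[mu]_(x in `[a, c]) f x + \int[mu]_(x in `[c, b]) f x.
Proof.
move=> ac cb intf.
have := @Rintegral_itvB R f (BLeft a) (BRight b) c intf.
rewrite !bnd_simp => /(_ ac cb) /eqP; rewrite subr_eq => /eqP ->.
rewrite addrC Rintegral_itv_obnd_cbnd//.
apply: integrableS intf => //; apply: subset_itvr; rewrite bnd_simp; exact: ac.
Qed.

Lemma Rintegral_segment_cst a b c : a <= b ->
  \int[mu]_(x in `[a, b]) c = c * (b - a).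
Proof.
move=> ab; rewrite Rintegral_cst//=; rewrite lebesgue_measure_itv/= lte_fin.
move: ab; rewrite le_eqVlt => /predU1P[->|->//].
by rewrite ltxx subrr.
Qed.

Lemma le_norm_Rintegral_segment f a b M : a <= b ->
  mu.-integrable `[a, b] (EFin \o f) ->
  (forall x, a <= x <= b -> `|f x| <= M) ->
  `|\int[mu]_(x in `[a, b]) f x| <= M * (b - a).
Proof.
move=> ab intf fM; apply: le_trans (le_normr_Rintegral _ intf) _ => //.
rewrite -Rintegral_segment_cst//; apply: le_Rintegral => //.
- exact: integrable_norm.
- by apply: continuous_segment_integrable => x _; exact: cvg_cst.
Qed.

Lemma differentiable_continuous_hor (U : R * R -> R) x y :
  differentiable U (x, y) -> {for x, continuous (fun t => U (t, y))}.
Proof.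
move=> /differentiable_continuous cU.
apply: (@continuous_comp _ _ _ (fun t : R => (t, y)) U); last exact: cU.
have h1 : t @[t --> x] --> x by exact: cvg_id.
have h2 : y @[t --> x] --> y by exact: cvg_cst.
exact: (cvg_pair h1 h2).
Qed.

Lemma differentiable_continuous_ver (U : R * R -> R) x y :
  differentiable U (x, y) -> {for y, continuous (fun t => U (x, t))}.
Proof.
move=> /differentiable_continuous cU.
apply: (@continuous_comp _ _ _ (fun t : R => (x, t)) U); last exact: cU.
have h1 : t @[t --> y] --> y by exact: cvg_id.
have h2 : x @[t --> y] --> x by exact: cvg_cst.
exact: (cvg_pair h2 h1).
Qed.

(** The supremum of the left endpoints works: each left endpoint is below each right endpoint,
    whichever of the two segments contains the other. *)
Lemma nested_segments (u d : nat -> R) :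
  (forall m n, (m <= n)%N -> u m <= u n /\ u n + d n <= u m + d m) ->
  (forall n, 0 <= d n) -> exists x, forall n, u n <= x <= u n + d n.
Proof.
move=> ud d0.
have le m n : u m <= u n + d n.
  case: (leqP m n) => [mn|/ltnW nm].
    by apply: le_trans (ud _ _ mn).1 _; rewrite lerDl.
  by apply: le_trans (ud _ _ nm).2; rewrite lerDl.
have ub n : ubound (range u) (u n + d n) by move=> _ [m _ <-].
exists (sup (range u)) => n; apply/andP; split.
  by apply: ub_le_sup; [exists (u 0%N + d 0%N)|exists n].
by apply: ge_sup => //; exists (u 0%N), 0%N.
Qed.

End SegmentIntegrals.

Section Goursat.
Variable R : realType.
Local Notation mu := (@lebesgue_measure R).
Variables (P Q : R * R -> R) (x0 y0 A B : R).
Hypotheses (A0 : 0 <= A) (B0 : 0 <= B).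
(** The shared [q] expresses that P dx + Q dy is closed: it is both dP/dy and dQ/dx. *)
Hypothesis closedPQ : forall x y, x0 <= x <= x0 + A -> y0 <= y <= y0 + B ->
  exists p q r, approx2 P (x, y) p q /\ approx2 Q (x, y) q r.

Let hor (U : R * R -> R) y a b := \int[mu]_(t in `[a, b]) U (t, y).
Let ver (U : R * R -> R) x a b := \int[mu]_(t in `[a, b]) U (x, t).
(** Counterclockwise integral of P dx + Q dy around the copy of the rectangle scaled by [l] with
    lower left corner (x, y). Keeping the proportions A : B fixed lets bisection act on the single
    number [l]. *)
Let J x y l := hor P y x (x + l * A) - hor P (y + l * B) x (x + l * A)
  + ver Q (x + l * A) y (y + l * B) - ver Q x y (y + l * B).

Let inside x y l := [/\ x0 <= x, x + l * A <= x0 + A, y0 <= y & y + l * B <= y0 + B].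

Let hor_int y a b : y0 <= y <= y0 + B -> x0 <= a -> b <= x0 + A ->
  mu.-integrable `[a, b] (EFin \o (fun t => P (t, y))).
Proof.
move=> yB xa bA; apply: continuous_segment_integrable => x /andP[ax xb].
have [|p [q [r [/approx2_diff[dP _ _] _]]]] := @closedPQ x y _ yB.
  by rewrite (le_trans xa)//= (le_trans xb).
exact: (differentiable_continuous_hor dP).
Qed.

Let ver_int x a b : x0 <= x <= x0 + A -> y0 <= a -> b <= y0 + B ->
  mu.-integrable `[a, b] (EFin \o (fun t => Q (x, t))).
Proof.
move=> xA ya bB; apply: continuous_segment_integrable => y /andP[ay yb].
have [|p [q [r [_ /approx2_diff[dQ _ _]]]]] := @closedPQ x y xA.
  by rewrite (le_trans ya)//= (le_trans yb).
exact: (differentiable_continuous_ver dQ).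
Qed.

Let J_split x y l : 0 <= l -> inside x y l ->
  J x y l = J x y (l / 2) + J (x + l / 2 * A) y (l / 2)
   + J x (y + l / 2 * B) (l / 2) + J (x + l / 2 * A) (y + l / 2 * B) (l / 2).
Proof.
move=> l0 [xa xb ya yb].
have lA : 0 <= l / 2 * A by rewrite mulr_ge0// divr_ge0.
have lB : 0 <= l / 2 * B by rewrite mulr_ge0// divr_ge0.
have eA : l * A = l / 2 * A + l / 2 * A by field.
have eB : l * B = l / 2 * B + l / 2 * B by field.
have sh z : y0 <= z <= y0 + B ->
    hor P z x (x + l * A) = hor P z x (x + l / 2 * A) +
      hor P z (x + l / 2 * A) (x + l / 2 * A + l / 2 * A).
  move=> zB; rewrite /hor -addrA -eA; apply: Rintegral_segment_split.
  - by rewrite lerDl.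
  - by rewrite eA addrA lerDl.
  - exact: hor_int.
have sv z : x0 <= z <= x0 + A ->
    ver Q z y (y + l * B) = ver Q z y (y + l / 2 * B) +
      ver Q z (y + l / 2 * B) (y + l / 2 * B + l / 2 * B).
  move=> zA; rewrite /ver -addrA -eB; apply: Rintegral_segment_split.
  - by rewrite lerDl.
  - by rewrite eB addrA lerDl.
  - exact: ver_int.
rewrite /J !sh ?sv; do ?(apply/andP; split); rewrite ?eA ?eB; try lra.
rewrite !addrA; ring.
Qed.

(** The threshold scales like the area, so it is inherited by a quarter with the same [e]. *)
Let bad e x y l := [/\ 0 < l, inside x y l & e * l ^+ 2 < `|J x y l|].

(** Four quarters all within e (l / 2)^2 would add up, by [J_split], to at most e l^2. *)
Let bad_quarter e x y l : bad e x y l -> exists x' y',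
  [/\ x <= x', x' + l / 2 * A <= x + l * A, y <= y', y' + l / 2 * B <= y + l * B &
     bad e x' y' (l / 2)].
Proof.
move=> [l0 ins Jl]; have [xa xb ya yb] := ins.
have lA : 0 <= l / 2 * A by rewrite mulr_ge0// divr_ge0// ltW.
have lB : 0 <= l / 2 * B by rewrite mulr_ge0// divr_ge0// ltW.
have eA : l * A = l / 2 * A + l / 2 * A by field.
have eB : l * B = l / 2 * B + l / 2 * B by field.
have l20 : 0 < l / 2 by rewrite divr_gt0.
apply: contrapT => /forallNP H.
have small x' y' : x <= x' -> x' + l / 2 * A <= x + l * A -> y <= y' ->
    y' + l / 2 * B <= y + l * B -> `|J x' y' (l / 2)| <= e * (l / 2) ^+ 2.
  move=> h1 h2 h3 h4; rewrite leNgt; apply/negP => h.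
  apply: (H x'); exists y'; split => //; split => //; split; lra.
move: Jl; apply/negP; rewrite -leNgt J_split//; last exact: ltW.
have -> : e * l ^+ 2 = e * (l / 2) ^+ 2 + e * (l / 2) ^+ 2 + e * (l / 2) ^+ 2
  + e * (l / 2) ^+ 2 by field.
do 3 (apply: le_trans (ler_normD _ _) _; apply: lerD; last by apply: small; lra).
by apply: small; lra.
Qed.

Let bad_sequence e : bad e x0 y0 1 -> exists u v : nat -> R,
  [/\ forall n, bad e (u n) (v n) (2^-1 ^+ n),
   forall m n, (m <= n)%N -> u m <= u n /\ u n + 2^-1 ^+ n * A <= u m + 2^-1 ^+ m * A &
   forall m n, (m <= n)%N -> v m <= v n /\ v n + 2^-1 ^+ n * B <= v m + 2^-1 ^+ m * B].
Proof.
move=> b0.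
(* The selection of a bad quarter is made total, so that it can be iterated by a plain fixpoint; on
   a rectangle that is not bad its value is arbitrary. *)
have /choice[s Hs] : forall w : R * R * R, exists w' : R * R, bad e w.1.1 w.1.2 w.2 ->
    [/\ w.1.1 <= w'.1, w'.1 + w.2 / 2 * A <= w.1.1 + w.2 * A, w.1.2 <= w'.2,
        w'.2 + w.2 / 2 * B <= w.1.2 + w.2 * B & bad e w'.1 w'.2 (w.2 / 2)].
  move=> [[x y] l] /=; have [/bad_quarter[x' [y' H]]|nb] := pselect (bad e x y l).
    by exists (x', y').
  by exists (x, y).
pose w := fix w n : R * R := if n is n'.+1 then s (w n', 2^-1 ^+ n') else (x0, y0).
have bw n : bad e (w n).1 (w n).2 (2^-1 ^+ n).
  elim: n => [|n ih]; first by rewrite expr0.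
  by have [_ _ _ _] := Hs (w n, 2^-1 ^+ n) ih; rewrite /= exprSr.
have st n := Hs (w n, 2^-1 ^+ n) (bw n).
exists (fun n => (w n).1), (fun n => (w n).2); split => //.
- move=> m n /subnK <-; elim: (n - m)%N => [//|k [ih1 ih2]].
  have [h1 h2 _ _ _] := st (k + m)%N; rewrite addSn /= exprSr; split.
    exact: le_trans ih1 h1.
  exact: le_trans h2 ih2.
- move=> m n /subnK <-; elim: (n - m)%N => [//|k [ih1 ih2]].
  have [_ _ h1 h2 _] := st (k + m)%N; rewrite addSn /= exprSr; split.
    exact: le_trans ih1 h1.
  exact: le_trans h2 ih2.
Qed.

(* Only first-order terms survive, and those cancel as dP/dy = dQ/dx at [(X, Y)]. *)
Let local_estimate e X Y : 0 < e -> x0 <= X <= x0 + A -> y0 <= Y <= y0 + B ->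
  exists2 d : R, 0 < d & forall x y l, 0 < l -> inside x y l ->
    x <= X <= x + l * A -> y <= Y <= y + l * B -> l * (A + B) < d ->
    `|J x y l| <= e * l ^+ 2.
Proof.
move=> e0 XA YB; have [p [q [r [HP HQ]]]] := closedPQ XA YB.
(* With L = l (A + B), the integrands below are at most 2 (e / C) L and the two integration lengths
   add up to L, for a total of e l^2 times 2 (A + B)^2 / C. The added 1 keeps C positive for a
   degenerate rectangle. *)
pose C := 2 * (A + B) ^+ 2 + 1.
have C0 : 0 < C by rewrite /C ltr_wpDl// mulr_ge0// sqr_ge0.
have [d1 d10 H1] := HP _ (divr_gt0 e0 C0); have [d2 d20 H2] := HQ _ (divr_gt0 e0 C0).
exists (Num.min d1 d2); first by rewrite lt_min d10.
move=> x y l l0 ins /andP[xX Xx] /andP[yY Yy]; rewrite lt_min => /andP[ld1 ld2].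
have [xa xb ya yb] := ins.
set L := l * (A + B) in ld1 ld2.
have lA : 0 <= l * A by rewrite mulr_ge0// ltW.
have lB : 0 <= l * B by rewrite mulr_ge0// ltW.
have LE : L = l * A + l * B by rewrite /L mulrDr.
have dist s t : x <= s <= x + l * A -> y <= t <= y + l * B ->
    `|(s - X, t - Y) : R * R| <= L.
  move=> /andP[s1 s2] /andP[t1 t2]; rewrite prod_normE/= ge_max !ler_norml.
  by apply/andP; split; apply/andP; split; lra.
have bnd (U : R * R -> R) a b k s t : (forall h : R * R, `|h| < k ->
      `|U (h + (X, Y)) - U (X, Y) - lin2 a b h| <= e / C * `|h|) -> L < k ->
    x <= s <= x + l * A -> y <= t <= y + l * B ->
    `|U (s, t) - U (X, Y) - (a * (s - X) + b * (t - Y))| <= e / C * L.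
  move=> H Lk hs ht; have D := dist _ _ hs ht.
  have := H (s - X, t - Y) (le_lt_trans D Lk).
  have -> : (s - X, t - Y) + (X, Y) = (s, t) :> R * R.
    by congr pair => /=; rewrite subrK.
  by move=> /le_trans; apply; rewrite ler_wpM2l// ltW// divr_gt0.
have hP s : x <= s <= x + l * A ->
    `|P (s, y) - P (s, y + l * B) - (- (q * (l * B)))| <= 2 * (e / C * L).
  move=> hs.
  have := bnd _ _ _ _ s y H1 ld1 hs; rewrite lexx lerDl => /(_ lB) b1.
  have := bnd _ _ _ _ s (y + l * B) H1 ld1 hs; rewrite lexx lerDl andbT => /(_ lB) b2.
  have := lerD b1 b2; rewrite -mulr2n -[X in _ <= X -> _]mulr_natl.
  apply: le_trans; apply: le_trans (ler_normB _ _).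
  by rewrite le_eqVlt; apply/orP; left; apply/eqP; congr `|_|; ring.
have hQ t : y <= t <= y + l * B ->
    `|Q (x + l * A, t) - Q (x, t) - q * (l * A)| <= 2 * (e / C * L).
  move=> ht.
  have := bnd _ _ _ _ x t H2 ld2; rewrite lexx lerDl => /(_ lA ht) b1.
  have := bnd _ _ _ _ (x + l * A) t H2 ld2; rewrite lexx lerDl andbT => /(_ lA ht) b2.
  have := lerD b2 b1; rewrite -mulr2n -[X in _ <= X -> _]mulr_natl.
  apply: le_trans; apply: le_trans (ler_normB _ _).
  by rewrite le_eqVlt; apply/orP; left; apply/eqP; congr `|_|; ring.
have i1 : mu.-integrable `[x, x + l * A] (EFin \o (fun t => P (t, y))).
  by apply: hor_int => //; lra.
have i2 : mu.-integrable `[x, x + l * A] (EFin \o (fun t => P (t, y + l * B))).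
  by apply: hor_int => //; lra.
have i3 : mu.-integrable `[y, y + l * B] (EFin \o (fun t => Q (x + l * A, t))).
  by apply: ver_int => //; lra.
have i4 : mu.-integrable `[y, y + l * B] (EFin \o (fun t => Q (x, t))).
  by apply: ver_int => //; lra.
have ic a b (k : R) : mu.-integrable `[a, b] (EFin \o (fun=> k)).
  by apply: continuous_segment_integrable => ? _; exact: cvg_cst.
have -> : J x y l =
    \int[mu]_(t in `[x, x + l * A]) (P (t, y) - P (t, y + l * B) - (- (q * (l * B)))) +
    \int[mu]_(t in `[y, y + l * B]) (Q (x + l * A, t) - Q (x, t) - q * (l * A)).
  rewrite !RintegralB//; do ?exact: (integrableB _ i1 i2);
    do ?exact: (integrableB _ i3 i4).
  by rewrite !Rintegral_segment_cst ?lerDl// /J /hor /ver; ring.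
apply: le_trans (ler_normD _ _) _.
apply: (@le_trans _ _ (2 * (e / C * L) * (l * A) + 2 * (e / C * L) * (l * B))).
  have aux z (k : R) : z + k - z = k by rewrite addrC addKr.
  apply: lerD.
  - rewrite -[X in _ <= _ * X](aux x); apply: le_norm_Rintegral_segment => //.
      by rewrite lerDl.
    exact: (integrableB _ (integrableB _ i1 i2) (ic _ _ _)).
  - rewrite -[X in _ <= _ * X](aux y); apply: le_norm_Rintegral_segment => //.
      by rewrite lerDl.
    exact: (integrableB _ (integrableB _ i3 i4) (ic _ _ _)).
rewrite -mulrDr -LE.
have -> : 2 * (e / C * L) * L = e * l ^+ 2 * ((C - 1) / C).
  by rewrite /L /C; field; rewrite -/C gt_eqF.
rewrite ler_piMr//; first by rewrite mulr_ge0 ?sqr_ge0// ltW.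
by rewrite ler_pdivrMr// mul1r lerBlDr lerDl.
Qed.

(* Goursat's bisection: the partial derivatives are not assumed continuous. *)
Lemma closed_form_rectangle :
  \int[mu]_(t in `[x0, x0 + A]) P (t, y0)
  - \int[mu]_(t in `[x0, x0 + A]) P (t, y0 + B)
  + \int[mu]_(t in `[y0, y0 + B]) Q (x0 + A, t)
  - \int[mu]_(t in `[y0, y0 + B]) Q (x0, t) = 0.
Proof.
suff : J x0 y0 1 = 0 by rewrite /J /hor /ver !mul1r.
apply: contrapT => /eqP J0.
(* Halving makes the inequality in [bad] strict for the initial rectangle. *)
pose e := `|J x0 y0 1| / 2.
have e0 : 0 < e by rewrite divr_gt0// normr_gt0.
have b0 : bad e x0 y0 1.
  split=> //; first by rewrite /inside !mul1r !lexx.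
  by rewrite expr1n mulr1 /e ltr_pdivrMr// ltr_pMr ?normr_gt0// ltr1n.
have [u [v [buv uP vP]]] := bad_sequence b0.
have p0 n : 0 < (2^-1 : R) ^+ n by rewrite exprn_gt0// invr_gt0.
have [X HX] := @nested_segments R u (fun n => 2^-1 ^+ n * A) uP
  (fun n => mulr_ge0 (ltW (p0 n)) A0).
have [Y HY] := @nested_segments R v (fun n => 2^-1 ^+ n * B) vP
  (fun n => mulr_ge0 (ltW (p0 n)) B0).
have [_ [x1 x2 y1 y2] _] := buv 0%N.
have XA : x0 <= X <= x0 + A.
  by have /andP[h1 h2] := HX 0%N; rewrite (le_trans x1 h1) (le_trans h2 x2).
have YB : y0 <= Y <= y0 + B.
  by have /andP[h1 h2] := HY 0%N; rewrite (le_trans y1 h1) (le_trans h2 y2).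
have [d d0 Hd] := local_estimate e0 XA YB.
have [n Hn] : exists n, 2^-1 ^+ n * (A + B) < d.
  have : (geometric (A + B) (2^-1 : R)) @ \oo --> 0.
    by apply: cvg_geometric; rewrite ger0_norm ?invr_ge0// invf_lt1// ltr1n.
  move=> /cvgrPdist_lt /(_ _ d0) [n _ /(_ n (leqnn n))] /=.
  rewrite sub0r normrN ger0_norm; last by rewrite mulr_ge0 ?addr_ge0// ltW.
  by exists n; rewrite mulrC.
have [_ ins] := buv n; apply/negP; rewrite -leNgt.
exact: (Hd _ _ _ (p0 n) ins (HX n) (HY n) Hn).
Qed.

End Goursat.

(** * First-order calculus of complex functions of two real variables *)

Section FirstOrder.
Variable R : realType.
Local Notation Re := complex.Re.
Local Notation Im := complex.Im.
Implicit Types (F G : R * R -> R[i]) (w h : R * R) (f : R[i] -> R[i]).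

Definition approxR1 (phi : R -> R[i]) x (a : R[i]) := forall e : R, 0 < e ->
  exists2 d : R, 0 < d & forall h : R, `|h| < d ->
    normc (phi (h + x) - phi x - a * h%:C) <= e * `|h|.

Definition approxR2 F w (a b : R[i]) := forall e : R, 0 < e ->
  exists2 d : R, 0 < d & forall h : R * R, `|h| < d ->
    normc (F (h + w) - F w - (a * h.1%:C + b * h.2%:C)) <= e * `|h|.

Lemma approxR2_ReIm F w a b : approxR2 F w a b ->
  approx2 (fun w => Re (F w)) w (Re a) (Re b) /\
  approx2 (fun w => Im (F w)) w (Im a) (Im b).
Proof.
move=> H; split=> e e0; have [d d0 Hd] := H e e0; exists d => // h hd.
  apply: le_trans (Hd h hd); apply: le_trans (ler_normc_Re _).
  rewrite le_eqVlt; apply/orP; left; apply/eqP; congr `|_|.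
  by rewrite /lin2 !reimE; ring.
apply: le_trans (Hd h hd); apply: le_trans (ler_normc_Im _).
rewrite le_eqVlt; apply/orP; left; apply/eqP; congr `|_|.
by rewrite /lin2 !reimE; ring.
Qed.

Lemma ler_norm_fst h : `|h.1| <= `|h|.
Proof. by rewrite prod_normE le_max lexx. Qed.

Lemma ler_norm_snd h : `|h.2| <= `|h|.
Proof. by rewrite prod_normE le_max lexx orbT. Qed.

Lemma normc_lin_le (a b : R[i]) h :
  normc (a * h.1%:C + b * h.2%:C) <= (normc a + normc b) * `|h|.
Proof.
apply: (le_trans (le_normcD _ _)); rewrite !normcM !normc_real mulrDl.
by rewrite lerD// ler_wpM2l ?normcge0// (ler_norm_fst, ler_norm_snd).
Qed.

Lemma approxR2_lip F w a b : approxR2 F w a b ->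
  exists2 d : R, 0 < d & forall h, `|h| < d ->
    normc (F (h + w) - F w) <= (normc a + normc b + 1) * `|h|.
Proof.
move=> /(_ 1 ltr01)[d d0 Hd]; exists d => // h /Hd {}Hd.
set y := F (h + w) - F w - _ in Hd; set x := a * h.1%:C + b * h.2%:C in y Hd.
have -> : F (h + w) - F w = x + y by rewrite [RHS]addrC subrK.
by rewrite mulrDl (le_trans (le_normcD _ _))// lerD// normc_lin_le.
Qed.

Lemma eq_approxR2 F G w a b a' b' : (forall w, F w = G w) -> a = a' -> b = b' ->
  approxR2 F w a b -> approxR2 G w a' b'.
Proof. by move=> /funext -> -> ->. Qed.

Lemma approxR2_cst (c : R[i]) w : approxR2 (fun=> c) w 0 0.
Proof.
move=> e e0; exists 1 => // h _.
by rewrite subrr sub0r !mul0r addr0 oppr0 normc0 mulr_ge0// ltW.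
Qed.

Lemma approxR2D F G w a b a' b' : approxR2 F w a b -> approxR2 G w a' b' ->
  approxR2 (fun w => F w + G w) w (a + a') (b + b').
Proof.
move=> HF HG e e0; have e20 : 0 < e / 2 by rewrite divr_gt0.
have [d1 d10 H1] := HF _ e20; have [d2 d20 H2] := HG _ e20.
exists (Num.min d1 d2); first by rewrite lt_min d10.
move=> h; rewrite lt_min => /andP[/H1 {}H1 /H2 {}H2].
rewrite [e]splitr [leRHS]mulrDl; apply: le_trans (lerD H1 H2).
apply: le_trans (le_normcD _ _); rewrite le_eqVlt; apply/orP; left; apply/eqP.
by congr normc; ring.
Qed.

Lemma approxR2M F G w a b a' b' : approxR2 F w a b -> approxR2 G w a' b' ->
  approxR2 (fun w => F w * G w) w (F w * a' + G w * a) (F w * b' + G w * b).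
Proof.
move=> HF HG e e0.
have [d3 d30 LF] := approxR2_lip HF; have [d4 d40 LG] := approxR2_lip HG.
set M := normc a + normc b + 1 in LF; set M' := normc a' + normc b' + 1 in LG.
have n0 := @normcge0 R.
have M0 : 0 < M by rewrite /M ltr_wpDl// addr_ge0.
have M'0 : 0 < M' by rewrite /M' ltr_wpDl// addr_ge0.
(* The error of the product is F(w) rG + G(w) rF + kF kG, and [C] collects the three factors. The
   last term is quadratic in h, with Lipschitz constants M and M', which is why |h| is also kept
   below e / C. *)
pose C := normc (F w) + normc (G w) + M * M'.
have C0 : 0 < C by rewrite /C ltr_wpDl ?mulr_gt0// addr_ge0.
have eC0 : 0 < e / C by rewrite divr_gt0.
have [d1 d10 H1] := HF _ eC0; have [d2 d20 H2] := HG _ eC0.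
exists (Num.min (Num.min d1 d2) (Num.min (Num.min d3 d4) (e / C))).
  by rewrite !lt_min d10 d20 d30 d40.
move=> h; rewrite !lt_min => /andP[/andP[/H1 {}H1 /H2 {}H2]].
move=> /andP[/andP[/LF {}LF /LG {}LG] he].
set rF := (X in normc X) in H1; set rG := (X in normc X) in H2.
set kF := (X in normc X) in LF; set kG := (X in normc X) in LG.
have -> : F (h + w) * G (h + w) - F w * G w - ((F w * a' + G w * a) * h.1%:C +
    (F w * b' + G w * b) * h.2%:C) = F w * rG + G w * rF + kF * kG.
  by rewrite /rF /rG /kF /kG; ring.
apply: (le_trans (le_normcD _ _)).
apply: (@le_trans _ _ (normc (F w) * (e / C * `|h|) + normc (G w) * (e / C * `|h|)
    + M * M' * (e / C * `|h|))).
  apply: lerD.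
    by apply: (le_trans (le_normcD _ _)); rewrite !normcM lerD// ler_wpM2l.
  rewrite normcM; apply: le_trans (ler_pM (n0 _) (n0 _) LF LG) _.
  rewrite -[leLHS]mulrA -[leRHS]mulrA ler_wpM2l ?(ltW M0)//.
  by rewrite mulrCA ler_wpM2l ?(ltW M'0)// ler_wpM2r// ltW.
rewrite -!mulrDl -/C.
by rewrite le_eqVlt; apply/orP; left; apply/eqP; field; rewrite gt_eqF.
Qed.

(** With no antiholomorphic part, the differential of f is multiplication by c, so both partial
    derivatives acquire the same factor. *)
Lemma approxR2_comp f F w c a b : approxC f (F w) c 0 -> approxR2 F w a b ->
  approxR2 (fun w => f (F w)) w (c * a) (c * b).
Proof.
move=> Hf HF e e0; have [d3 d30 LF] := approxR2_lip HF.
set M := normc a + normc b + 1 in LF.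
have n0 := @normcge0 R.
have M0 : 0 < M by rewrite /M ltr_wpDl// addr_ge0.
pose C := M + normc c.
have C0 : 0 < C by rewrite /C ltr_wpDr.
have eC0 : 0 < e / C by rewrite divr_gt0.
have [d1 d10 H1] := HF _ eC0; have [d2 d20 H2] := Hf _ eC0.
exists (Num.min (Num.min d1 d3) (d2 / M)); first by rewrite !lt_min d10 d30 divr_gt0.
move=> h; rewrite !lt_min => /andP[/andP[/H1 {}H1 /LF {}LF] hM].
have := H2 (F (h + w) - F w); rewrite addrCA subrr addr0 mul0r subr0 => {}H2.
have {}H2 : normc (f (F (h + w)) - f (F w) - c * (F (h + w) - F w)) <=
    e / C * (M * `|h|).
  apply: le_trans (H2 _) _; last by rewrite ler_wpM2l// ltW.
  by apply: le_lt_trans LF _; rewrite mulrC -ltr_pdivlMr.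
have -> : f (F (h + w)) - f (F w) - (c * a * h.1%:C + c * b * h.2%:C) =
  (f (F (h + w)) - f (F w) - c * (F (h + w) - F w)) +
  c * (F (h + w) - F w - (a * h.1%:C + b * h.2%:C)) by ring.
apply: (le_trans (le_normcD _ _)); rewrite normcM.
apply: le_trans (lerD H2 (ler_wpM2l (n0 c) H1)) _.
by rewrite le_eqVlt; apply/orP; left; apply/eqP; rewrite /C; field; rewrite -/C gt_eqF.
Qed.

Lemma approxR2_fst phi w a : approxR1 phi w.1 a ->
  approxR2 (fun w => phi w.1) w a 0.
Proof.
move=> H e e0; have [d d0 Hd] := H e e0; exists d => // h hd.
rewrite mul0r addr0; apply: le_trans (Hd _ (le_lt_trans (ler_norm_fst h) hd)) _.
by rewrite ler_wpM2l ?ler_norm_fst// ltW.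
Qed.

Lemma approxR2_snd phi w a : approxR1 phi w.2 a ->
  approxR2 (fun w => phi w.2) w 0 a.
Proof.
move=> H e e0; have [d d0 Hd] := H e e0; exists d => // h hd.
rewrite mul0r add0r; apply: le_trans (Hd _ (le_lt_trans (ler_norm_snd h) hd)) _.
by rewrite ler_wpM2l ?ler_norm_snd// ltW.
Qed.

Lemma is_derive_approx (phi : R -> R) (x a : R) : is_derive x 1 phi a ->
  forall e : R, 0 < e -> exists2 d : R, 0 < d & forall h : R, `|h| < d ->
    `|phi (h + x) - phi x - a * h| <= e * `|h|.
Proof.
move=> [dphi Da] e e0; move: dphi; rewrite /derivable => /cvg_ex[l Hl].
have la : l = a by rewrite -Da; apply/esym/cvg_lim.
move: Hl; rewrite la => /cvgrPdist_le/(_ _ e0).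
rewrite near_withinE => /nbhs_norm0P[d /= d0 Hd]; exists d => // h hd.
have [->|h0] := eqVneq h 0; first by rewrite add0r subrr mulr0 subr0 normr0 mulr0.
have /= := Hd h hd h0; rewrite /GRing.scale/= mulr1 => {}Hd.
have -> : phi (h + x) - phi x - a * h = - ((a - h^-1 * (phi (h + x) - phi x)) * h).
  by field.
by rewrite normrN normrM ler_wpM2r.
Qed.

Lemma is_derive_approxR1 (u v : R -> R) (x a b : R) :
  is_derive x 1 u a -> is_derive x 1 v b ->
  approxR1 (fun t => u t +i* v t) x (a +i* b).
Proof.
move=> /is_derive_approx Hu /is_derive_approx Hv e e0.
have e20 : 0 < e / 2 by rewrite divr_gt0.
have [d1 d10 H1] := Hu _ e20; have [d2 d20 H2] := Hv _ e20.
exists (Num.min d1 d2); first by rewrite lt_min d10.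
move=> h; rewrite lt_min => /andP[/H1 {}H1 /H2 {}H2].
rewrite [e]splitr [leRHS]mulrDl; apply: le_trans (lerD H1 H2).
apply: le_trans (normc_le_ReIm _) _; rewrite !reimE !mulr0 subr0 add0r.
exact: lexx.
Qed.

Definition expi (t : R) : R[i] := cos t +i* sin t.

Lemma approxR1_expi t : approxR1 expi t ('i%C * expi t).
Proof.
have -> : 'i%C * expi t = (- sin t) +i* cos t.
  by apply: complex_ext; rewrite /expi !reimE; ring.
exact: is_derive_approxR1.
Qed.

Lemma approxR1_expiJ t : approxR1 (fun t => (expi t)^*) t (- 'i%C * (expi t)^*).
Proof.
have -> : - 'i%C * (expi t)^* = (- sin t) +i* (- cos t).
  by apply: complex_ext; rewrite /expi !reimE; ring.
have -> : (fun t => (expi t)^*) = (fun t => cos t +i* (- sin t)) by apply/funext.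
exact: is_derive_approxR1.
Qed.

Lemma approxR1_expR t : approxR1 (fun t => (expR t)%:C) t (expR t)%:C.
Proof.
exact: is_derive_approxR1.
Qed.

Lemma approxR1_id t : approxR1 (fun t => t%:C) t 1.
Proof.
exact: is_derive_approxR1.
Qed.

Lemma normc_expi t : normc (expi t) = 1.
Proof. by rewrite /normc/= cos2Dsin2 sqrtr1. Qed.

(** On the rectangle [a, b] x [0, T] the two horizontal sides cancel by periodicity of P, so the two
    vertical sides agree. *)
Lemma closed_form_periodic (P Q : R * R -> R[i]) (a b T : R) : a <= b -> 0 <= T ->
  (forall x y, a <= x <= b -> exists p q r,
     approxR2 P (x, y) p q /\ approxR2 Q (x, y) q r) ->
  (forall x, P (x, T) = P (x, 0)) ->
  cint lebesgue_measure `[0, T] (fun t => Q (a, t)) =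
  cint lebesgue_measure `[0, T] (fun t => Q (b, t)).
Proof.
move=> ab T0 PQ PT.
have ba : 0 <= b - a by rewrite subr_ge0.
apply: complex_ext; rewrite /cint/=.
- have := @closed_form_rectangle R (fun w => Re (P w)) (fun w => Re (Q w)) a 0 _ T ba T0.
  rewrite addrC subrK !add0r => H; apply/esym/eqP; rewrite -subr_eq0; apply/eqP.
  rewrite -[RHS]H; last first.
    move=> x y xab _; have [p [q [r [/approxR2_ReIm[h _] /approxR2_ReIm[h' _]]]]] := PQ x y xab.
    by exists (Re p), (Re q), (Re r).
  by under [X in _ = _ - X + _ - _]eq_Rintegral do rewrite PT; rewrite subrr add0r.
- have := @closed_form_rectangle R (fun w => Im (P w)) (fun w => Im (Q w)) a 0 _ T ba T0.
  rewrite addrC subrK !add0r => H; apply/esym/eqP; rewrite -subr_eq0; apply/eqP.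
  rewrite -[RHS]H; last first.
    move=> x y xab _; have [p [q [r [/approxR2_ReIm[_ h] /approxR2_ReIm[_ h']]]]] := PQ x y xab.
    by exists (Im p), (Im q), (Im r).
  by under [X in _ = _ - X + _ - _]eq_Rintegral do rewrite PT; rewrite subrr add0r.
Qed.

End FirstOrder.

(** * Means over circles *)

Section CircleMeans.
Variable R : realType.
Local Notation Re := complex.Re.
Local Notation Im := complex.Im.
Local Notation leb := (@lebesgue_measure R).
Implicit Types (F G : R * R -> R[i]) (f : R[i] -> R[i]).

Lemma approxR2_cintegrable F x T :
  (forall y, 0 <= y <= T -> exists a b, approxR2 F (x, y) a b) ->
  cintegrable leb `[0, T] (fun t => F (x, t)).
Proof.
move=> HF; split; apply: continuous_segment_integrable => y yT.
- have [a [b /approxR2_ReIm[/approx2_diff[dF _ _] _]]] := HF y yT.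
  exact: (differentiable_continuous_ver dF).
- have [a [b /approxR2_ReIm[_ /approx2_diff[dF _ _]]]] := HF y yT.
  exact: (differentiable_continuous_ver dF).
Qed.

Lemma approxC_onemV (v : R[i]) : v != 1 ->
  approxC (fun u => (1 - u)^-1) v ((1 - v)^-1 ^+ 2) 0.
Proof.
move=> v1 e e0; have v0 : 1 - v != 0 by rewrite subr_eq0 eq_sym.
set A := 1 - v in v0 *; have n0 : 0 < normc A by rewrite normc_gt0.
(* The remainder is h^2 / (A^2 (A - h)). The first bound gives |A - h| >= |A| / 2, and with it the
   second gives |h| <= e |A|^2 |A - h|. *)
pose d := Num.min (normc A / 2) (e * normc A ^+ 3 / 2).
exists d; first by rewrite lt_min !divr_gt0// mulr_gt0// exprn_gt0.
move=> h; rewrite lt_min => /andP[h1 h2].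
have B2 : normc A / 2 <= normc (A - h).
  by apply: le_trans (ler_normcB _ _); lra.
have B0 : A - h != 0 by rewrite -normc_gt0; apply: lt_le_trans B2; rewrite divr_gt0.
have -> : (1 - (v + h))^-1 - A^-1 - A^-1 ^+ 2 * h - 0 * h^* =
    h ^+ 2 * (A ^+ 2 * (A - h))^-1.
  have -> : 1 - (v + h) = A - h by rewrite opprD addrA.
  by field; rewrite v0 B0.
rewrite (normcM (h ^+ 2)) normcV (normcM (A ^+ 2)) !normcX.
rewrite [_ ^+ 2 in leLHS]expr2 -mulrA [leRHS]mulrC ler_wpM2l ?normcge0//.
have nB : 0 < normc A ^+ 2 * normc (A - h).
  by rewrite mulr_gt0 ?exprn_gt0// normc_gt0.
rewrite ler_pdivrMr//; apply: le_trans (ltW h2) _.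
rewrite -[leLHS]mulrA ler_wpM2l ?(ltW e0)// exprSr -mulrA ler_wpM2l//.
by rewrite sqr_ge0.
Qed.

(** The parameter c is shrunk to 0. With u = c exp(-i t) and Q = (1 - r u)^-1, the form i u Q dr + Q
    dt is closed because du/dt = - i u: both cross derivatives equal u Q^2. At r = 0 the integrand
    is 1. *)
Lemma cint_circle_kernel (c : R[i]) : normc c < 1 ->
  cint leb `[0, pi *+ 2] (fun t => (1 - c * (expi t)^*)^-1) = (pi *+ 2)%:C.
Proof.
move=> c1; set T : R := pi *+ 2.
have T0 : 0 <= T by rewrite mulrn_wge0// pi_ge0.
pose u (w : R * R) : R[i] := c * (expi w.2)^*.
pose Q (w : R * R) : R[i] := (1 - w.1%:C * u w)^-1.
pose P (w : R * R) : R[i] := 'i%C * (u w * Q w).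
have uP w : approxR2 u w 0 (- 'i%C * u w).
  have := approxR2M (approxR2_cst c w) (approxR2_snd (approxR1_expiJ w.2)).
  by apply: eq_approxR2 => //; rewrite /u; ring.
have tu1 x y : 0 <= x <= 1 -> x%:C * u (x, y) != 1.
  move=> /andP[x0 x1]; apply/eqP => /(congr1 (@normc R)).
  rewrite normc1 !normcM normc_conj normc_expi normc_real mulr1 ger0_norm//= => h.
  have : x * normc c <= normc c by rewrite ler_piMl// normcge0.
  by rewrite h => /le_lt_trans /(_ c1); rewrite ltxx.
have := @closed_form_periodic R P Q 0 1 T ler01 T0.
have E1 : cint leb `[0, T] (fun t => Q (1, t)) =
    cint leb `[0, T] (fun t => (1 - c * (expi t)^*)^-1).
  by apply: eq_cint => t _; rewrite /Q /u /= mul1r.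
have E0 : cint leb `[0, T] (fun t => Q (0, t)) = T%:C.
  rewrite (@eq_cint _ _ _ _ _ _ (fun=> 1)); last first.
    by move=> t _; rewrite /Q /= mul0r subr0 invr1.
  apply: complex_ext; rewrite /cint /= Rintegral_segment_cst ?mul0r// mul1r.
  by rewrite subr0.
rewrite E0 E1 => <- //; last first.
  by move=> x; rewrite /P /Q /u /expi /= /T cos2pi sin2pi cos0 sin0.
move=> x y x01.
have n1 := tu1 x y x01.
have tuP := approxR2M (approxR2_fst (approxR1_id (x, y).1)) (uP (x, y)).
have QP := approxR2_comp (approxC_onemV n1) tuP.
have PP := approxR2M (approxR2_cst 'i%C (x, y)) (approxR2M (uP (x, y)) QP).
do 3 eexists; split; last exact: QP.
apply: eq_approxR2 PP => //=.
rewrite -/(Q (x, y)); have D0 : 1 - x%:C * u (x, y) != 0 by rewrite subr_eq0 eq_sym.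
have ii : 'i%C * 'i%C = -1 :> R[i] by apply: complex_ext; rewrite !reimE; ring.
rewrite /Q /=; move: (u (x, y)) D0 => U D0.
transitivity (- ('i%C * 'i%C) * U * (1 - x%:C * U)^-1 ^+ 2); first by field.
by rewrite ii; field.
Qed.

(** Since dW/dt = i W and (W - c') K = W, one has dZ / (Z - c') = ds + i K dt; hence [P] and [Q] are
    the coefficients of f(Z) dZ / (Z - c'). The side s = 0 is the given circle. *)
Lemma holomorphic_circle_mean f (z c : R[i]) : holomorphic f -> normc z < 1 ->
  normc c < 1 ->
  cintegrable leb `[0, pi *+ 2]
    (fun t => f (expi t * z) * (1 - c * (expi t * z)^*)^-1) /\
  cint leb `[0, pi *+ 2]
    (fun t => f (expi t * z) * (1 - c * (expi t * z)^*)^-1) =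
  (pi *+ 2)%:C * f ((normc z ^+ 2)%:C * c).
Proof.
move=> hf z1 c1; set T : R := pi *+ 2.
have T0 : 0 <= T by rewrite mulrn_wge0// pi_ge0.
have n0 := @normcge0 R.
set c' := (normc z ^+ 2)%:C * c.
pose W (t : R) := expi t * z.
pose K t := (1 - c * (W t)^*)^-1.
pose Z (w : R * R) := c' + (expR w.1)%:C * (W w.2 - c').
pose P (w : R * R) := f (Z w); pose Q (w : R * R) := f (Z w) * ('i%C * K w.2).
have nW t : normc (W t) = normc z by rewrite normcM normc_expi mul1r.
have cW t : normc (c * (W t)^*) <= normc c.
  by rewrite normcM normc_conj nW ler_piMr// ltW.
have c'1 : normc c' < 1.
  rewrite normcM normc_real ger0_norm ?sqr_ge0//.
  by apply: le_lt_trans c1; rewrite ler_piMl// expr_le1// ltW.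
have K1 t : c * (W t)^* != 1.
  apply/eqP => /(congr1 (@normc R)); rewrite normc1 => h.
  by move: (cW t); rewrite h => /le_lt_trans /(_ c1); rewrite ltxx.
have K0 t : 1 - c * (W t)^* != 0 by rewrite subr_eq0 eq_sym.
have WK t : (W t - c') * K t = W t.
  have -> : W t - c' = W t * (1 - c * (W t)^*).
    rewrite mulrBr mulr1 mulrCA mul_conjc nW /c'; congr (_ - _); exact: mulrC.
  by rewrite /K mulfK.
have nK t : normc (K t) <= (1 - normc c)^-1.
  rewrite /K normcV lef_pV2 ?posrE ?subr_gt0//; last by rewrite normc_gt0.
  apply: le_trans (ler_normcB _ _); rewrite normc1 lerD2l lerN2; exact: cW.
(* For s <= 0 the point Z is a convex combination of c' and W, so the whole deformation stays in the
   disc. *)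
have Z1 s t : s <= 0 -> normc (Z (s, t)) < 1.
  move=> s0; have e1 : expR s <= 1 by rewrite -expR0 ler_expR.
  have e0 := expR_gt0 s.
  have -> : Z (s, t) = (1 - expR s)%:C * c' + (expR s)%:C * W t.
    by apply: complex_ext; rewrite /Z !reimE /=; ring.
  apply: (le_lt_trans (le_normcD _ _)); rewrite (normcM _ c') (normcM _ (W t)) !normc_real nW.
  rewrite ger0_norm ?subr_ge0// gtr0_norm//.
  have h1 : (1 - expR s) * normc c' <= (1 - expR s) * 1.
    by rewrite ler_wpM2l ?subr_ge0// ltW.
  have h2 : expR s * normc z < expR s * 1 by rewrite ltr_pM2l.
  by have := ler_ltD h1 h2; rewrite !mulr1 subrK.
have WP w : approxR2 (fun w => W w.2) w 0 ('i%C * W w.2).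
  have := approxR2M (approxR2_snd (approxR1_expi w.2)) (approxR2_cst z w).
  by apply: eq_approxR2 => //; rewrite /W; ring.
have WJP w : approxR2 (fun w => (W w.2)^*) w 0 (- 'i%C * (W w.2)^*).
  have := approxR2M (approxR2_snd (approxR1_expiJ w.2)) (approxR2_cst z^* w).
  by apply: eq_approxR2 => [w'||]; rewrite /W ?rmorphM//=; ring.
have KP w : exists a, approxR2 (fun w => K w.2) w 0 a.
  have h := approxR2M (approxR2_cst c w) (WJP w).
  eexists; apply: eq_approxR2 (approxR2_comp (approxC_onemV (K1 w.2)) h) => //.
  by rewrite !mulr0 addr0 mulr0.
have ZP w : approxR2 Z w ((expR w.1)%:C * (W w.2 - c')) ((expR w.1)%:C * ('i%C * W w.2)).
  have := approxR2D (approxR2_cst c' w) (approxR2M (approxR2_fst (approxR1_expR w.1))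
    (approxR2D (WP w) (approxR2_cst (- c') w))).
  by apply: eq_approxR2 => //; ring.
have PQ s t : s <= 0 -> exists p q r, approxR2 P (s, t) p q /\ approxR2 Q (s, t) q r.
  move=> s0; have [a fa] := (derivable_approxC f _).1 (hf _ (Z1 s t s0)).
  have PP := approxR2_comp fa (ZP (s, t)); have [k Kk] := KP (s, t).
  have QP := approxR2M PP (approxR2M (approxR2_cst 'i%C (s, t)) Kk).
  do 3 eexists; split; first exact: PP.
  apply: eq_approxR2 QP => //=.
  by rewrite !(mulr0, addr0, add0r) -[in RHS](WK t); ring.
have iQ s : s <= 0 -> cintegrable leb `[0, T] (fun t => Q (s, t)).
  by move=> s0; apply: approxR2_cintegrable => t _;
     have [p [q [r [_ h]]]] := PQ s t s0; exists q, r.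
have iK : cintegrable leb `[0, T] K.
  apply: (@approxR2_cintegrable (fun w => K w.2) 0) => t _.
  by have [a h] := KP (0, t); exists 0, a.
have shift s : s <= 0 ->
    cint leb `[0, T] (fun t => Q (s, t)) = cint leb `[0, T] (fun t => Q (0, t)).
  move=> s0; apply: (@closed_form_periodic R P Q) => //.
    by move=> x y /andP[_ x0]; exact: PQ.
  by move=> x; rewrite /P /Z /W /expi /= /T cos2pi sin2pi cos0 sin0.
have Z0 t : Z (0, t) = W t by rewrite /Z /= expR0 mul1r addrC subrK.
have iG : cintegrable leb `[0, T] (fun t => f (W t) * K t).
  apply: eq_cintegrable (cintegrableZ _ (- 'i%C) (iQ 0 (lexx 0))) => //.
  move=> t _; rewrite /Q Z0 mulrCA; congr (_ * _); rewrite mulrA.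
  have -> : - 'i%C * 'i%C = 1 :> R[i] by apply: complex_ext; rewrite !reimE; ring.
  by rewrite mul1r.
split; first exact: iG.
have EK : cint leb `[0, T] K = T%:C.
  rewrite -(@cint_circle_kernel (c * z^*)); last first.
    by rewrite normcM normc_conj (le_lt_trans _ c1)// ler_piMr// ltW.
  by apply: eq_cint => t _; rewrite /K /W rmorphM/= -mulrA [z^* * _]mulrC.
(* The integral at level s does not depend on s <= 0, by [shift]; it is compared, for s very
   negative, with the one where f(Z) is replaced by f(c'). *)
suff : normc (cint leb `[0, T] (fun t => Q (0, t)) - 'i%C * (T%:C * f c')) = 0.
  have -> : cint leb `[0, T] (fun t => Q (0, t)) =
      cint leb `[0, T] (fun t => 'i%C * (f (W t) * K t)).
    by apply: eq_cint => t _; rewrite /Q Z0 mulrCA.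
  move=> /eq0_normc/eqP; rewrite subr_eq0 => /eqP; rewrite cintZ// => /mulfI; apply.
  by apply/eqP => /(congr1 (@Im R)) /= /eqP; rewrite oner_eq0.
apply/eqP; rewrite eq_le n0 andbT; apply/ler_addgt0Pr => e e0; rewrite add0r.
(* The bound on |K|, the length of the interval and the factor 2 of [normc_cint_le]; the 1 makes C
   positive. *)
pose C := (1 - normc c)^-1 * T * 2 + 1.
have C0 : 0 < C.
  by rewrite /C ltr_wpDl// !mulr_ge0// invr_ge0 subr_ge0 ltW.
have [a fa] := (derivable_approxC f _).1 (hf _ c'1).
have [d d0 Hd] := fa 1 ltr01.
have a0 : 0 < normc a + 1 by rewrite ltr_wpDl.
have eC0 : 0 < e / C by rewrite divr_gt0.
(* Both W and c' lie in the disc, so |Z - c'| <= 2 D once exp(s) <= D. The first term keeps Z within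
   the radius d of validity of the expansion at c', the second makes the variation (|a| + 1) |Z -
   c'| of f at most e / C. *)
pose D := Num.min (d / 4) (e / C / (normc a + 1) / 2).
have D0 : 0 < D by rewrite lt_min !divr_gt0.
pose s := Num.min 0 (ln D).
have s0 : s <= 0 by rewrite ge_min lexx.
have sD : expR s <= D by rewrite -[leRHS]lnK ?posrE// ler_expR ge_min lexx orbT.
have nZ t : normc (f (Z (s, t)) - f c') <= e / C.
  set h := (expR s)%:C * (W t - c').
  have hD : normc h <= D * 2.
    rewrite /h normcM normc_real gtr0_norm ?expR_gt0// ler_pM ?expR_ge0//.
    apply: (le_trans (le_normcB _ _)); rewrite nW -[leRHS](@natrD _ 1 1).
    by rewrite lerD// ltW.
  have h1 : normc h < d.
    apply: le_lt_trans hD _; have : D <= d / 4 by rewrite ge_min lexx.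
    lra.
  have h2 : normc h <= e / C / (normc a + 1).
    by apply: le_trans hD _; rewrite -ler_pdivlMr// ge_min lexx orbT.
  have := Hd h h1; rewrite mul0r subr0 mul1r => h3.
  have -> : f (Z (s, t)) - f c' = (f (c' + h) - f c' - a * h) + a * h.
    by rewrite subrK.
  apply: (le_trans (le_normcD _ _)); rewrite normcM.
  apply: (@le_trans _ _ ((normc a + 1) * normc h)).
    by rewrite mulrDl mul1r addrC lerD2l.
  by rewrite mulrC -ler_pdivlMr.
rewrite -(shift s s0).
have -> : 'i%C * (T%:C * f c') = cint leb `[0, T] (fun t => 'i%C * f c' * K t).
  by rewrite cintZ// EK -mulrA [f c' * _]mulrC.
rewrite -cintB//; [|exact: iQ|exact: cintegrableZ].
have := @normc_cint_le R _ _ leb `[0, T] _ (fun t => Q (s, t) - 'i%C * f c' * K t)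
  (fun=> e / C * (1 - normc c)^-1).
rewrite Rintegral_segment_cst// subr0 => H.
apply: le_trans (H _ _ _ _) _ => //.
- apply: cintegrable_meas; apply: cintegrableB => //; first exact: iQ.
  exact: cintegrableZ.
- by apply: continuous_segment_integrable => ? _; exact: cvg_cst.
- move=> t _; have -> : Q (s, t) - 'i%C * f c' * K t = 'i%C * ((f (Z (s, t)) - f c') * K t).
    by rewrite /Q /=; ring.
  have -> : forall x : R[i], normc ('i%C * x) = normc x.
    move=> x; rewrite normcM; have -> : normc ('i%C : R[i]) = 1.
      by rewrite /normc /= expr0n expr1n add0r sqrtr1.
    by rewrite mul1r.
  by rewrite normcM ler_pM.
have -> : 2 * (e / C * (1 - normc c)^-1 * T) = e * ((C - 1) / C).
  rewrite (_ : C - 1 = (1 - normc c)^-1 * T * 2) ?addrK//; ring.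
rewrite ler_piMr ?(ltW e0)// ler_pdivrMr// mul1r lerBlDr lerDl.
exact: ler01.
Qed.

End CircleMeans.

(** * Lebesgue measure on the plane *)

(** Presents the image measure as an abstract [nu], known only through its values and its
    integrals. *)
Lemma pushforward_measureP d1 d2 (X : measurableType d1) (Y : measurableType d2)
    (R : realType) (mu : {measure set X -> \bar R}) (phi : X -> Y) :
  measurable_fun setT phi ->
  exists2 nu : {measure set Y -> \bar R}, forall A, nu A = mu (phi @^-1` A) &
    forall D f, measurable D -> measurable_fun setT f -> (forall y, (0 <= f y)%E) ->
      (\int[nu]_(y in D) f y = \int[mu]_(x in phi @^-1` D) f (phi x))%E.
Proof.
move=> mphi; pose nu : {measure set Y -> \bar R} := pushforward mu phi.
exists (nu mphi) => // D f mD mf f0.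
by apply: (@ge0_integral_pushforward _ _ _ _ _ _ mphi mu D f) => //;
  exact: measurable_funTS.
Qed.

Section LebesgueLine.
Variable R : realType.
Local Notation mR := (measurableTypeR R).
Local Notation leb := (@lebesgue_measure R).

(** Lebesgue measure is determined by the lengths of half-open intervals, so the image measure need
    only be computed on those. *)
Lemma ge0_integral_translate (f : mR -> \bar R) (c : R) : measurable_fun setT f ->
  (forall x, (0 <= f x)%E) ->
  (\int[leb]_x f (x + c)%R = \int[leb]_x f x)%E.
Proof.
move=> mf f0; pose phi : mR -> mR := fun x => x + c.
have mphi : measurable_fun setT phi.
  by apply: measurable_funD => //; exact: measurable_cst.
have [nu nuE nuI] := pushforward_measureP leb mphi.
have := nuI setT f measurableT mf f0; rewrite preimage_setT => <-.
apply: eq_measure_integral => A mA _; apply/esym.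
apply: (@lebesgue_measure_unique R nu) => // _ [[a b]] _ <-; rewrite nuE.
have -> : phi @^-1` `]a, b] = `]a - c, b - c]%classic.
  by apply/seteqP; split => x /=; rewrite !in_itv/= /phi ltrBlDr lerBrDr.
rewrite lebesgue_measure_itv [RHS](lebesgue_measure_itv `]a - c, b - c])/=.
rewrite !lte_fin ltrD2r; case: ifPn => // _.
by rewrite -!EFinB; congr EFin; ring.
Qed.

Lemma ge0_integral_dilate (f : mR -> \bar R) (c : R) : 0 < c ->
  measurable_fun setT f -> (forall x, (0 <= f x)%E) ->
  (\int[leb]_x f (c * x)%R = c^-1%:E * \int[leb]_x f x)%E.
Proof.
move=> c0 mf f0; pose phi : mR -> mR := fun x => c * x.
have mphi : measurable_fun setT phi.
  by apply: measurable_funM => //; exact: measurable_cst.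
have [nu nuE nuI] := pushforward_measureP leb mphi.
have := nuI setT f measurableT mf f0; rewrite preimage_setT => <-.
(* The image measure gives ]a, b] the length (b - a) / c; the factor c restores Lebesgue measure. *)
pose m : {measure set mR -> \bar R} := mscale (NngNum (ltW c0)) nu.
have -> : (\int[leb]_x f x = \int[m]_x f x)%E.
  apply: eq_measure_integral => A mA _.
  apply: (@lebesgue_measure_unique R m) => // _ [[a b]] _ <-.
  rewrite /m /= /mscale /= nuE.
  have -> : phi @^-1` `]a, b] = `]a / c, b / c]%classic.
    by apply/seteqP; split => x /=;
      rewrite !in_itv/= /phi ltr_pdivrMr// ler_pdivlMr// [x * c]mulrC.
  rewrite lebesgue_measure_itv [X in (_ * X)%E](lebesgue_measure_itv `]a / c, b / c])/=.
  rewrite !lte_fin ltr_pM2r ?invr_gt0//.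
  case: ifPn => _; last by rewrite mule0.
  by rewrite -!EFinB -EFinM; congr EFin; field; rewrite gt_eqF.
by rewrite ge0_integral_mscale//= muleA -EFinM mulVf ?gt_eqF// mul1e.
Qed.

End LebesgueLine.

(** * Shears, dilations and rotations of the plane *)

Section LebesguePlane.
Variable R : realType.
Local Notation Re := complex.Re.
Local Notation Im := complex.Im.
Local Notation mR := (measurableTypeR R).
Local Notation plane := (mR * mR)%type.
Local Notation leb := (@lebesgue_measure R).
Local Notation leb2 := (@leb2 R).
Implicit Types (F : plane -> \bar R) (f : plane -> R).

(** Restricted to a vertical line the shear is a translation, so Tonelli reduces the claim to
    [ge0_integral_translate]. *)
Lemma ge0_integral_shear_snd F (c : R) : measurable_fun setT F ->
  (forall w, (0 <= F w)%E) ->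
  (\int[leb2]_w F (w.1, w.2 + c * w.1)%R = \int[leb2]_w F w)%E.
Proof.
move=> mF F0; pose G (w : plane) := F (w.1, w.2 + c * w.1).
have mG : measurable_fun setT G.
  apply: (measurableT_comp mF); apply: measurable_fun_pair => //.
  by apply: measurable_funD => //; apply: measurable_funM => //; exact: measurable_cst.
transitivity (\int[leb]_x fubini_F leb G x)%E.
  exact: (fubini_tonelli1 _ mG (fun w => F0 _)).
transitivity (\int[leb]_x fubini_F leb F x)%E; last first.
  exact/esym/(fubini_tonelli1 _ mF F0).
- apply: eq_integral => x _.
  rewrite /fubini_F /G /=; apply: (@ge0_integral_translate R (fun y => F (x, y))) => //.
  exact: (measurableT_comp mF (measurable_pair1 _)).
Qed.

Lemma ge0_integral_shear_fst F (c : R) : measurable_fun setT F ->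
  (forall w, (0 <= F w)%E) ->
  (\int[leb2]_w F (w.1 + c * w.2, w.2)%R = \int[leb2]_w F w)%E.
Proof.
move=> mF F0; pose G (w : plane) := F (w.1 + c * w.2, w.2).
have mG : measurable_fun setT G.
  apply: (measurableT_comp mF); apply: measurable_fun_pair => //.
  by apply: measurable_funD => //; apply: measurable_funM => //; exact: measurable_cst.
transitivity (\int[leb]_y fubini_G leb G y)%E.
  exact: (fubini_tonelli2 _ mG (fun w => F0 _)).
transitivity (\int[leb]_y fubini_G leb F y)%E; last first.
  exact/esym/(fubini_tonelli2 _ mF F0).
- apply: eq_integral => y _.
  rewrite /fubini_G /G /=; apply: (@ge0_integral_translate R (fun x => F (x, y))) => //.
  exact: (measurableT_comp mF (measurable_pair2 _)).
Qed.

Lemma ge0_integral_dilate2 F (c : R) : 0 < c -> measurable_fun setT F ->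
  (forall w, (0 <= F w)%E) ->
  (\int[leb2]_w F (c * w.1, c * w.2)%R = (c^-1 ^+ 2)%:E * \int[leb2]_w F w)%E.
Proof.
move=> c0 mF F0; pose G (w : plane) := F (c * w.1, c * w.2).
have mc : measurable_fun setT (fun x : mR => c * x : mR).
  by apply: measurable_funM => //; exact: measurable_cst.
have mG : measurable_fun setT G.
  apply: (measurableT_comp mF); apply: measurable_fun_pair.
  - by apply: (measurableT_comp mc).
  - by apply: (measurableT_comp mc).
pose H x := (\int[leb]_y F (x, y))%E.
have mH : measurable_fun setT H by exact: (measurable_fun_fubini_tonelli_F F).
have H0 x : (0 <= H x)%E by exact: integral_ge0.
transitivity (\int[leb]_x fubini_F leb G x)%E.
  exact: (fubini_tonelli1 _ mG (fun w => F0 _)).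
transitivity (\int[leb]_x (c^-1%:E * H (c * x)%R))%E.
  apply: eq_integral => x _; rewrite /fubini_F /G /=.
  apply: (@ge0_integral_dilate R (fun y => F (c * x, y))) => //.
  exact: (measurableT_comp mF (measurable_pair1 _)).
have -> : (\int[leb2]_w F w = \int[leb]_x H x)%E by exact: fubini_tonelli1.
rewrite (@ge0_integralZl _ _ _ leb setT measurableT (fun x => H (c * x)%R)
  (measurableT_comp mH mc) c^-1%:E (fun x _ => H0 _))//.
- by rewrite ge0_integral_dilate// muleA -EFinM.

- by rewrite lee_fin invr_ge0 ltW.
Qed.

Definition crot (c : R[i]) (w : plane) : plane :=
  (Re c * w.1 - Im c * w.2, Im c * w.1 + Re c * w.2).

Lemma cplx_crot c w : cplx (crot c w) = c * cplx w.
Proof. by apply: complex_ext; rewrite /cplx /crot !reimE /=; ring. Qed.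

Lemma crotM c c' w : crot (c * c') w = crot c (crot c' w).
Proof. by rewrite /crot !reimE /=; congr pair; ring. Qed.

Lemma measurable_crot c : measurable_fun setT (crot c).
Proof.
have mM (a : R) (g : plane -> R) : measurable_fun setT g ->
    measurable_fun setT (fun w => a * g w).
  by move=> mg; apply: measurable_funM => //; exact: measurable_cst.
apply: measurable_fun_pair.
- by apply: measurable_funB; exact: mM.
- by apply: measurable_funD; exact: mM.
Qed.

(* A rotation that is not a homothety is a product of three shears. *)
Let ge0_integral_crot_shear F c : Im c != 0 -> normc c = 1 -> measurable_fun setT F ->
  (forall w, (0 <= F w)%E) -> (\int[leb2]_w F (crot c w) = \int[leb2]_w F w)%E.
Proof.
move=> c0 c1 mF F0; have e1 : Re c ^+ 2 + Im c ^+ 2 = 1 by rewrite -normc_sqE c1 expr1n.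
(* For c = exp(i a) this is - tan(a / 2): the rotation is the horizontal shear by k, then the
   vertical one by sin a, then the horizontal one by k again. *)
pose k := (Re c - 1) / Im c.
pose U (w : plane) : plane := (w.1 + k * w.2, w.2).
pose L (w : plane) : plane := (w.1, w.2 + Im c * w.1).
have mU : measurable_fun setT U.
  apply: measurable_fun_pair => //.
  by apply: measurable_funD => //; apply: measurable_funM => //; exact: measurable_cst.
have mL : measurable_fun setT L.
  apply: measurable_fun_pair => //.
  by apply: measurable_funD => //; apply: measurable_funM => //; exact: measurable_cst.
rewrite -[RHS](@ge0_integral_shear_fst F k)//.
have mFU : measurable_fun setT (F \o U) by exact: (measurableT_comp mF mU).
have mFUL : measurable_fun setT (F \o U \o L) by exact: (measurableT_comp mFU mL).
rewrite -[RHS](@ge0_integral_shear_snd (F \o U) (Im c))//; last by move=> w; exact: F0.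
rewrite -[RHS](@ge0_integral_shear_fst (F \o U \o L) k)//; last by move=> w; exact: F0.
apply: eq_integral => w _; rewrite /= /U /L /crot /=; congr (F (_, _)); rewrite /k.
- have -> : Re c * w.1 - Im c * w.2 = Re c * w.1 - Im c ^+ 2 / Im c * w.2.
    by field.
  have -> : Im c ^+ 2 = 1 - Re c ^+ 2 by rewrite -e1; ring.
  by field.
- by field.
Qed.

Lemma ge0_integral_crot F c : normc c = 1 -> measurable_fun setT F ->
  (forall w, (0 <= F w)%E) -> (\int[leb2]_w F (crot c w) = \int[leb2]_w F w)%E.
Proof.
move=> c1 mF F0; have [Ic|Ic] := eqVneq (Im c) 0; last exact: ge0_integral_crot_shear.
have ni : normc ('i%C : R[i]) = 1 by rewrite /normc /= expr0n expr1n add0r sqrtr1.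
have Ri : Im ('i%C : R[i]) != 0 by rewrite Im_i oner_eq0.
have Rc : Im (- 'i%C * c) != 0.
  rewrite !reimE Ic !(mul0r, mulr0, oppr0, sub0r, subr0, addr0, add0r) mulN1r oppr_eq0.
  apply/eqP => Rc0; move: c1; rewrite (_ : c = 0).
    by rewrite normc0 => /eqP; rewrite eq_sym oner_eq0.
  exact: complex_ext.
(* A real c is split into two rotations with nonzero imaginary part, to which the shears apply. *)
have -> : c = 'i%C * (- 'i%C * c).
  by apply: complex_ext; rewrite !reimE; ring.
under eq_integral do rewrite crotM.
rewrite (@ge0_integral_crot_shear (F \o crot 'i%C))//.
- exact: ge0_integral_crot_shear.
- by rewrite normcM normcN ni mul1r.
- exact: (measurableT_comp mF (measurable_crot _)).
- by move=> w; exact: F0.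
Qed.

End LebesguePlane.

Section PlaneRotation.
Variable R : realType.
Local Notation Re := complex.Re.
Local Notation Im := complex.Im.
Local Notation mR := (measurableTypeR R).
Local Notation plane := (mR * mR)%type.
Local Notation leb := (@lebesgue_measure R).
Local Notation leb2 := (@leb2 R).
Implicit Types (F : plane -> \bar R) (f : plane -> R).

Lemma integral_crot F c : normc c = 1 -> measurable_fun setT F ->
  (\int[leb2]_w F (crot c w) = \int[leb2]_w F w)%E.
Proof.
move=> c1 mF; rewrite [LHS]integralE [RHS]integralE; congr (_ - _)%E.
- rewrite -[RHS](@ge0_integral_crot _ _ c c1 (measurable_funepos mF) (funepos_ge0 F)).
  by apply: eq_integral => w _; rewrite !funeposE.
- rewrite -[RHS](@ge0_integral_crot _ _ c c1 (measurable_funeneg mF) (funeneg_ge0 F)).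
  by apply: eq_integral => w _; rewrite !funenegE.
Qed.

Lemma discE w : @disc R w = (normc (cplx w) < 1) :> Prop. Proof. by []. Qed.

Lemma disc_crot c w : normc c = 1 -> @disc R (crot c w) = @disc R w.
Proof. by move=> c1; rewrite !discE cplx_crot normcM c1 mul1r. Qed.

Lemma integral_disc_crot F c : normc c = 1 -> measurable_fun (@disc R) F ->
  (\int[leb2]_(w in @disc R) F (crot c w) = \int[leb2]_(w in @disc R) F w)%E.
Proof.
move=> c1 mF; rewrite [LHS]integral_mkcond [RHS]integral_mkcond.
rewrite -[RHS](@integral_crot _ c)//; last first.
  by apply/(measurable_restrictT _ (@measurable_disc R)).
apply: eq_integral => w _; rewrite /patch; congr (if _ then _ else _).
by apply/idP/idP; rewrite !inE disc_crot.
Qed.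

Lemma cint_disc_crot (F : plane -> R[i]) c : normc c = 1 ->
  cmeasurable (@disc R) F ->
  cint leb2 (@disc R) (fun w => F (crot c w)) = cint leb2 (@disc R) F.
Proof.
move=> c1 [m1 m2]; rewrite /cint /Rintegral; congr (fine _ +i* fine _).
- by apply: (@integral_disc_crot (fun w => (Re (F w))%:E)) => //; exact/measurable_EFinP.
- by apply: (@integral_disc_crot (fun w => (Im (F w))%:E)) => //; exact/measurable_EFinP.
Qed.

End PlaneRotation.

(** * The distribution of the squared modulus under plane Lebesgue measure *)

Section RadialIntegrals.
Variable R : realType.
Local Notation mR := (measurableTypeR R).
Local Notation plane := (mR * mR)%type.
Local Notation leb := (@lebesgue_measure R).
Local Notation leb2 := (@leb2 R).

Let q (w : plane) : mR := w.1 ^+ 2 + w.2 ^+ 2.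

Let mq : measurable_fun setT q.
Proof. by apply: measurable_funD; apply: measurable_funX. Qed.

Let q0 w : 0 <= q w. Proof. by rewrite addr_ge0// sqr_ge0. Qed.

Let B (t : R) : set plane := [set w | q w <= t].

Let mball t : measurable (B t).
Proof.
have -> : B t = setT `&` q @^-1` `]-oo, t].
  by apply/seteqP; split=> w /=; rewrite in_itv/= => // -[].
by apply: mq => //; exact: measurable_itv.
Qed.

Let leb2_square (t : R) : 0 <= t ->
  leb2 (`[- t, t] `*` `[- t, t]) = ((t + t) ^+ 2)%:E.
Proof.
move=> t0; pose S : set mR := `[- t, t]%classic.
transitivity (leb S * leb S)%E; first by apply: product_measure1E; exact: measurable_itv.
have -> : leb S = (t + t)%:E.
  rewrite lebesgue_measure_itv/= lte_fin; case: ltrP => [_|h].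
    by rewrite -EFinB opprK.
  have {}h : t <= 0 by rewrite -(@pmulrn_lle0 _ _ 2)// mulr2n -[X in _ + X]opprK subr_le0.
  have -> : t = 0 by apply/eqP; rewrite eq_le t0 h.
  by rewrite addr0.
by rewrite -EFinM expr2.
Qed.

(** The disc contains a square of side 1 and lies in one of side 2. Positivity and finiteness
    suffice at this stage; the value is found in [ge0_integral_radial]. *)
Let ball_area : exists2 a : R, 0 < a & leb2 (B 1) = a%:E.
Proof.
have le1 : (leb2 (B 1) <= 4%:E)%E.
  have <- : leb2 (`[- 1, 1] `*` `[- 1, 1]) = 4%:E.
    by rewrite leb2_square//; congr EFin; ring.
  apply: le_measure; rewrite ?inE//; first exact: measurableX.
  move=> w /= h; have := sqr_ge0 w.1; have := sqr_ge0 w.2; rewrite /q in h.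
  move=> h1 h2; have h3 : w.1 ^+ 2 <= 1 by apply: le_trans h; rewrite lerDl.
  have h4 : w.2 ^+ 2 <= 1 by apply: le_trans h; rewrite lerDr.
  split; rewrite /= in_itv/= -ler_norml -(@ler_sqr R) ?nnegrE//.
    by rewrite real_normK ?num_real// expr1n.
  by rewrite real_normK ?num_real// expr1n.
have ge1 : (1%:E <= leb2 (B 1))%E.
  have <- : leb2 (`[- 2^-1, 2^-1] `*` `[- 2^-1, 2^-1]) = 1%:E.
    by rewrite leb2_square//; congr EFin; field.
  apply: le_measure; rewrite ?inE//; first exact: measurableX.
  move=> [x y] [] /=; rewrite !in_itv/= -!ler_norml => hx hy; rewrite /q /=.
  have : `|x| ^+ 2 <= 2^-1 ^+ 2 by rewrite ler_sqr ?nnegrE.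
  have : `|y| ^+ 2 <= 2^-1 ^+ 2 by rewrite ler_sqr ?nnegrE.
  rewrite !real_normK ?num_real// => h1 h2; apply: le_trans (lerD h2 h1) _.
  by rewrite -subr_ge0; have -> : 1 - (2^-1 ^+ 2 + 2^-1 ^+ 2) = 2^-1 :> R by field.
have fA : leb2 (B 1) \is a fin_num.
  by rewrite ge0_fin_numE// (le_lt_trans le1)// ltry.
exists (fine (leb2 (B 1))); last by rewrite fineK.
by rewrite -lte_fin fineK// (lt_le_trans _ ge1)// lte_fin.
Qed.

Let leb2_ball (a t : R) : leb2 (B 1) = a%:E ->
  leb2 (B t) = (a * Num.max t 0)%:E.
Proof.
move=> aE.
have pos s : 0 < s -> leb2 (B s) = (a * s)%:E.
  move=> s0; have c0 : 0 < Num.sqrt s by rewrite sqrtr_gt0.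
  have mF : measurable_fun setT (fun w : plane => (\1_(B s) w : R)%:E).
    by apply/measurable_EFinP; exact: measurable_indic.
  have I1 r : (\int[leb2]_w (\1_(B r) w)%:E = leb2 (B r))%E.
    by rewrite integral_indic// setIT.
  have := @ge0_integral_dilate2 R _ (Num.sqrt s) c0 mF (fun w => _).
  rewrite I1.
  have -> : (\int[leb2]_w (\1_(B s) (Num.sqrt s * w.1, Num.sqrt s * w.2)%R)%:E
      = leb2 (B 1))%E.
    rewrite -(I1 1); apply: eq_integral => w _; rewrite !indicE.
    congr ((_ : bool)%:R)%:E; apply/idP/idP; rewrite !inE /B /= /q /= !exprMn.
      by rewrite sqr_sqrtr ?(ltW s0)// -mulrDr -[X in _ <= X -> _]mulr1 ler_pM2l.
    by rewrite sqr_sqrtr ?(ltW s0)// -mulrDr -[X in _ -> _ <= X]mulr1 ler_pM2l.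
  have F0 (w : plane) : (0 <= ((\1_(B s) w : R)%:E))%E by rewrite lee_fin indicE.
  move=> /(_ F0)/(congr1 (fun x => s%:E * x)%E); rewrite aE muleA -!EFinM.
  by rewrite exprVn sqr_sqrtr ?(ltW s0)// mulfV ?gt_eqF// mul1e [s * a]mulrC.
have [t0|t0] := ltP 0 t; first exact: pos.
(* For t <= 0 the set B t lies in B s for every s > 0; the choice s = e / (a + 1) gives area at most
   e, even if a is large. *)
rewrite mulr0; apply/eqP; rewrite eq_le measure_ge0 andbT.
apply/lee_addgt0Pr => e e0; rewrite add0e.
have a0 : 0 <= a by rewrite -lee_fin -aE measure_ge0.
have e1 : 0 < e / (a + 1) by rewrite divr_gt0// ltr_wpDl.
apply: (@le_trans _ _ (leb2 (B (e / (a + 1))))).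
  apply: le_measure; rewrite ?inE// => w /= h.
  by apply: le_trans h _; apply: le_trans t0 _; exact: ltW.
rewrite pos// lee_fin mulrA ler_pdivrMr ?ltr_wpDl// mulrC ler_wpM2l ?(ltW e0)//.
by rewrite lerDl.
Qed.

(** By homogeneity the disc of squared radius t >= 0 has area a t. The image of plane measure under
    the squared modulus thus has the same distribution function as a times Lebesgue measure on the
    half-line. *)
Let radial_scaled : exists2 a : R, 0 < a & forall phi : mR -> \bar R,
  measurable_fun setT phi -> (forall t, (0 <= phi t)%E) ->
  (\int[leb2]_w phi (q w) = a%:E * \int[leb]_(t in `[0%R, +oo[) phi t)%E.
Proof.
have [a a0 aE] := ball_area; exists a => // phi mphi phi0.
have [nu nuE nuI] := pushforward_measureP leb2 mq.
have := nuI `[0, +oo[%classic phi (measurable_itv _) mphi phi0.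
have -> : q @^-1` `[0, +oo[ = setT.
  by apply/seteqP; split => // w _ /=; rewrite in_itv/= q0.
move=> <-.
have nut t : nu `]-oo, t]%classic = (a * Num.max t 0)%:E.
  rewrite nuE -(leb2_ball t aE).
  have -> // : q @^-1` `]-oo, t] = B t.
  by apply/seteqP; split => w /=; rewrite in_itv.
have nuab (x y : R) : x <= y -> nu `]x, y]%classic = (a * (Num.max y 0 - Num.max x 0))%:E.
  move=> xy; have : nu `]-oo, y]%classic = (nu `]-oo, x]%classic + nu `]x, y]%classic)%E.
    have dis : `]-oo, x]%classic `&` `]x, y]%classic = set0 :> set mR.
      by apply/seteqP; split => // z [] /=; rewrite !in_itv/= => h /andP[]; rewrite ltNge h.
    rewrite -measureU//; do ?exact: measurable_itv.
    by rewrite -itv_bndbnd_setU.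
  rewrite !nut; case: (nu `]x, y]%classic) => [r||] //.
  by rewrite -EFinD => -[h]; congr EFin; rewrite mulrBr h; ring.
have inva : 0 < a^-1 by rewrite invr_gt0.
(* The image measure [nu] lives on the nonnegative half-line. Adding Lebesgue measure on the
   negative one gives a measure to which the uniqueness theorem on the whole line applies. *)
pose m : {measure set mR -> \bar R} :=
  measure_add (mscale (NngNum (ltW inva)) nu) (mrestr leb (measurable_itv `]-oo, 0[)).
have mE (A : set mR) : m A = (a^-1%:E * nu A + leb (A `&` `]-oo, 0%R[%classic))%E.
  exact: measure_addE.
have mleb (A : set mR) : measurable A -> leb A = m A.
  apply: lebesgue_measure_unique => _ [[x y]] _ <-; rewrite mE.
  have [xy|yx] := leP x y; last first.
    by rewrite set_itv_ge ?bnd_simp -?leNgt ?(ltW yx)// set0I !measure0 mule0 adde0.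
  rewrite nuab//.
  have -> : leb (`]x, y]%classic `&` `]-oo, 0%R[%classic) = (Num.min y 0 - Num.min x 0)%:E.
    case: (boolP (y < 0)) => [y0|]; last rewrite -leNgt => y0.
      have x0 : x < 0 by exact: le_lt_trans xy y0.
      rewrite (min_l (ltW y0)) (min_l (ltW x0)).
      rewrite (_ : _ `&` _ = `]x, y]%classic :> set R).
        rewrite lebesgue_measure_itv/= lte_fin; move: xy; rewrite le_eqVlt.
        by move=> /predU1P[->|->]; rewrite ?ltxx ?subrr.
      apply/seteqP; split => z /=; first by case.
      move=> h; split => //; move: h; rewrite !in_itv/= => /andP[_ h].
      exact: le_lt_trans h y0.
    rewrite (min_r y0).
    case: (boolP (x < 0)) => [x0|]; last rewrite -leNgt => x0.
      rewrite (min_l (ltW x0)) (_ : _ `&` _ = `]x, 0[%classic :> set R).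
        by rewrite lebesgue_measure_itv/= lte_fin x0 sub0r add0e.
      apply/seteqP; split => z /=; rewrite !in_itv/=.
        by move=> [/andP[-> _] ->].
      by move=> /andP[xz z0]; rewrite xz z0 (le_trans (ltW z0)).
    rewrite (min_r x0) (_ : _ `&` _ = set0 :> set R) ?measure0 ?subrr//.
    apply/seteqP; split => z //=; rewrite !in_itv/= => -[/andP[xz _]].
    by rewrite ltNge (le_trans x0 (ltW xz)).
  rewrite -EFinM mulKf ?gt_eqF// -EFinD.
  have -> : Num.max y 0 - Num.max x 0 + (Num.min y 0 - Num.min x 0) = y - x.
    by rewrite addrACA addr_max_min -opprD addr_max_min !addr0.
  rewrite lebesgue_measure_itv/= lte_fin.
  move: xy; rewrite le_eqVlt => /predU1P[->|->]; last by rewrite EFinB.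
  by rewrite ltxx subrr.
rewrite -(@ge0_integral_mscale _ _ _ leb _ _ (NngNum (ltW a0)))//.
- apply: eq_measure_integral => A mA A0.
  rewrite /mscale/= [X in _ = (_ * X)%E](mleb A mA) mE.
  rewrite (_ : A `&` _ = set0) ?measure0 ?adde0; last first.
    apply/seteqP; split => // z [/A0 /=]; rewrite !in_itv/= andbT => z0.
    by rewrite ltNge z0.
  by rewrite muleA -EFinM mulfV ?gt_eqF// mul1e.
- exact: measurable_funTS.
Qed.

Lemma ge0_integral_radial (phi : mR -> \bar R) : measurable_fun setT phi ->
  (forall t, (0 <= phi t)%E) ->
  (\int[leb2]_w phi (normc (cplx w) ^+ 2)%R =
   pi%:E * \int[leb]_(t in `[0%R, +oo[) phi t)%E.
Proof.
move=> mphi phi0; have [a a0 H] := radial_scaled.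
have api : a = pi.
  (* The test function exp(-t) has integral 1 on the half-line, while exp(-|z|^2) splits into two
     Gaussian integrals, each equal to the square root of pi. *)
  pose e (t : mR) : \bar R := (expR (- t))%:E.
  have me : measurable_fun setT e.
    by apply/measurable_EFinP; apply: measurableT_comp.
  have e0 t : (0 <= e t)%E by rewrite lee_fin expR_ge0.
  have := H e me e0.
  have -> : (\int[leb]_(t in `[0%R, +oo[) e t = 1)%E.
    rewrite -(@integral_exponential_pdf R 1 ltr01) [LHS]integral_mkcond.
    apply: eq_integral => t _; rewrite /patch /exponential_pdf /patch /=.
    by case: ifPn => // _; rewrite /e mul1r mulN1r.
  rewrite mule1 => /esym/(congr1 fine) /= ->.
  have -> : (\int[leb2]_w e (q w) = \int[leb]_x \int[leb]_y (gauss_fun x * gauss_fun y)%:E)%E.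
    transitivity (\int[leb]_x fubini_F leb (fun w : plane => e (q w)) x)%E.
      exact: (fubini_tonelli1 _ (measurableT_comp me mq) (fun w => e0 _)).
    apply: eq_integral => x _; apply: eq_integral => y _.
    by rewrite /e /q /gauss_fun /= opprD expRD.
  under eq_integral => x _.
    under eq_integral do rewrite EFinM.
    rewrite ge0_integralZl//; first last.
    - by rewrite lee_fin gauss_fun_ge0.
    - by move=> y _; rewrite lee_fin gauss_fun_ge0.
    - by apply/measurable_EFinP; exact: measurable_gauss_fun.
    rewrite integralT_gauss.
    over.
  have mg : measurable_fun setT (fun x : mR => (gauss_fun x)%:E).
    by apply/measurable_EFinP; exact: measurable_gauss_fun.
  rewrite (ge0_integralZr _ _ mg); first last.
  - by rewrite lee_fin sqrtr_ge0.
  - by move=> x _; rewrite lee_fin gauss_fun_ge0.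
  - exact: measurableT.
  by rewrite integralT_gauss -EFinM /= -expr2 sqr_sqrtr// pi_ge0.
rewrite -api -H//; apply: eq_integral => w _.
by rewrite normc_sqE.
Qed.

End RadialIntegrals.

(** * The Hilbert space of the disc *)

Section DiscL2.
Variable R : realType.
Local Notation Re := complex.Re.
Local Notation Im := complex.Im.
Local Notation mR := (measurableTypeR R).
Local Notation plane := (mR * mR)%type.
Local Notation leb := (@lebesgue_measure R).
Local Notation leb2 := (@leb2 R).
Local Notation disc := (@disc R).
Local Notation I01 := (`[0%R, 1%R[%classic : set mR).
Implicit Types (f g h : R[i] -> R[i]).

Lemma ge0_integral_disc_radial (phi : mR -> \bar R) : measurable_fun I01 phi ->
  (forall t, (0 <= phi t)%E) ->
  (\int[leb2]_(w in disc) phi (normc (cplx w) ^+ 2)%R =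
   pi%:E * \int[leb]_(t in I01) phi t)%E.
Proof.
move=> mphi phi0.
have mp : measurable_fun setT (phi \_ I01).
  exact: (measurable_restrictT phi (measurable_itv _)).1.
have p0 (t : mR) : (0 <= (phi \_ I01) t)%E by rewrite /patch; case: ifPn.
have := ge0_integral_radial mp p0.
have -> : (\int[leb]_(t in `[0%R, +oo[) (phi \_ I01) t =
    \int[leb]_(t in I01) phi t)%E.
  rewrite -integral_mkcondr; congr (integral _ _ _).
  apply/seteqP; split => t /=; rewrite !in_itv/= ?andbT; first by case.
  by move=> /andP[-> ->].
move=> <-; rewrite [LHS]integral_mkcond; apply: eq_integral => w _.
rewrite /patch; congr (if _ then _ else _); apply/idP/idP; rewrite !inE discE /=.
  by rewrite in_itv/= sqr_ge0 => w1; rewrite expr_lt1 ?normcge0.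
by rewrite in_itv/= sqr_ge0 expr_lt1 ?normcge0.
Qed.

Lemma integrable_disc_radial (u : mR -> R) : leb.-integrable I01 (EFin \o u) ->
  leb2.-integrable disc (EFin \o (fun w : plane => u (normc (cplx w) ^+ 2))) /\
  \int[leb2]_(w in disc) u (normc (cplx w) ^+ 2) = pi * \int[leb]_(t in I01) u t.
Proof.
move=> iu; have mu := measurable_int _ iu.
have mI : measurable I01 by exact: measurable_itv.
pose v w := (u (normc (cplx w) ^+ 2))%:E.
have Ep : (\int[leb2]_(w in disc) v^\+ w =
    pi%:E * \int[leb]_(t in I01) (EFin \o u)^\+ t)%E.
  rewrite -(ge0_integral_disc_radial (measurable_funepos mu) (funepos_ge0 _)).
  by apply: eq_integral => w _; rewrite !funeposE.
have En : (\int[leb2]_(w in disc) v^\- w =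
    pi%:E * \int[leb]_(t in I01) (EFin \o u)^\- t)%E.
  rewrite -(ge0_integral_disc_radial (measurable_funeneg mu) (funeneg_ge0 _)).
  by apply: eq_integral => w _; rewrite !funenegE.
have Ea : (\int[leb2]_(w in disc) `|v w| =
    pi%:E * \int[leb]_(t in I01) `|(EFin \o u) t|)%E.
  apply: (@ge0_integral_disc_radial (fun t => `|(EFin \o u) t|%E)) => //.
  exact: measurableT_comp.
have fp := integrable_pos_fin_num mI iu.
have fn := integrable_neg_fin_num mI iu.
split.
  apply/integrableP; split.
    have mr : measurable_fun setT (u \_ I01).
      apply: (measurable_restrictT u (measurable_itv _)).1.
      exact/measurable_EFinP.
    apply/measurable_EFinP.
    pose q (w : plane) : mR := normc (cplx w) ^+ 2.
    have mq : measurable_fun setT q.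
      rewrite (_ : q = (fun w => w.1 ^+ 2 + w.2 ^+ 2)); last first.
        by apply/funext => w; rewrite /q normc_sqE.
      by apply: measurable_funD; apply: measurable_funX.
    apply: (@eq_measurable_fun _ _ _ _ _ ((u \_ I01) \o q)).
      move=> w; rewrite inE discE => w1; rewrite /= /patch mem_set//=.
      by rewrite in_itv/= sqr_ge0 expr_lt1 ?normcge0.
    by apply: measurable_funTS; exact: (measurableT_comp mr mq).
  rewrite Ea; case/integrableP: iu => _ iu.
  by apply: lte_mul_pinfty => //; rewrite ?lee_fin ?pi_ge0.
rewrite /Rintegral [X in fine X = _]integralE Ep En [X in _ = _ * fine X]integralE.
rewrite -(fineK fp) -(fineK fn) -!EFinM -!EFinB /=.
by rewrite mulrBr.
Qed.

End DiscL2.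

Section DiscHilbert.
Variable R : realType.
Local Notation Re := complex.Re.
Local Notation Im := complex.Im.
Local Notation mR := (measurableTypeR R).
Local Notation plane := (mR * mR)%type.
Local Notation leb := (@lebesgue_measure R).
Local Notation leb2 := (@leb2 R).
Local Notation disc := (@disc R).
Implicit Types (f g h : R[i] -> R[i]).

Let mD := @measurable_disc R.

Lemma integrable_disc_cst (c : R) : leb2.-integrable disc (EFin \o (fun=> c)) /\
  \int[leb2]_(w in disc) c = pi * c.
Proof.
have ic : leb.-integrable (`[0%R, 1%R[%classic : set mR) (EFin \o (fun=> c)).
  apply: (@integrableS _ _ _ leb `[0%R, 1%R]) => //.
    by move=> x /=; rewrite !in_itv/= => /andP[-> /ltW].
  by apply: continuous_segment_integrable => x _; exact: cvg_cst.
have [i1 ->] := integrable_disc_radial ic; split; first exact: i1.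
rewrite Rintegral_cst//= [X in fine X](lebesgue_measure_itv `[0%R, 1%R[)/= lte_fin ltr01.
by rewrite -EFinB /= subr0 mulr1.
Qed.

(** The real-valued square of [normL2]. Meaningful only on L^2: an infinite integral would be read
    as 0. *)
Definition dnorm2 f : R := \int[leb2]_(w in disc) (normc (f (cplx w)) ^+ 2).

Lemma innerE f g : inner f g =
  cint leb2 disc (fun w => f (cplx w) * (g (cplx w))^* ).
Proof. by []. Qed.

Lemma inL2_cmeas f : inL2 f -> cmeasurable disc (fun w => f (cplx w)).
Proof. by case. Qed.

Lemma inL2_sqr_integrable f : inL2 f ->
  leb2.-integrable disc (EFin \o (fun w => normc (f (cplx w)) ^+ 2)).
Proof.
case=> m1 m2 foo; apply/integrableP; split; first exact: measurable_normc2.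
apply: le_lt_trans foo; apply: ge0_le_integral => //.
- by apply: measurableT_comp => //; exact: (@measurable_normc2 R f).
- exact: (@measurable_normc2 R f).
- by move=> w _; rewrite /= ger0_norm ?sqr_ge0.
Qed.

Lemma sqr_integrable_inL2 f : cmeasurable disc (fun w => f (cplx w)) ->
  leb2.-integrable disc (EFin \o (fun w => normc (f (cplx w)) ^+ 2)) -> inL2 f.
Proof.
move=> [m1 m2] /integrableP[_ foo]; split => //.
apply: le_lt_trans foo; apply: ge0_le_integral => //.
- by move=> w _; rewrite lee_fin sqr_ge0.
- exact: (@measurable_normc2 R f).
- by apply: measurableT_comp => //; exact: (@measurable_normc2 R f).
- by move=> w _; rewrite /= ger0_norm ?sqr_ge0.
Qed.

Lemma dnorm2E f : inL2 f ->
  (\int[leb2]_(w in disc) (normc (f (cplx w)) ^+ 2)%:E)%E = (dnorm2 f)%:E.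
Proof. by move=> fL; rewrite fineK// integrable_fin_num// inL2_sqr_integrable. Qed.

Lemma dnorm2_ge0 f : 0 <= dnorm2 f.
Proof. by apply: Rintegral_ge0 => w _; exact: sqr_ge0. Qed.

Lemma bounded_inL2 f (M : R) : cmeasurable disc (fun w => f (cplx w)) ->
  (forall z, normc z < 1 -> normc (f z) <= M) -> inL2 f.
Proof.
move=> mf fM; apply: sqr_integrable_inL2 => //.
apply: (@le_integrable _ _ _ leb2 disc mD _ (EFin \o (fun=> M ^+ 2))).
- by case: mf => m1 m2; exact: (@measurable_normc2 R f).
- move=> w wD /=; rewrite lee_fin !ger0_norm ?sqr_ge0//.
  have M0 : 0 <= M by apply: le_trans (normcge0 _) (fM _ wD).
  by rewrite ler_sqr ?nnegrE ?normcge0// fM.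
- exact: (integrable_disc_cst _).1.
Qed.

Lemma inL2_mulJ_integrable f g : inL2 f -> inL2 g ->
  cintegrable leb2 disc (fun w => f (cplx w) * (g (cplx w))^* ).
Proof.
move=> fL gL.
apply: (@cintegrable_dom _ _ _ leb2 disc mD _
  (fun w => normc (f (cplx w)) ^+ 2 + normc (g (cplx w)) ^+ 2)).
- by apply: cmeasurableM; [exact: inL2_cmeas|apply: cmeasurableJ; exact: inL2_cmeas].
- have := integrableD mD (inL2_sqr_integrable fL) (inL2_sqr_integrable gL).
  by apply: eq_integrable => // w _ /=; rewrite EFinD.
- move=> w _; rewrite normcM normc_conj.
  set a := normc _; set b := normc _; have a0 : 0 <= a by exact: normcge0.
  have b0 : 0 <= b by exact: normcge0.
  have : 0 <= (a - b) ^+ 2 by exact: sqr_ge0.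
  rewrite sqrrB -mulr_natr => h.
  have : 0 <= a * b by exact: mulr_ge0.
  by move: h; lra.
Qed.

Lemma inL2Z (c : R[i]) f : inL2 f -> inL2 (fun z => c * f z).
Proof.
move=> fL; apply: sqr_integrable_inL2.
  by apply: (cmeasurableM (cmeasurable_cst _ c)); exact: inL2_cmeas.
have := integrableZl mD (normc c ^+ 2) (inL2_sqr_integrable fL).
by apply: eq_integrable => // w _ /=; rewrite normcM exprMn EFinM.
Qed.

Lemma inL2D f g : inL2 f -> inL2 g -> inL2 (fun z => f z + g z).
Proof.
move=> fL gL; have := inL2B fL (inL2Z (-1) gL).
by congr inL2; apply/funext => z; rewrite mulN1r opprK.
Qed.

Lemma inL2_0 : inL2 (fun=> 0 : R[i]).
Proof.
apply: (@bounded_inL2 _ 0); first exact: cmeasurable_cst.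
by move=> z _; rewrite normc0.
Qed.

Lemma inL2_cst (c : R[i]) : inL2 (fun=> c).
Proof. by apply: (@bounded_inL2 _ (normc c)) => //; exact: cmeasurable_cst. Qed.

Lemma inL2_sum n (F : nat -> R[i] -> R[i]) : (forall i, inL2 (F i)) ->
  inL2 (fun z => \sum_(i < n) F i z).
Proof.
move=> FL; elim: n => [|n ih].
  by have := inL2_0; congr inL2; apply/funext => z; rewrite big_ord0.
have := inL2D ih (FL n).
by congr inL2; apply/funext => z; rewrite big_ord_recr.
Qed.

Lemma innerDl f g h : inL2 f -> inL2 g -> inL2 h ->
  inner (fun z => f z + g z) h = inner f h + inner g h.
Proof.
move=> fL gL hL; rewrite !innerE -cintD//; try exact: inL2_mulJ_integrable.
by apply: eq_cint => w _; rewrite mulrDl.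
Qed.

Lemma innerZl (c : R[i]) f h : inL2 f -> inL2 h ->
  inner (fun z => c * f z) h = c * inner f h.
Proof.
move=> fL hL; rewrite !innerE -cintZ//; last exact: inL2_mulJ_integrable.
by apply: eq_cint => w _; rewrite mulrA.
Qed.

Lemma innerC f g : inL2 f -> inL2 g -> inner g f = (inner f g)^*.
Proof.
move=> fL gL; rewrite !innerE -cintJ//; last exact: inL2_mulJ_integrable.
by apply: eq_cint => w _; rewrite rmorphM/= conjCK mulrC.
Qed.

Lemma innerBl f g h : inL2 f -> inL2 g -> inL2 h ->
  inner (fun z => f z - g z) h = inner f h - inner g h.
Proof.
move=> fL gL hL; rewrite -[- inner g h]mulN1r -innerZl// -innerDl//; last exact: inL2Z.
by congr inner; apply/funext => z; rewrite mulN1r.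
Qed.

Lemma innerZr (c : R[i]) f h : inL2 f -> inL2 h ->
  inner f (fun z => c * h z) = c^* * inner f h.
Proof.
move=> fL hL; rewrite innerC//; last exact: inL2Z.
by rewrite innerZl// rmorphM/= -innerC.
Qed.

Lemma innerBr f g h : inL2 f -> inL2 g -> inL2 h ->
  inner f (fun z => g z - h z) = inner f g - inner f h.
Proof.
move=> fL gL hL; rewrite innerC//; last exact: inL2B.
by rewrite innerBl// rmorphB/= -!innerC.
Qed.

Lemma inner_suml n (F : nat -> R[i] -> R[i]) h : (forall i, inL2 (F i)) -> inL2 h ->
  inner (fun z => \sum_(i < n) F i z) h = \sum_(i < n) inner (F i) h.
Proof.
move=> FL hL; elim: n => [|n ih].
  rewrite big_ord0 -[RHS](cint0 leb2 mD); apply: eq_cint => w _.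
  by rewrite big_ord0 mul0r.
rewrite big_ord_recr/= -ih -innerDl//; last exact: inL2_sum.
by congr inner; apply/funext => z; rewrite big_ord_recr.
Qed.

Lemma inner_diag f : inL2 f -> inner f f = (dnorm2 f)%:C.
Proof.
move=> fL; apply: complex_ext; rewrite innerE /cint/=.
  by apply: eq_Rintegral => w _; rewrite mul_conjc.
rewrite -[RHS](mul0r (fine (leb2 disc))) -Rintegral_cst//.
by apply: eq_Rintegral => w _; rewrite mul_conjc.
Qed.

Lemma eq_inner f f' g g' : (forall z, normc z < 1 -> f z = f' z) ->
  (forall z, normc z < 1 -> g z = g' z) -> inner f g = inner f' g'.
Proof. by move=> ff gg; rewrite !innerE; apply: eq_cint => w w1; rewrite ff// gg. Qed.

Lemma eq_dnorm2 f f' : (forall z, normc z < 1 -> f z = f' z) -> dnorm2 f = dnorm2 f'.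
Proof. by move=> ff; apply: eq_Rintegral => w /set_mem wD; rewrite ff. Qed.

Lemma dnorm2B f g : inL2 f -> inL2 g ->
  dnorm2 (fun z => f z - g z) = dnorm2 f - 2 * Re (inner f g) + dnorm2 g.
Proof.
move=> fL gL; transitivity (Re (inner (fun z => f z - g z) (fun z => f z - g z))).
  by rewrite inner_diag//; exact: inL2B.
rewrite innerBl ?innerBr//; try exact: inL2B.
by rewrite (innerC fL gL) !inner_diag// !reimE; ring.
Qed.

Lemma dnorm2Z (c : R[i]) f : inL2 f ->
  dnorm2 (fun z => c * f z) = normc c ^+ 2 * dnorm2 f.
Proof.
move=> fL; rewrite -RintegralZl//; last exact: inL2_sqr_integrable.
by apply: eq_Rintegral => w _; rewrite normcM exprMn.
Qed.

Lemma inner_CauchySchwarz f g : inL2 f -> inL2 g ->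
  normc (inner f g) ^+ 2 <= dnorm2 f * dnorm2 g.
Proof.
move=> fL gL; set c := inner f g; set n := normc c ^+ 2.
(* This is ||f - t c g||^2 with t real: the factor c = <f, g> makes the cross term real, leaving a
   real quadratic polynomial in t. *)
have H (t : R) : 0 <= dnorm2 f - 2 * t * n + t ^+ 2 * n * dnorm2 g.
  have := dnorm2_ge0 (fun z => f z - (t%:C * c) * g z).
  rewrite dnorm2B//; last exact: inL2Z.
  rewrite dnorm2Z// innerZr// -/c normcM normc_real exprMn real_normK ?num_real//.
  have -> : Re ((t%:C * c)^* * c) = t * n.
    by rewrite /n normc_sqE !reimE; ring.
  by rewrite mulrA.
have n0 : 0 <= n by exact: sqr_ge0.
have [g0|g0] := eqVneq (dnorm2 g) 0.
  rewrite g0 mulr0 leNgt; apply/negP => np.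
  (* If g has norm 0 the polynomial is affine with slope - 2 n, and at this t it takes the value
     -1. *)
  have := H ((dnorm2 f + 1) / (2 * n)); rewrite g0 mulr0 addr0.
  have -> : 2 * ((dnorm2 f + 1) / (2 * n)) * n = dnorm2 f + 1.
    by field; rewrite gt_eqF.
  by rewrite opprD addrA subrr sub0r oppr_ge0 ler10.
have gp : 0 < dnorm2 g by rewrite lt_neqAle eq_sym g0 dnorm2_ge0.
(* The minimiser of the quadratic polynomial. *)
have := H (dnorm2 g)^-1.
have -> : dnorm2 f - 2 * (dnorm2 g)^-1 * n + (dnorm2 g)^-1 ^+ 2 * n * dnorm2 g =
  dnorm2 f - n / dnorm2 g by field.
by rewrite subr_ge0 ler_pdivrMr.
Qed.

End DiscHilbert.

(** * Monomials *)

Section Monomials.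
Variable R : realType.
Local Notation Re := complex.Re.
Local Notation Im := complex.Im.
Local Notation mR := (measurableTypeR R).
Local Notation plane := (mR * mR)%type.
Local Notation leb := (@lebesgue_measure R).
Local Notation leb2 := (@leb2 R).
Local Notation disc := (@disc R).
Implicit Types (f g h : R[i] -> R[i]).

(** Uses 1 / F = conj(F) / |F|^2, which also holds where F vanishes since the inverse of 0 is 0; the
    real inverse is measurable as the power of exponent -1. *)
Lemma cmeasurableV d (T : measurableType d) (D : set T) (F : T -> R[i]) :
  cmeasurable D F -> cmeasurable D (fun x => (F x)^-1).
Proof.
move=> mF; have [m1 m2] := mF.
have mN : measurable_fun D (fun x => (normc (F x) ^+ 2)^-1).
  have -> : (fun x => (normc (F x) ^+ 2)^-1) = (@powR R ^~ (- 1)) \o (fun x => normc (F x) ^+ 2).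
    by apply/funext => x /=; rewrite powR_inv1// sqr_ge0.
  apply: measurableT_comp; first exact: measurable_powR.
  exact: measurable_funX (measurable_normc mF).
have E x : (F x)^-1 = (F x)^* * ((normc (F x) ^+ 2)^-1)%:C.
  have [->|F0] := eqVneq (F x) 0; first by rewrite invr0 rmorph0 mul0r.
  apply: (mulfI F0); rewrite mulfV// mulrA mul_conjc -realCM mulfV//.
  by rewrite expf_eq0/= gt_eqF// normc_gt0.
apply: (@eq_cmeasurable _ _ _ _ (fun x => (F x)^* * ((normc (F x) ^+ 2)^-1)%:C)).
  by move=> x _; rewrite -E.
apply: cmeasurableM; first exact: cmeasurableJ.
by split => //; exact: measurable_cst.
Qed.

Lemma cmeasurable_cplx (D : set plane) : cmeasurable D (@cplx R).
Proof.
split; apply: measurable_funTS; first exact: (@measurable_fst _ _ mR mR).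
exact: (@measurable_snd _ _ mR mR).
Qed.

Lemma holomorphicX n : holomorphic (fun z : R[i] => z ^+ n).
Proof.
move=> z _; have := @derivableX R[i] R[i]^o id n z 1 (@derivable_id R[i] R[i]^o z 1).
by rewrite (_ : id ^+ n = (fun x : R[i]^o => x ^+ n))//; apply/funext => x; rewrite fctE.
Qed.

Lemma holomorphicD f g : holomorphic f -> holomorphic g ->
  holomorphic (fun z => f z + g z).
Proof. by move=> hf hg z z1; apply: (@derivableD _ R[i]^o R[i]^o); [exact: hf|exact: hg]. Qed.

Lemma holomorphicZ (c : R[i]) f : holomorphic f -> holomorphic (fun z => c * f z).
Proof. by move=> hf z z1; apply: (@derivableZ _ R[i]^o R[i]^o); exact: hf. Qed.

Lemma monomial_inL2 n : inL2 (fun z : R[i] => z ^+ n).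
Proof.
apply: (@bounded_inL2 _ _ 1).
  by apply: cmeasurableX; exact: cmeasurable_cplx.
by move=> z z1; rewrite normcX exprn_ile1 ?normcge0// ltW.
Qed.

Lemma monomial_inA2 n : inA2 (fun z : R[i] => z ^+ n).
Proof. by split; [exact: holomorphicX|exact: monomial_inL2]. Qed.

Lemma inA2D f g : inA2 f -> inA2 g -> inA2 (fun z => f z + g z).
Proof. by move=> [hf fL] [hg gL]; split; [exact: holomorphicD|exact: inL2D]. Qed.

Lemma inA2Z (c : R[i]) f : inA2 f -> inA2 (fun z => c * f z).
Proof. by move=> [hf fL]; split; [exact: holomorphicZ|exact: inL2Z]. Qed.

Lemma inA2B f g : inA2 f -> inA2 g -> inA2 (fun z => f z - g z).
Proof.
move=> fA gA; have := inA2D fA (inA2Z (-1) gA).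
by congr inA2; apply/funext => z; rewrite mulN1r.
Qed.

Lemma Rintegral_exprn n :
  \int[leb]_(t in (`[0%R, 1%R[%classic : set mR)) (t ^+ n) = n.+1%:R^-1.
Proof.
have c m (x : R) : {for x, continuous (fun t : R => t ^+ m)} by exact: exprn_continuous.
pose F (x : R) := x ^+ n.+1 / n.+1%:R.
have dF (x : R) : derivable F x 1.
  by apply: derivableM => //; exact: exprn_derivable.
have cF (x : R) : {for x, continuous F}.
  by apply/differentiable_continuous/derivable1_diffP; exact: dF.
transitivity (\int[leb]_(t in `[0, 1]) (t ^+ n)).
  apply: (@Rintegral_itv_bndo_bndc R (BLeft 0)).
  apply: (@integrableS _ _ _ leb `[0%R, 1%R]) => //.
    by move=> x /=; rewrite !in_itv/= => /andP[-> /ltW].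
  by apply: continuous_segment_integrable => x _; exact: c.
rewrite /Rintegral (@continuous_FTC2 _ _ (fun x => x ^+ n.+1 / n.+1%:R))//=.
- by rewrite expr1n expr0n/= mul0r subr0 mul1r.
- by apply: continuous_in_subspaceT => x _; exact: c.
- split.
  + by move=> x _; exact: dF.
  + by apply: cvg_at_right_filter; exact: cF.
  + by apply: cvg_at_left_filter; exact: cF.
- move=> x _; rewrite derive1Mr//; last exact: exprn_derivable.
  by rewrite derive1E exp_derive// scaler1 /GRing.scale/= mulrC mulKf ?pnatr_eq0.
Qed.

Lemma dnorm2_monomial n : dnorm2 (fun z : R[i] => z ^+ n) = pi / n.+1%:R.
Proof.
have ic : leb.-integrable (`[0%R, 1%R[%classic : set mR) (EFin \o (fun t : mR => t ^+ n)).
  apply: (@integrableS _ _ _ leb `[0%R, 1%R]) => //.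
    by move=> x /=; rewrite !in_itv/= => /andP[-> /ltW].
  by apply: continuous_segment_integrable => x _; exact: exprn_continuous.
have [_ H] := integrable_disc_radial ic.
rewrite -(Rintegral_exprn n) -H; apply: eq_Rintegral => w _.
by rewrite normcX exprAC.
Qed.

Lemma expiD (s t : R) : expi (s + t) = expi s * expi t.
Proof.
by apply: complex_ext; rewrite /expi !reimE ?sinD ?cosD; ring.
Qed.

Lemma expiX (t : R) n : expi t ^+ n = expi (t *+ n).
Proof.
elim: n => [|n ih]; last by rewrite exprS mulrS expiD ih.
by apply: complex_ext; rewrite expr0 mulr0n /expi ?cos0 ?sin0.
Qed.

(** The rotation by pi / (n - m) preserves the integral of z^m conj(z^n) but changes the sign of the
    integrand. *)
Lemma inner_monomial_neq m n : m <> n ->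
  inner (fun z : R[i] => z ^+ m) (fun z => z ^+ n) = 0.
Proof.
wlog mn : m n / (m < n)%N => [H|_].
  case: (ltngtP m n) => // [h|h] mn; first exact: H.
  rewrite innerC ?H ?conjC0//; try exact: monomial_inL2.
  by move=> e; apply: mn; rewrite e.
set F := fun w : plane => cplx w ^+ m * (cplx w ^+ n)^*.
pose c : R[i] := expi (pi / (n - m)%:R).
have c1 : normc c = 1 by exact: normc_expi.
have cn : c ^+ (n - m) = -1.
  rewrite expiX -[X in expi X]mulr_natr divfK ?pnatr_eq0 -?lt0n ?subn_gt0//.
  by apply: complex_ext; rewrite /expi ?reimE ?cospi ?sinpi //= oppr0.
have mF : cmeasurable disc F.
  apply: cmeasurableM; first by apply: cmeasurableX; exact: cmeasurable_cplx.
  by apply: cmeasurableJ; apply: cmeasurableX; exact: cmeasurable_cplx.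
have iF : cintegrable leb2 disc F.
  exact: (inL2_mulJ_integrable (monomial_inL2 m) (monomial_inL2 n)).
have := cint_disc_crot c1 mF.
have -> : cint leb2 disc (fun w => F (crot c w)) = cint leb2 disc (fun w => (-1) * F w).
  apply: eq_cint => w _; rewrite /F cplx_crot !exprMn rmorphM/=.
  rewrite -[in c ^+ n](subnK (ltnW mn)) exprD cn rmorphM/= rmorphN1.
  have : c ^+ m * (c ^+ m)^* = 1.
    by rewrite mul_conjc normcX c1 !expr1n.
  move: (c ^+ m) ((c ^+ m)^*) => a b ab.
  by rewrite mulrACA [a * _]mulrCA ab mulr1.
rewrite (cintZ (@measurable_disc R) _ iF) => h.
apply/eqP; rewrite innerE -/F; move: h; set I := cint _ _ _ => /eqP.
by rewrite mulN1r eq_sym -subr_eq0 opprK -mulr2n mulrn_eq0/=.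
Qed.

End Monomials.

Arguments monomial_inL2 {R} n.
Arguments monomial_inA2 {R} n.

(** * Averaging over rotations *)

Section RotationAverage.
Variable R : realType.
Local Notation Re := complex.Re.
Local Notation Im := complex.Im.
Local Notation mR := (measurableTypeR R).
Local Notation plane := (mR * mR)%type.
Local Notation leb := (@lebesgue_measure R).
Local Notation leb2 := (@leb2 R).
Local Notation disc := (@disc R).

Let mD := @measurable_disc R.

Lemma measurable_crot_expi :
  measurable_fun setT (fun p : mR * plane => crot (expi p.1) p.2).
Proof.
have mcos : measurable_fun setT (fun p : mR * plane => cos p.1 : mR).
  exact: (measurableT_comp (continuous_measurable_fun (@continuous_cos R)) measurable_fst).
have msin : measurable_fun setT (fun p : mR * plane => sin p.1 : mR).
  exact: (measurableT_comp (continuous_measurable_fun (@continuous_sin R)) measurable_fst).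
have m1 : measurable_fun setT (fun p : mR * plane => p.2.1).
  exact: (measurableT_comp measurable_fst measurable_snd).
have m2 : measurable_fun setT (fun p : mR * plane => p.2.2).
  exact: (measurableT_comp measurable_snd measurable_snd).
apply: measurable_fun_pair.
- by apply: measurable_funB; apply: measurable_funM.
- by apply: measurable_funD; apply: measurable_funM.
Qed.

(** The type of [leb2] records a measure and no more; sigma-finiteness is supplied here so that
    Fubini's theorem applies in [integral_disc_average]. *)
Lemma leb2_sigma_finite : sigma_finite setT leb2.
Proof.
have /sigma_finiteP[F [TF ndF Foo]] := sigma_finiteT leb.
exists (fun n => F n `*` F n).
  rewrite -setXTT TF predeqE => -[x y]; split.
    move=> [/= [n _ Fnx] [k _ Fky]]; exists (maxn n k) => //; split.
    - by move: x Fnx; exact/subsetPset/ndF/leq_maxl.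
    - by move: y Fky; exact/subsetPset/ndF/leq_maxr.
  by move=> [n _ []/= ? ?]; split; exists n.
move=> k; have [mF Fk] := Foo k; split; first exact: measurableX.
have -> : leb2 (F k `*` F k) = (leb (F k) * leb (F k))%E by exact: product_measure1E.
by rewrite lte_mul_pinfty// ge0_fin_numE.
Qed.

(** The function g(exp(i t) w) is integrated over [0, 2 pi] x D in both orders: rotation invariance
    gives 2 pi times the integral of g, the hypothesis gives 2 pi times that of m. *)
Lemma integral_disc_average (g m : plane -> R) :
  leb2.-integrable disc (EFin \o g) -> leb2.-integrable disc (EFin \o m) ->
  (forall w, disc w -> (\int[leb]_(t in `[0%R, (pi *+ 2)%R]) (g (crot (expi t) w))%:E =
     ((pi *+ 2) * m w)%:E)%E) ->
  \int[leb2]_(w in disc) g w = \int[leb2]_(w in disc) m w.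
Proof.
move=> ig im gm; set T : R := pi *+ 2.
have T0 : 0 < T by rewrite /T pmulrn_lgt0// pi_gt0.
pose I : set mR := `[0, T]%classic.
have mI : measurable I by exact: measurable_itv.
have lI : leb I = T%:E.
  by rewrite [LHS](lebesgue_measure_itv `[0, T])/= lte_fin T0 oppr0 adde0.
pose leb2' : {sigma_finite_measure set plane -> \bar R} :=
  HB.pack (Measure.sort leb2) (Measure.class leb2)
    (Measure_isSigmaFinite.Build _ _ _ leb2 leb2_sigma_finite).
pose gd := g \_ disc.
have mg : measurable_fun disc g by apply/measurable_EFinP; exact: (measurable_int _ ig).
have mgd : measurable_fun setT gd by exact: (measurable_restrictT g mD).1.
(* Extension by zero turns the domain into a full product space. *)
pose H (p : mR * plane) : \bar R := (\1_I p.1 * gd (crot (expi p.1) p.2))%:E.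
have mH : measurable_fun setT H.
  apply/measurable_EFinP; apply: measurable_funM.
    exact: (measurableT_comp (measurable_indic mI) measurable_fst).
  exact: (measurableT_comp mgd measurable_crot_expi).
(* Used twice: k = |.| for integrability on the product, k = id for the value of the iterated
   integral. *)
have rot (k : R -> R) (t : R) : measurable_fun setT k ->
    (\int[leb2]_w (\1_I t * k (gd (crot (expi t) w)))%:E =
     \int[leb2]_w ((\1_I t)%:E * (k (gd w))%:E))%E.
  move=> mk.
  rewrite -(@integral_crot R (fun w => (\1_I t)%:E * (k (gd w))%:E)%E (expi t)).
  - by apply: eq_integral => w _; rewrite EFinM.
  - exact: normc_expi.
  - apply: emeasurable_funM; first exact: measurable_cst.
    by apply/measurable_EFinP; exact: (measurableT_comp mk mgd).
have indE : (\int[leb]_t (\1_I t)%:E = T%:E)%E by rewrite integral_indic// setIT.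
have igd : leb2.-integrable setT (EFin \o gd).
  rewrite /gd -restrict_EFin; apply/integrable_restrict => //.
  by rewrite setTI.
have iH : (leb \x leb2')%E.-integrable setT H.
  apply/integrable12ltyP => //.
  have -> : (\int[leb]_x \int[leb2']_y `|H (x, y)| =
      \int[leb]_t ((\1_I t)%:E * \int[leb2]_w `|(gd w)%:E|))%E.
    apply: eq_integral => t _; have t0 : 0 <= \1_I t :> R by rewrite indicE.
    transitivity (\int[leb2]_w (\1_I t * `|gd (crot (expi t) w)|)%:E)%E.
      by apply: eq_integral => w _; rewrite /H /= normrM ger0_norm.
    rewrite rot; last exact: normr_measurable.
    have mabs : measurable_fun setT (fun w : plane => (`|gd w|)%:E).
      by apply/measurable_EFinP; exact: (measurableT_comp (@normr_measurable R setT) mgd).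
    by rewrite (ge0_integralZl _ measurableT mabs) ?lee_fin// => w _; rewrite lee_fin.
  case/integrableP: igd => _ gfin.
  rewrite ge0_integralZr//.
  - by rewrite indE; apply: lte_mul_pinfty => //; rewrite lee_fin ltW.
  - by apply/measurable_EFinP; exact: measurable_indic.
  - by apply: integral_ge0.
have i1 : leb.-integrable setT (EFin \o \1_I).
  apply/integrableP; split; first by apply/measurable_EFinP; exact: measurable_indic.
  rewrite (eq_integral (fun t => (\1_I t)%:E)) ?indE ?ltry// => t _ /=.
  by rewrite ger0_norm// indicE.
have := Fubini iH.
pose A := \int[leb2]_(w in disc) g w.
have AE : (\int[leb2]_w (gd w)%:E = A%:E)%E.
  rewrite /A /Rintegral integral_mkcond fineK.
    by apply: eq_integral => w _; rewrite /gd /patch; case: ifPn.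
  by rewrite -integral_mkcond; exact: integrable_fin_num.
have -> : (\int[leb]_x \int[leb2']_y H (x, y) = (T * A)%:E)%E.
  transitivity (\int[leb]_t ((\1_I t)%:E * A%:E))%E.
    apply: eq_integral => t _; rewrite -AE.
    transitivity (\int[leb2]_w ((\1_I t)%:E * (gd w)%:E))%E.
      exact: (rot id t (@measurable_id _ _ setT)).
    exact: (integralZl measurableT igd).
  by rewrite integralZr// indE.
have -> : (\int[leb2']_y \int[leb]_x H (x, y) = (T * \int[leb2]_(w in disc) m w)%:E)%E.
  transitivity (\int[leb2]_(w in disc) (T%:E * (m w)%:E))%E.
    rewrite [RHS]integral_mkcond; apply: eq_integral => w _.
    transitivity (\int[leb]_(t in I) (gd (crot (expi t) w))%:E)%E.
      rewrite [RHS]integral_mkcond; apply: eq_integral => t _.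
      rewrite /H /patch /= indicE; case: ifPn => _; first by rewrite mul1r.
      by rewrite mul0r.
    rewrite [RHS]/patch; case: ifPn => wD.
      rewrite -EFinM -gm; last by rewrite inE in wD.
      apply: eq_integral => t _; rewrite /gd /patch mem_set//.
      by rewrite disc_crot ?normc_expi//; rewrite inE in wD.
    rewrite -[RHS](@integral0 _ _ _ leb I); apply: eq_integral => t _.
    by rewrite /gd /patch memNset// disc_crot ?normc_expi// => h; rewrite mem_set in wD.
  rewrite integralZl// EFinM; congr (_ * _)%E.
  by rewrite fineK//; exact: integrable_fin_num.
by move=> [] /mulfI; apply; rewrite gt_eqF.
Qed.

Lemma cint_disc_average (G M : plane -> R[i]) :
  cintegrable leb2 disc G -> cintegrable leb2 disc M ->
  (forall w, disc w -> cintegrable leb `[0, pi *+ 2] (fun t => G (crot (expi t) w)) /\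
     cint leb `[0, pi *+ 2] (fun t => G (crot (expi t) w)) = (pi *+ 2)%:C * M w) ->
  cint leb2 disc G = cint leb2 disc M.
Proof.
move=> [G1 G2] [M1 M2] GM; rewrite /cint; congr (_ +i* _).
- apply: integral_disc_average => // w wD; have [[i1 _] /(congr1 (@Re R))] := GM w wD.
  rewrite ReM ReC ImC mul0r subr0 => <-.
  by rewrite fineK//; apply: integrable_fin_num => //; exact: i1.
- apply: integral_disc_average => // w wD; have [[_ i1] /(congr1 (@Im R))] := GM w wD.
  rewrite ImM ReC ImC mul0r addr0 => <-.
  by rewrite fineK//; apply: integrable_fin_num => //; exact: i1.
Qed.

End RotationAverage.

(** * Completeness of the monomials *)

Section ScaledMeans.
Variable R : realType.
Local Notation mR := (measurableTypeR R).
Local Notation leb := (@lebesgue_measure R).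

Lemma Rintegral_dilate_unit (v : R -> R) (x : R) : 0 < x ->
  leb.-integrable (`[0%R, x[%classic : set mR) (EFin \o v) ->
  \int[leb]_(t in `[0, 1[) v (x * t) = x^-1 * \int[leb]_(t in `[0, x[) v t.
Proof.
move=> x0 iv; pose I : set mR := `[0%R, x[%classic.
have mI : measurable I by exact: measurable_itv.
pose F (t : mR) : \bar R := ((v \_ I) t)%:E.
have mF : measurable_fun setT F.
  apply/measurable_EFinP; apply: (measurable_restrictT v mI).1.
  by apply/measurable_EFinP; exact: (measurable_int _ iv).
have iF : leb.-integrable setT F.
  rewrite (_ : F = (EFin \o v) \_ I); last first.
    by apply/funext => t; rewrite /F /patch /=; case: ifPn.
  by apply/integrable_restrict => //; rewrite setTI.
have fp := integrable_pos_fin_num measurableT iF.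
have fn := integrable_neg_fin_num measurableT iF.
have Ep := ge0_integral_dilate x0 (measurable_funepos mF) (funepos_ge0 F).
have En := ge0_integral_dilate x0 (measurable_funeneg mF) (funeneg_ge0 F).
have E1 : (\int[leb]_(t in I) (v t)%:E = \int[leb]_t F t)%E.
  rewrite [LHS]integral_mkcond; apply: eq_integral => t _.
  by rewrite /F /patch; case: ifPn.
have E2 : (\int[leb]_(t in (`[0%R, 1%R[%classic : set mR)) (v (x * t)%R)%:E =
    \int[leb]_t F (x * t)%R)%E.
  rewrite [LHS]integral_mkcond; apply: eq_integral => t _.
  rewrite /F /patch; have -> : (x * t \in I) = (t \in (`[0%R, 1%R[%classic : set mR)).
    have xt : (x * t < x) = (t < 1) by rewrite -[X in _ < X]mulr1 ltr_pM2l.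
    by apply/idP/idP; rewrite !inE /I /= !in_itv/= pmulr_rge0// xt.
  by case: ifPn.
rewrite /Rintegral [X in fine X = _]E2 [X in _ = _ * fine X]E1.
rewrite [X in fine X = _]integralE [X in _ = _ * fine X]integralE.
have -> : (\int[leb]_t (fun t => F (x * t)%R)^\+ t = \int[leb]_t F^\+ (x * t)%R)%E.
  by apply: eq_integral => t _; rewrite !funeposE.
have -> : (\int[leb]_t (fun t => F (x * t)%R)^\- t = \int[leb]_t F^\- (x * t)%R)%E.
  by apply: eq_integral => t _; rewrite !funenegE.
rewrite Ep En -(fineK fp) -(fineK fn) -!EFinM -!EFinB /=.
by rewrite mulrBr.
Qed.

(* The primitive of [v] vanishes on [[0, 1]], hence so does its derivative. *)
Lemma scaled_means_eq0 (v : R -> R) : (forall t, 0 <= t <= 1 -> {for t, continuous v}) ->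
  (forall x, 0 < x <= 1 -> \int[leb]_(t in `[0, 1[) v (x * t) = 0) ->
  forall y, 0 < y < 1 -> v y = 0.
Proof.
move=> cv v0 y /andP[y0 y1].
have iv : leb.-integrable `[0, 1] (EFin \o v) by exact: continuous_segment_integrable.
have prim x : 0 < x <= 1 -> \int[leb]_(t in `[0, x]) v t = 0.
  move=> x01; have /andP[x0 x1] := x01.
  have ix : leb.-integrable (`[0%R, x[%classic : set mR) (EFin \o v).
    apply: (integrableS _ _ _ iv) => // t /=; rewrite !in_itv/= => /andP[-> tx].
    by rewrite (le_trans (ltW tx)).
  have := v0 x x01; rewrite Rintegral_dilate_unit// => /eqP.
  rewrite mulf_eq0 invr_eq0 gt_eqF//= => /eqP H; rewrite -[RHS]H; apply/esym.
  exact: (@Rintegral_itv_bndo_bndc R (BLeft 0)).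
have cy : {for y, continuous v} by apply: cv; rewrite !ltW.
have [_] := continuous_FTC1_closed y1 iv y0 cy.
rewrite derive1E => <-.
rewrite (@near_eq_derive _ _ _ _ (cst 0) y 1)//; first by rewrite derive_cst.
near=> x; rewrite prim//; apply/andP; split.
  by near: x; exact: lt_nbhsr.
by apply: ltW; near: x; exact: lt_nbhsl.
Unshelve. all: by end_near. Qed.

End ScaledMeans.

Section Completeness.
Variable R : realType.
Local Notation Re := complex.Re.
Local Notation Im := complex.Im.
Local Notation mR := (measurableTypeR R).
Local Notation plane := (mR * mR)%type.
Local Notation leb := (@lebesgue_measure R).
Local Notation leb2 := (@leb2 R).
Local Notation disc := (@disc R).
Implicit Types (f g h : R[i] -> R[i]) (c z : R[i]).

Let mD := @measurable_disc R.

(** The ray runs through the second coordinate and the first is a dummy, so that the two-variable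
    calculus yields continuity in t. *)
Lemma approxR2_ray f c (w : R * R) : holomorphic f -> normc (w.2%:C * c) < 1 ->
  exists a b, approxR2 (fun w => f (w.2%:C * c)) w a b.
Proof.
move=> hf w1; have [a fa] := (derivable_approxC f _).1 (hf _ w1).
have H := approxR2M (approxR2_snd (approxR1_id w.2)) (approxR2_cst c w).
by do 2 eexists; exact: approxR2_comp fa H.
Qed.

Let ray1 c (t : R) : normc c < 1 -> 0 <= t <= 1 -> normc (t%:C * c) < 1.
Proof.
move=> c1 /andP[t0 t1]; rewrite normcM normc_real ger0_norm//.
by apply: le_lt_trans c1; rewrite ler_piMl// normcge0.
Qed.

Lemma holomorphic_ray_continuous f c (t : R) : holomorphic f -> normc c < 1 -> 0 <= t <= 1 ->
  {for t, continuous (fun t : R => Re (f (t%:C * c)))} /\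
  {for t, continuous (fun t : R => Im (f (t%:C * c)))}.
Proof.
move=> hf c1 t01; have [a [b H]] := @approxR2_ray f c (0, t) hf (ray1 c1 t01).
have [/approx2_diff[d1 _ _] /approx2_diff[d2 _ _]] := approxR2_ReIm H.
by split; [exact: (differentiable_continuous_ver d1)|exact: (differentiable_continuous_ver d2)].
Qed.

Lemma holomorphic_radial_cint f c : holomorphic f -> normc c < 1 ->
  cintegrable leb2 disc (fun w => f ((normc (cplx w) ^+ 2)%:C * c)) /\
  cint leb2 disc (fun w => f ((normc (cplx w) ^+ 2)%:C * c)) =
  pi%:C * cint leb (`[0%R, 1%R[%classic : set mR) (fun t => f (t%:C * c)).
Proof.
move=> hf c1.
have sub : (`[0%R, 1%R[%classic : set mR) `<=` `[0%R, 1%R].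
  by move=> x /=; rewrite !in_itv/= => /andP[-> /ltW].
have i1 : leb.-integrable (`[0%R, 1%R[%classic : set mR)
    (EFin \o (fun t : mR => Re (f (t%:C * c)))).
  apply: (@integrableS _ _ _ leb `[0%R, 1%R]) => //.
  apply: continuous_segment_integrable => t t01.
  by have [] := holomorphic_ray_continuous hf c1 t01.
have i2 : leb.-integrable (`[0%R, 1%R[%classic : set mR)
    (EFin \o (fun t : mR => Im (f (t%:C * c)))).
  apply: (@integrableS _ _ _ leb `[0%R, 1%R]) => //.
  apply: continuous_segment_integrable => t t01.
  by have [] := holomorphic_ray_continuous hf c1 t01.
have [j1 e1] := integrable_disc_radial i1; have [j2 e2] := integrable_disc_radial i2.
split; first by split.
apply: complex_ext.
  by rewrite ReM ReC ImC mul0r subr0.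
by rewrite ImM ReC ImC mul0r addr0.
Qed.

Lemma normc_onem_kernel_ge c z : normc z <= 1 -> 1 - normc c <= normc (1 - c * z^*).
Proof.
move=> z1; apply: le_trans (ler_normcB _ _); rewrite normc1 lerD2l lerN2.
by rewrite normcM normc_conj ler_piMr// normcge0.
Qed.

Lemma onem_kernel_neq0 c z : normc c < 1 -> normc z <= 1 -> 1 - c * z^* != 0.
Proof.
move=> c1 z1; rewrite -normc_gt0; apply: lt_le_trans (normc_onem_kernel_ge c z1).
by rewrite subr_gt0.
Qed.

Lemma normc_kernel_le c z : normc c < 1 -> normc z <= 1 ->
  normc (1 - c * z^*)^-1 <= (1 - normc c)^-1.
Proof.
move=> c1 z1; rewrite normcV lef_pV2 ?posrE ?subr_gt0 ?normc_onem_kernel_ge//.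
by rewrite normc_gt0 onem_kernel_neq0.
Qed.

Lemma cmeasurable_kernel c (D : set plane) :
  cmeasurable D (fun w => (1 - c * (cplx w)^*)^-1).
Proof.
apply: cmeasurableV; apply: cmeasurableB; first exact: cmeasurable_cst.
apply: cmeasurableM; first exact: cmeasurable_cst.
by apply: cmeasurableJ; exact: cmeasurable_cplx.
Qed.

Lemma inL2_cintegrable f : inL2 f -> cintegrable leb2 disc (fun w => f (cplx w)).
Proof.
move=> fL; apply: (eq_cintegrable mD _ (inL2_mulJ_integrable fL (inL2_cst 1))).
by move=> w _; rewrite conjC1 mulr1.
Qed.

Lemma inL2_kernel_integrable f c : inL2 f -> normc c < 1 ->
  cintegrable leb2 disc (fun w => f (cplx w) * (1 - c * (cplx w)^*)^-1).
Proof.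
move=> fL c1; have iF := inL2_cintegrable fL; have nF := cintegrable_normc mD iF.
apply: (@cintegrable_dom _ _ _ leb2 disc mD _
  (fun w => (1 - normc c)^-1 * normc (f (cplx w)))).
- exact: cmeasurableM (cintegrable_meas iF) (cmeasurable_kernel _ _).
- exact: (integrableZl mD _ nF).
- move=> w wD; rewrite normcM mulrC ler_wpM2r ?normcge0//.
  by rewrite normc_kernel_le// ltW.
Qed.

Lemma inA2_kernel_cint f c : inA2 f -> normc c < 1 ->
  cint leb2 disc (fun w => f (cplx w) * (1 - c * (cplx w)^*)^-1) =
  pi%:C * cint leb (`[0%R, 1%R[%classic : set mR) (fun t => f (t%:C * c)).
Proof.
move=> [hf fL] c1; have [iM <-] := holomorphic_radial_cint hf c1.
apply: cint_disc_average => //; first exact: inL2_kernel_integrable.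
move=> w wD; have [h1 h2] := holomorphic_circle_mean hf wD c1; split.
  apply: eq_cintegrable h1 => // t _; by rewrite cplx_crot.
by rewrite -h2; apply: eq_cint => t _; rewrite cplx_crot.
Qed.

Lemma geometric_kernel (x : R[i]) n : x != 1 ->
  (1 - x)^-1 = \sum_(i < n) x ^+ i + x ^+ n * (1 - x)^-1.
Proof.
move=> x1; have x0 : 1 - x != 0 by rewrite subr_eq0 eq_sym.
apply: (mulfI x0); rewrite mulfV// mulrDr mulrCA mulfV// mulr1.
by rewrite -[1 - x]opprB mulNr -subrX1 opprB subrK.
Qed.

Lemma normc_small_eq0 (x : R[i]) (q M : R) : 0 <= q < 1 ->
  (forall n, normc x <= M * q ^+ n) -> x = 0.
Proof.
move=> /andP[q0 q1] H; apply: eq0_normc; apply/eqP; rewrite eq_le normcge0 andbT.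
rewrite leNgt; apply/negP => x0.
have : geometric M q @ \oo --> 0 by apply: cvg_geometric; rewrite ger0_norm.
move=> /cvgrPdist_lt /(_ _ x0) [n _ /(_ n (leqnn n))] /=.
rewrite sub0r normrN => /(le_lt_trans (ler_norm _)).
by rewrite ltNge H.
Qed.

Lemma inL2_ortho_kernel f c : inL2 f -> normc c < 1 ->
  (forall n, inner f (fun z => z ^+ n) = 0) ->
  cint leb2 disc (fun w => f (cplx w) * (1 - c * (cplx w)^*)^-1) = 0.
Proof.
move=> fL c1 f0; have iF := inL2_cintegrable fL; have nF := cintegrable_normc mD iF.
have n0 := @normcge0 R.
pose A := \int[leb2]_(w in disc) normc (f (cplx w)).
apply: (@normc_small_eq0 _ (normc c) (2 * ((1 - normc c)^-1 * A))); first by rewrite n0.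
move=> n.
pose S (i : nat) (w : plane) := c ^+ i * (f (cplx w) * (cplx w ^+ i)^*).
have iS i : cintegrable leb2 disc (S i).
  exact: (cintegrableZ mD (c ^+ i) (inL2_mulJ_integrable fL (monomial_inL2 i))).
have iSn := cintegrable_sum mD n iS.
have iK := inL2_kernel_integrable fL c1.
(* Subtracting a partial sum of the geometric series costs nothing, as f is orthogonal to the
   monomials. What is left carries the factor (c wbar)^n, so no interchange of sum and integral is
   involved. *)
have -> : cint leb2 disc (fun w => f (cplx w) * (1 - c * (cplx w)^*)^-1) =
    cint leb2 disc (fun w => f (cplx w) * (1 - c * (cplx w)^*)^-1 - \sum_(i < n) S i w).
  rewrite (cintB mD iK iSn) (cint_sum mD n iS) big1 ?subr0// => i _.
  rewrite /S (cintZ mD _ (inL2_mulJ_integrable fL (monomial_inL2 i))).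
  by rewrite [X in _ * X](f0 i) mulr0.
have mB := cintegrable_meas (cintegrableB mD iK iSn).
have -> : 2 * ((1 - normc c)^-1 * A) * normc c ^+ n =
   2 * (normc c ^+ n * (1 - normc c)^-1 * A) by ring.
rewrite -(RintegralZl _ mD nF).
apply: (normc_cint_le mD mB); first exact: (integrableZl mD _ nF).
move=> w wD; have x1 : c * (cplx w)^* != 1.
  by rewrite eq_sym -subr_eq0 onem_kernel_neq0// ltW.
have -> : f (cplx w) * (1 - c * (cplx w)^*)^-1 - \sum_(i < n) S i w =
    f (cplx w) * ((c * (cplx w)^*) ^+ n * (1 - c * (cplx w)^*)^-1).
  rewrite [X in _ * X - _](geometric_kernel n x1) mulrDr mulr_sumr.
  rewrite (eq_bigr (fun i : 'I_n => S i w)); first by rewrite addrC addKr.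
  by move=> i _; rewrite /S exprMn rmorphXn/= mulrCA.
rewrite normcM mulrC ler_wpM2r// normcM ler_pM//.
- rewrite normcX lerXn2r ?nnegrE// normcM normc_conj ler_piMr//; exact: ltW.
- by rewrite normc_kernel_le// ltW.
Qed.

Theorem inA2_monomials_complete f : inA2 f ->
  (forall n, inner f (fun z => z ^+ n) = 0) -> forall z, normc z < 1 -> f z = 0.
Proof.
move=> fA f0.
have H c : normc c < 1 ->
    cint leb (`[0%R, 1%R[%classic : set mR) (fun t => f (t%:C * c)) = 0.
  move=> c1; have := inA2_kernel_cint fA c1; rewrite inL2_ortho_kernel//; last by case: fA.
  move=> /esym/eqP; rewrite mulf_eq0 => /orP[/eqP/(congr1 (@Re R)) /= /eqP|/eqP//].
  by rewrite gt_eqF// pi_gt0.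
(* Applied at x c, [H] says that t |-> f(x t c) has mean zero for every x in ]0, 1], which is the
   hypothesis of [scaled_means_eq0]. *)
have ray c y : normc c < 1 -> 0 < y < 1 -> f (y%:C * c) = 0.
  move=> c1 y01.
  have hx (x t : R) : t%:C * (x%:C * c) = (x * t)%:C * c.
    by rewrite mulrA -realCM [t * x]mulrC.
  have x1 (x : R) : 0 < x <= 1 -> normc (x%:C * c) < 1.
    by move=> /andP[x0 xl]; apply: ray1 => //; rewrite ltW.
  apply: complex_ext.
  - apply: (@scaled_means_eq0 R (fun t => Re (f (t%:C * c)))) => //.
      by move=> t t01; have [] := holomorphic_ray_continuous fA.1 c1 t01.
    move=> x x01; have /(congr1 (@Re R)) := H _ (x1 x x01).
    by move=> h; rewrite -[RHS]h; apply: eq_Rintegral => t _; rewrite hx.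
  - apply: (@scaled_means_eq0 R (fun t => Im (f (t%:C * c)))) => //.
      by move=> t t01; have [] := holomorphic_ray_continuous fA.1 c1 t01.
    move=> x x01; have /(congr1 (@Im R)) := H _ (x1 x x01).
    by move=> h; rewrite -[RHS]h; apply: eq_Rintegral => t _; rewrite hx.
(* [ray] needs both y < 1 and |z / y| < 1; the midpoint of |z| and 1 provides them, for z = 0 as
   well. *)
move=> z z1; pose y := (1 + normc z) / 2.
have n0 := normcge0 z.
have y0 : 0 < y by rewrite /y; lra.
have y1 : y < 1 by rewrite /y; lra.
have -> : z = y%:C * (y^-1%:C * z).
  by rewrite mulrA -realCM mulfV ?gt_eqF// mul1r.
apply: ray; last by rewrite y0.
rewrite normcM normc_real ger0_norm ?invr_ge0 ?(ltW y0)// mulrC ltr_pdivrMr// mul1r.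
by rewrite /y; lra.
Qed.

End Completeness.

(** * The Bergman projection *)

Section KernelOperator.
Variable R : realType.
Local Notation Re := complex.Re.
Local Notation Im := complex.Im.
Local Notation mR := (measurableTypeR R).
Local Notation plane := (mR * mR)%type.
Local Notation leb := (@lebesgue_measure R).
Local Notation leb2 := (@leb2 R).
Local Notation disc := (@disc R).
Implicit Types (f g h k : R[i] -> R[i]) (c z : R[i]).

Let mD := @measurable_disc R.

Definition bergman_integral f z : R[i] :=
  pi^-1%:C * cint leb2 disc (fun w => f (cplx w) * (1 - z * (cplx w)^*)^-1 ^+ 2).

Lemma inL2_mul_bounded f (K : plane -> R[i]) (M : R) : inL2 f -> cmeasurable disc K ->
  (forall w, disc w -> normc (K w) <= M) ->
  cintegrable leb2 disc (fun w => f (cplx w) * K w) /\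
  normc (cint leb2 disc (fun w => f (cplx w) * K w)) <=
    2 * M * \int[leb2]_(w in disc) normc (f (cplx w)).
Proof.
move=> fL mK KM; have iF := inL2_cintegrable fL; have nF := cintegrable_normc mD iF.
have mB : cmeasurable disc (fun w => f (cplx w) * K w).
  exact: cmeasurableM (cintegrable_meas iF) mK.
have le w : disc w -> normc (f (cplx w) * K w) <= M * normc (f (cplx w)).
  by move=> wD; rewrite normcM mulrC ler_wpM2r ?normcge0// KM.
split; first exact: (cintegrable_dom mD mB (integrableZl mD M nF) le).
rewrite -mulrA -(RintegralZl _ mD nF).
exact: (normc_cint_le mD mB (integrableZl mD M nF) le).
Qed.

Lemma normc_nat n : normc (n%:R : R[i]) = n%:R.
Proof.
have -> : n%:R = (n%:R)%:C :> R[i] by rewrite rmorph_nat.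
by rewrite normc_real ger0_norm.
Qed.

Let mK (n : nat) c : cmeasurable disc (fun w : plane => (1 - c * (cplx w)^*)^-1 ^+ n).
Proof. by apply: cmeasurableX; exact: cmeasurable_kernel. Qed.

Let mJ : cmeasurable disc (fun w : plane => (cplx w)^*).
Proof. by apply: cmeasurableJ; exact: cmeasurable_cplx. Qed.

Let pi0 : 0 < pi^-1 :> R. Proof. by rewrite invr_gt0 pi_gt0. Qed.

(** Differentiation under the integral, made explicit: the second-order remainder of the kernel is
    bounded by a multiple of |h|^2, uniformly in w. *)
Lemma bergman_integral_holomorphic f : inL2 f -> holomorphic (bergman_integral f).
Proof.
move=> fL z z1; apply/derivable_approxC.
have n0 := @normcge0 R; have nz := n0 z.
(* Half the distance from z to the unit circle: for |h| < r both z and z + h have modulus at most 1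
   - r, so both kernels 1 / (1 - . wbar) are at most 1 / r. *)
pose r := (1 - normc z) / 2.
have r0 : 0 < r by rewrite /r divr_gt0// subr_gt0.
pose A (w : plane) := 1 - z * (cplx w)^*.
pose K1 (w : plane) := 2%:R * (cplx w)^* * (A w)^-1 ^+ 3.
have kb c w : normc c <= 1 - r -> disc w -> normc (1 - c * (cplx w)^*)^-1 <= r^-1.
  move=> cr wD; rewrite normcV lef_pV2 ?posrE//.
    apply: le_trans (normc_onem_kernel_ge c (ltW wD)).
    by rewrite lerBrDr -lerBrDl.
  by rewrite normc_gt0 onem_kernel_neq0 ?(ltW wD)// (le_lt_trans cr)// ltrBlDr ltrDl.
have zr : normc z <= 1 - r.
  by rewrite /r; lra.
have mK1 : cmeasurable disc K1.
  apply: cmeasurableM; last exact: mK.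
  by apply: (cmeasurableM (cmeasurable_cst _ _)); exact: mJ.
have ri0 : 0 < r^-1 by rewrite invr_gt0.
have kbX c n w : normc c <= 1 - r -> disc w ->
    normc ((1 - c * (cplx w)^*)^-1 ^+ n) <= r^-1 ^+ n.
  by move=> cr wD; rewrite normcX lerXn2r ?nnegrE ?(ltW ri0)// kb.
have wJ (w : plane) : disc w -> normc (cplx w)^* <= 1 by move=> wD; rewrite normc_conj ltW.
have K1b w : disc w -> normc (K1 w) <= 2 * r^-1 ^+ 3.
  move=> wD; rewrite /K1 normcM normcM normc_nat -mulrA ler_wpM2l// -[leRHS]mul1r.
  by rewrite ler_pM// ?wJ// kbX.
pose a := pi^-1%:C * cint leb2 disc (fun w => f (cplx w) * K1 w).
exists a => e e0.
pose N := \int[leb2]_(w in disc) normc (f (cplx w)).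
have N0 : 0 <= N by apply: Rintegral_ge0 => w _.
(* In [rem] below there are five kernel factors, each at most 1 / r, and |3 A - 2 h wbar| <= 10
   because |A| <= 2 and |h| <= 1. The 2 comes from [inL2_mul_bounded]. *)
pose C := pi^-1 * (2 * (10 * r^-1 ^+ 5) * N) + 1.
have C0 : 0 < C.
  by rewrite /C ltr_wpDl// !mulr_ge0 ?exprn_ge0 ?invr_ge0// ?(ltW r0)// pi_ge0.
exists (Num.min r (e / C)); first by rewrite lt_min r0 divr_gt0.
move=> h; rewrite lt_min => /andP[hr he].
have zhr : normc (z + h) <= 1 - r.
  by apply: (le_trans (le_normcD _ _)); move: hr; rewrite /r; lra.
have r1 : r <= 1 by rewrite /r; lra.
(* With x = h wbar this is the exact identity (A - x)^-2 - A^-2 - 2 x A^-3 = x^2 (3 A - 2 x) / (A^3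
   (A - x)^2). *)
pose rem (w : plane) := (h * (cplx w)^*) ^+ 2 * (3%:R * A w - 2%:R * (h * (cplx w)^*)) *
  ((A w)^-1 ^+ 3 * (1 - (z + h) * (cplx w)^*)^-1 ^+ 2).
have K1E w : disc w -> (1 - (z + h) * (cplx w)^*)^-1 ^+ 2 - (1 - z * (cplx w)^*)^-1 ^+ 2
    - h * K1 w = rem w.
  move=> wD; have A0 : A w != 0 by rewrite onem_kernel_neq0// ltW.
  have B0 : 1 - (z + h) * (cplx w)^* != 0.
    by rewrite onem_kernel_neq0 ?(ltW wD)// (le_lt_trans zhr)// ltrBlDr ltrDl.
  have BE : 1 - (z + h) * (cplx w)^* = A w - h * (cplx w)^* by rewrite /A; ring.
  rewrite /rem /K1 -/(A w) BE in B0 *; field.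
  by rewrite A0 B0.
have mA : cmeasurable disc A.
  apply: (cmeasurableB (cmeasurable_cst _ _)); exact: (cmeasurableM (cmeasurable_cst _ _)).
have mh : cmeasurable disc (fun w => h * (cplx w)^*).
  exact: (cmeasurableM (cmeasurable_cst _ _)).
have mrem : cmeasurable disc rem.
  apply: cmeasurableM; last exact: (cmeasurableM (mK 3 z) (mK 2 (z + h))).
  apply: cmeasurableM; first exact: cmeasurableX.
  by apply: cmeasurableB; apply: (cmeasurableM (cmeasurable_cst _ _)).
have hw w : disc w -> normc (h * (cplx w)^*) <= normc h.
  by move=> wD; rewrite normcM ler_piMr// wJ.
have remb w : disc w -> normc (rem w) <= 10 * r^-1 ^+ 5 * normc h ^+ 2.
  move=> wD; rewrite /rem (normcM (_ * _)) (normcM (_ ^+ 2)) (normcM (_^-1 ^+ 3)) (normcX _ 2).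
  have -> : 10 * r^-1 ^+ 5 * normc h ^+ 2 =
      normc h ^+ 2 * 10 * (r^-1 ^+ 3 * r^-1 ^+ 2) by rewrite -exprD; ring.
  apply: ler_pM; rewrite ?mulr_ge0 ?exprn_ge0//.
    apply: ler_pM; rewrite ?exprn_ge0//.
      by rewrite lerXn2r ?nnegrE// hw.
    apply: (le_trans (le_normcB _ _)); rewrite !(normcM _%:R) !normc_nat.
    have Aw : normc (A w) <= 2.
      apply: (le_trans (le_normcB _ _)); rewrite normc1 normcM.
      have : normc z * normc (cplx w)^* <= normc z by rewrite ler_piMr// wJ.
      by move: z1; lra.
    by move: (hw w wD) hr r1 Aw; lra.
  by apply: ler_pM => //; rewrite kbX.
have [i1 b1] := inL2_mul_bounded fL mrem remb.
have [i2 _] := inL2_mul_bounded fL (mK 2 (z + h)) (fun w wD => kbX _ 2 w zhr wD).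
have [i3 _] := inL2_mul_bounded fL (mK 2 z) (fun w wD => kbX _ 2 w zr wD).
have [i4 _] := inL2_mul_bounded fL mK1 K1b.
have -> : bergman_integral f (z + h) - bergman_integral f z - a * h - 0 * h^* =
    pi^-1%:C * cint leb2 disc (fun w => f (cplx w) * rem w).
  have -> : cint leb2 disc (fun w => f (cplx w) * rem w) =
      cint leb2 disc (fun w => f (cplx w) * (1 - (z + h) * (cplx w)^*)^-1 ^+ 2
        - f (cplx w) * (1 - z * (cplx w)^*)^-1 ^+ 2 - h * (f (cplx w) * K1 w)).
    by apply: eq_cint => w wD; rewrite -(K1E w wD); ring.
  rewrite (cintB mD (cintegrableB mD i2 i3) (cintegrableZ mD h i4)) (cintB mD i2 i3).
  by rewrite (cintZ mD h i4) /a /bergman_integral; ring.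
rewrite normcM normc_real gtr0_norm//; apply: (le_trans (ler_wpM2l (ltW pi0) b1)).
have -> : pi^-1 * (2 * (10 * r^-1 ^+ 5 * normc h ^+ 2) * N) =
  (C - 1) * normc h * normc h by rewrite /C; ring.
rewrite ler_wpM2r//; apply: (@le_trans _ _ (C * normc h)).
  by rewrite ler_wpM2r// lerBlDr lerDl.
by rewrite mulrC -ler_pdivlMr// ltW.
Qed.

(** The derivative of the geometric series with its exact remainder. The coefficients i + 1 are, up
    to pi, the squared normalisations of the basis. *)
Lemma sum_onem_kernel (x : R[i]) n : x != 1 ->
  (1 - x)^-1 ^+ 2 = \sum_(i < n) i.+1%:R * x ^+ i +
    x ^+ n * (1 + n%:R * (1 - x)) * (1 - x)^-1 ^+ 2.
Proof.
move=> x1; have x0 : 1 - x != 0 by rewrite subr_eq0 eq_sym.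
elim: n => [|n ih]; first by rewrite big_ord0 add0r expr0 mul0r addr0 !mul1r.
rewrite big_ord_recr/= {1}ih -!addrA; congr (_ + _).
apply: (mulfI (expf_neq0 2 x0)).
have e (y : R[i]) : (1 - x) ^+ 2 * (y * (1 - x)^-1 ^+ 2) = y.
  by rewrite mulrCA -exprMn mulfV// expr1n mulr1.
have E1 : n.+1%:R = n%:R + 1 :> R[i] by rewrite natr1.
by rewrite [RHS]mulrDr !e E1 [x ^+ n.+1]exprS; ring.
Qed.

(** The factor n + 1 of the differentiated series is absorbed by half of the decay: with r the
    square root of q, (n + 1) r^n is at most 1 + r + ... + r^n <= 1 / (1 - r). *)
Lemma natmul_exp_small (q : R) : 0 <= q < 1 -> exists2 r : R, 0 <= r < 1 &
  exists2 C, 0 <= C & forall n, n.+1%:R * q ^+ n <= C * r ^+ n.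
Proof.
move=> /andP[q0 q1]; pose r := Num.sqrt q.
have r0 : 0 <= r by exact: sqrtr_ge0.
have r1 : r < 1 by rewrite /r -[X in _ < X]sqrtr1 ltr_sqrt.
have r10 : 0 < 1 - r by rewrite subr_gt0.
exists r; first by rewrite r0.
exists (1 - r)^-1; first by rewrite invr_ge0 ltW.
move=> n; have -> : q = r * r by rewrite -expr2 sqr_sqrtr.
rewrite exprMn mulrA ler_wpM2r ?exprn_ge0//.
rewrite -[leRHS]mul1r ler_pdivlMr//; apply: (@le_trans _ _ ((\sum_(i < n.+1) r ^+ i) * (1 - r))).
  rewrite ler_wpM2r ?(ltW r10)// mulrC mulr_natr.
  have -> : r ^+ n *+ n.+1 = \sum_(i < n.+1) r ^+ n by rewrite sumr_const card_ord.
  by apply: ler_sum => i _; rewrite ler_wiXn2l ?(ltW r1)// -ltnS.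
by rewrite mulrC -[1 - r]opprB mulNr -subrX1 opprB lerBlDr lerDl exprn_ge0.
Qed.

End KernelOperator.

(** * The normalised monomials as an orthonormal basis *)

Section BergmanBasis.
Variable R : realType.
Local Notation e := (@bergman_basis R).

Lemma realCD (a b : R) : (a + b)%:C = a%:C + b%:C :> R[i].
Proof. by apply: complex_ext; rewrite !reimE ?addr0. Qed.

Let s n : R := Num.sqrt (n.+1%:R / pi).

Lemma sqr_basis_coef n : s n ^+ 2 = n.+1%:R / pi.
Proof. by rewrite sqr_sqrtr// divr_ge0// pi_ge0. Qed.

Lemma basis_coef_gt0 n : 0 < s n.
Proof. by rewrite sqrtr_gt0 divr_gt0// pi_gt0. Qed.

Lemma bergman_basis_inA2 n : inA2 (e n).
Proof. exact: inA2Z (monomial_inA2 n). Qed.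

Lemma inner_bergman_basis f n : inL2 f ->
  inner f (e n) = (s n)%:C * inner f (fun z => z ^+ n).
Proof.
move=> fL; rewrite (@innerZr R (s n)%:C f (fun z => z ^+ n))//; last exact: monomial_inL2.
by congr (_ * _); apply: complex_ext; rewrite !reimE// oppr0.
Qed.

Lemma bergman_basis_orthonormal m n : inner (e m) (e n) = (m == n)%:R.
Proof.
rewrite inner_bergman_basis; last by case: (bergman_basis_inA2 m).
rewrite (@innerZl R (s m)%:C (fun z => z ^+ m)); try exact: monomial_inL2.
have [->|mn] := eqVneq m n; last by rewrite inner_monomial_neq ?mulr0//; apply/eqP.
rewrite inner_diag; last exact: monomial_inL2.
rewrite dnorm2_monomial -!realCM mulrA -expr2 sqr_basis_coef mulrA divfK ?gt_eqF ?pi_gt0//.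
by rewrite divff ?pnatr_eq0.
Qed.

Lemma bergman_basis_complete f : inA2 f -> (forall n, inner f (e n) = 0) ->
  forall z, normc z < 1 -> f z = 0.
Proof.
move=> fA f0; apply: inA2_monomials_complete => // n.
have := f0 n; rewrite inner_bergman_basis; last by case: fA.
move=> /eqP; rewrite mulf_eq0 => /orP[/eqP/(congr1 (@complex.Re R)) /= /eqP|/eqP//].
by rewrite gt_eqF// basis_coef_gt0.
Qed.

End BergmanBasis.

(** * Convergence of the Fourier sums to the kernel integral *)

Section FourierSums.
Variable R : realType.
Local Notation Re := complex.Re.
Local Notation Im := complex.Im.
Local Notation mR := (measurableTypeR R).
Local Notation plane := (mR * mR)%type.
Local Notation leb2 := (@leb2 R).
Local Notation disc := (@disc R).
Local Notation e := (@bergman_basis R).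
Implicit Types (f g h k : R[i] -> R[i]) (c z : R[i]).

Let mD := @measurable_disc R.
Let eL n : inL2 (e n). Proof. by case: (bergman_basis_inA2 R n). Qed.

Definition fourier_sum f (n : nat) z : R[i] := \sum_(i < n) inner f (e i) * e i z.

Definition fourier_mass f (n : nat) : R := \sum_(i < n) normc (inner f (e i)) ^+ 2.

Lemma holomorphic_sum (F : nat -> R[i] -> R[i]) n : (forall i, inA2 (F i)) ->
  inA2 (fun z => \sum_(i < n) F i z).
Proof.
move=> FA; elim: n => [|n ih].
  have := inA2B (FA 0%N) (FA 0%N).
  by congr inA2; apply/funext => z; rewrite big_ord0 subrr.
have := inA2D ih (FA n).
by congr inA2; apply/funext => z; rewrite big_ord_recr.
Qed.

Lemma fourier_sum_inA2 f n : inA2 (fourier_sum f n).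
Proof.
apply: (@holomorphic_sum (fun i z => inner f (e i) * e i z)) => i.
exact: inA2Z (bergman_basis_inA2 R i).
Qed.

Let pL f n : inL2 (fourier_sum f n). Proof. by case: (fourier_sum_inA2 f n). Qed.

Lemma inner_fourier_sum_l f h n : inL2 h ->
  inner (fourier_sum f n) h = \sum_(i < n) inner f (e i) * inner (e i) h.
Proof.
move=> hL; rewrite (@inner_suml R n (fun i z => inner f (e i) * e i z))//; last first.
  by move=> i; exact: inL2Z.
by apply: eq_bigr => i _; rewrite innerZl.
Qed.

Lemma inner_fourier_sum_basis f n i :
  inner (fourier_sum f n) (e i) = if (i < n)%N then inner f (e i) else 0.
Proof.
rewrite inner_fourier_sum_l//; case: ifPn => [lin|].
  rewrite (bigD1 (Ordinal lin))//= bergman_basis_orthonormal eqxx mulr1 big1 ?addr0// => j ji.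
  rewrite bergman_basis_orthonormal (_ : (j == i :> nat) = false) ?mulr0//.
  by apply/negbTE; apply: contra ji => /eqP ji; apply/eqP/val_inj.
rewrite -leqNgt => ni; rewrite big1// => j _.
rewrite bergman_basis_orthonormal (_ : (j == i :> nat) = false) ?mulr0//.
by apply/negbTE; rewrite neq_ltn (leq_trans (ltn_ord j) ni).
Qed.

(** Only the first n coefficients of g matter. This serves for g = f in Bessel's inequality and for
    g a longer or equal Fourier sum of f. *)
Lemma inner_fourier_sum_r f g n : inL2 g ->
  (forall i, (i < n)%N -> inner g (e i) = inner f (e i)) ->
  inner g (fourier_sum f n) = (fourier_mass f n)%:C.
Proof.
move=> gL gf; rewrite innerC// inner_fourier_sum_l// rmorph_sum/= /fourier_mass.
rewrite (big_morph (fun r => r%:C) (id1 := 0) (op1 := +%R) (@realCD R) (erefl _)).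
apply: eq_bigr => i _; rewrite (innerC gL (eL i)) gf// mul_conjc.
by apply: complex_ext; rewrite !reimE// oppr0.
Qed.

Lemma dnorm2_fourier_sum f n : dnorm2 (fourier_sum f n) = fourier_mass f n.
Proof.
have := @inner_fourier_sum_r f (fourier_sum f n) n (pL f n).
rewrite inner_diag// => H; apply: (congr1 (@Re R) (H _)).
by move=> i lin; rewrite inner_fourier_sum_basis lin.
Qed.

Lemma dnorm2_fourier_sumB f m n : (n <= m)%N ->
  dnorm2 (fun z => fourier_sum f m z - fourier_sum f n z) =
  fourier_mass f m - fourier_mass f n.
Proof.
move=> nm; rewrite dnorm2B// !dnorm2_fourier_sum inner_fourier_sum_r//.
  by rewrite ReC; ring.
by move=> i lin; rewrite inner_fourier_sum_basis (leq_trans lin).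
Qed.

Lemma bessel f n : inL2 f -> fourier_mass f n <= dnorm2 f.
Proof.
move=> fL; rewrite -subr_ge0.
have := dnorm2_ge0 (fun z => f z - fourier_sum f n z).
rewrite dnorm2B// dnorm2_fourier_sum inner_fourier_sum_r// ReC.
by congr (_ <= _); ring.
Qed.

Lemma fourier_mass_nd f : nondecreasing_seq (fourier_mass f).
Proof.
apply/nondecreasing_seqP => n.
by rewrite /fourier_mass big_ord_recr lerDl sqr_ge0.
Qed.

Lemma fourier_mass_cvg f : inL2 f -> cvgn (fourier_mass f).
Proof.
move=> fL; apply: nondecreasing_is_cvgn; first exact: fourier_mass_nd.
by exists (dnorm2 f) => _ [n _ <-]; exact: bessel.
Qed.

Lemma fourier_sum_cvg f z : inL2 f -> normc z < 1 ->
  normc (bergman_integral f z - fourier_sum f n z) @[n --> \oo] --> 0.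
Proof.
move=> fL z1; have n0 := @normcge0 R.
have [r /andP[r0 r1] [C C0 HC]] := @natmul_exp_small R (normc z) (introT andP (conj (n0 z) z1)).
pose N := \int[leb2]_(w in disc) normc (f (cplx w)).
have z10 : 0 < 1 - normc z by rewrite subr_gt0.
pose K n w := (z * (cplx w)^*) ^+ n * (1 + n%:R * (1 - z * (cplx w)^*)) *
  (1 - z * (cplx w)^*)^-1 ^+ 2.
pose x (w : plane) := z * (cplx w)^*.
have mx : cmeasurable disc x.
  apply: (cmeasurableM (cmeasurable_cst _ _)).
  by apply: cmeasurableJ; exact: cmeasurable_cplx.
have m1x : cmeasurable disc (fun w => 1 - x w) by exact: (cmeasurableB (cmeasurable_cst _ _)).
have mV : cmeasurable disc (fun w => (1 - x w)^-1 ^+ 2).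
  by apply: cmeasurableX; exact: cmeasurableV.
have mK n : cmeasurable disc (K n).
  apply: (cmeasurableM _ mV); apply: cmeasurableM; first exact: cmeasurableX.
  by apply: (cmeasurableD (cmeasurable_cst _ _)); exact: (cmeasurableM (cmeasurable_cst _ _)).
have xq w : disc w -> normc (x w) <= normc z.
  by move=> wD; rewrite normcM normc_conj ler_piMr// ltW.
have Vb w : disc w -> normc ((1 - x w)^-1 ^+ 2) <= (1 - normc z)^-1 ^+ 2.
  move=> wD; rewrite normcX lerXn2r ?nnegrE ?invr_ge0 ?(ltW z10)//.
  by rewrite normc_kernel_le// ltW.
(* Since |1 + n (1 - x)| <= 1 + 2 n <= 2 (n + 1), the remainder is at most 2 (n + 1) |z|^n (1 -
   |z|)^-2, and [HC] bounds (n + 1) |z|^n by C r^n. *)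
pose D0 := 2 * C * (1 - normc z)^-1 ^+ 2.
have Kb n w : disc w -> normc (K n w) <= D0 * r ^+ n.
  move=> wD; rewrite /K -/(x w) (normcM (_ * _)) (normcM (_ ^+ n)) normcX.
  have -> : D0 * r ^+ n = 2 * (C * r ^+ n) * (1 - normc z)^-1 ^+ 2 by rewrite /D0; ring.
  apply: ler_pM; rewrite ?mulr_ge0 ?exprn_ge0 ?Vb//.
  apply: (@le_trans _ _ (normc z ^+ n * (2 * n.+1%:R))).
    apply: ler_pM; rewrite ?exprn_ge0//; first by rewrite lerXn2r ?nnegrE ?xq.
    apply: (le_trans (le_normcD _ _)); rewrite normc1 normcM normc_nat.
    have h1 : normc (1 - x w) <= 2.
      apply: (le_trans (le_normcB _ _)); rewrite normc1.
      by have := xq w wD; move: z1; lra.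
    have -> : n.+1%:R = n%:R + 1 :> R by rewrite natr1.
    by have := ler_wpM2l (ler0n R n) h1; lra.
  by rewrite mulrCA ler_wpM2l// mulrC.
have E n : bergman_integral f z - fourier_sum f n z =
    pi^-1%:C * cint leb2 disc (fun w => f (cplx w) * K n w).
  pose S (i : nat) (w : plane) := (i.+1%:R * z ^+ i) * (f (cplx w) * (cplx w ^+ i)^*).
  have iM i := inL2_mulJ_integrable fL (monomial_inL2 i).
  have iS i : cintegrable leb2 disc (S i) by exact: (cintegrableZ mD _ (iM i)).
  have iSn := cintegrable_sum mD n iS.
  have [iK _] := inL2_mul_bounded fL mV Vb.
  have -> : fourier_sum f n z = pi^-1%:C * cint leb2 disc (fun w => \sum_(i < n) S i w).
    rewrite (cint_sum mD n iS) mulr_sumr; apply: eq_bigr => i _.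
    rewrite /S (cintZ mD _ (iM i)) inner_bergman_basis// /bergman_basis.
    set I := inner _ _; set I' := cint _ _ _; have -> : I' = I by [].
    (* The normalisation enters once through the coefficient <f, u_i> and once through u_i itself;
       its square (i + 1) / pi is the coefficient of the kernel series. *)
    set t := Num.sqrt _; have tt : t%:C * t%:C = pi^-1%:C * i.+1%:R :> R[i].
      rewrite -realCM -expr2 sqr_basis_coef mulrC realCM; congr (_ * _).
      by rewrite [RHS](_ : _ = (i.+1%:R)%:C) ?rmorph_nat.
    transitivity (t%:C * t%:C * z ^+ i * I); first by ring.
    by rewrite tt; ring.
  rewrite /bergman_integral -mulrBr -(cintB mD iK iSn); congr (_ * _).
  apply: eq_cint => w wD; have x1 : x w != 1.
    by rewrite eq_sym -subr_eq0 onem_kernel_neq0// ltW.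
  rewrite (sum_onem_kernel n x1) mulrDr mulr_sumr.
  rewrite (eq_bigr (fun i : 'I_n => S i w)); first by rewrite addrC addKr.
  by move=> i _; rewrite /S /x exprMn rmorphXn/=; ring.
pose D := pi^-1 * (2 * D0 * N).
have cD : (geometric D r) @ \oo --> 0 by apply: cvg_geometric; rewrite ger0_norm.
apply: (@squeeze_cvgr _ _ _ _ (fun=> 0) (geometric D r)) => //; last exact: cvg_cst.
near=> n; rewrite n0/= E normcM normc_real gtr0_norm ?invr_gt0 ?pi_gt0//.
have [_ b] := inL2_mul_bounded fL (mK n) (Kb n).
rewrite [leRHS](_ : _ = pi^-1 * (2 * (D0 * r ^+ n) * N)); last by rewrite /= /D; ring.
by rewrite ler_wpM2l ?invr_ge0 ?pi_ge0.
Unshelve. all: by end_near. Qed.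

(** A pointwise limit of polynomials. *)
Lemma bergman_integral_cmeasurable f : inL2 f ->
  cmeasurable disc (fun w => bergman_integral f (cplx w)).
Proof.
move=> fL; have mp n := inL2_cmeas (pL f n).
have cv w : disc w -> normc (bergman_integral f (cplx w) - fourier_sum f n (cplx w))
    @[n --> \oo] --> 0 by move=> wD; exact: fourier_sum_cvg.
split.
- apply: (@measurable_fun_cvg _ _ _ _ (fun n w => Re (fourier_sum f n (cplx w)))).
    by move=> n; case: (mp n).
  move=> w wD; apply/cvgrPdist_lt => eps eps0.
  have /cvgrPdist_lt/(_ _ eps0) := cv w wD; apply: filterS => n.
  rewrite sub0r normrN ger0_norm ?normcge0//; apply: le_lt_trans.
  by rewrite -ReN -ReD ler_normc_Re.
- apply: (@measurable_fun_cvg _ _ _ _ (fun n w => Im (fourier_sum f n (cplx w)))).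
    by move=> n; case: (mp n).
  move=> w wD; apply/cvgrPdist_lt => eps eps0.
  have /cvgrPdist_lt/(_ _ eps0) := cv w wD; apply: filterS => n.
  rewrite sub0r normrN ger0_norm ?normcge0//; apply: le_lt_trans.
  by rewrite -ImN -ImD ler_normc_Im.
Qed.

(* Fatou's lemma along [fourier_sum f (m + n) - fourier_sum f n], as m tends to infinity. *)
Lemma integral_bergman_integralB_le f n : inL2 f ->
  (\int[leb2]_(w in disc)
    (normc (bergman_integral f (cplx w) - fourier_sum f n (cplx w)) ^+ 2)%:E <=
   (limn (fourier_mass f) - fourier_mass f n)%:E)%E.
Proof.
move=> fL.
pose G m w := (normc (fourier_sum f (m + n) (cplx w) - fourier_sum f n (cplx w)) ^+ 2)%:E.
have GL m : inL2 (fun z => fourier_sum f (m + n) z - fourier_sum f n z) by exact: inL2B.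
have mG m : measurable_fun disc (G m) by case: (GL m) => m1 m2 _; exact: measurable_normc2 m1 m2.
have G0 m w : disc w -> (0 <= G m w)%E by move=> _; rewrite lee_fin sqr_ge0.
have := fatou leb2 mD mG G0.
have -> : limn_einf (fun m => \int[leb2]_(w in disc) G m w)%E =
    (limn (fourier_mass f) - fourier_mass f n)%:E.
  have -> : (fun m => \int[leb2]_(w in disc) G m w)%E =
      (fun m => (fourier_mass f (m + n) - fourier_mass f n)%:E).
    by apply/funext => m; rewrite -dnorm2_fourier_sumB ?leq_addl// -dnorm2E.
  apply: (cvg_limn_einf_sup _).1; apply: cvg_EFin; first exact: nearW.
  apply: cvgB; last exact: cvg_cst.
  rewrite (cvg_shiftn n (fourier_mass f)); exact: fourier_mass_cvg.
congr (_ <= _)%E; apply: eq_integral => w /set_mem wD.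
apply: (cvg_limn_einf_sup _).1; apply: cvg_EFin; first exact: nearW.
set b := bergman_integral f (cplx w); set p := fourier_sum f n (cplx w).
have c1 : normc (fourier_sum f (m + n) (cplx w) - p) @[m --> \oo] --> normc (b - p).
  apply/cvgrPdist_lt => eps eps0.
  have := fourier_sum_cvg fL wD; rewrite -(cvg_shiftn n) => /cvgrPdist_lt/(_ _ eps0).
  apply: filterS => m; rewrite sub0r normrN ger0_norm ?normcge0//; apply: le_lt_trans.
  apply: (le_trans (ler_dist_normc _ _)).
  by rewrite opprB addrA subrK.
exact: (cvgM c1 c1).
Qed.

Lemma bergman_integral_inA2 f : inL2 f -> inA2 (bergman_integral f).
Proof.
move=> fL; split; first exact: bergman_integral_holomorphic.
have [m1 m2] := bergman_integral_cmeasurable fL.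
split=> //; apply: le_lt_trans (ltry (limn (fourier_mass f) - fourier_mass f 0)).
(* For n = 0 the Fourier sum is empty and the Fatou bound becomes a bound on the norm of the kernel
   integral itself. *)
apply: le_trans (integral_bergman_integralB_le 0 fL).
rewrite le_eqVlt; apply/orP; left; apply/eqP; apply: eq_integral => w _.
by rewrite /fourier_sum big_ord0 subr0.
Qed.

Lemma dnorm2_bergman_integralB f n : inL2 f ->
  dnorm2 (fun z => bergman_integral f z - fourier_sum f n z) <=
  limn (fourier_mass f) - fourier_mass f n.
Proof.
move=> fL; rewrite -lee_fin -dnorm2E; first exact: integral_bergman_integralB_le.
by apply: inL2B => //; case: (bergman_integral_inA2 fL).
Qed.

(** The tails of [fourier_mass f] tend to 0. Requiring the bound only from rank m on leaves room for
    sums long enough to contain a given index; in the proof M + 1 replaces M, which may be 0. *)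
Lemma small_tail_eq0 f (x : R[i]) (M : R) m : inL2 f -> 0 <= M ->
  (forall n, (m <= n)%N ->
    normc x ^+ 2 <= M * (limn (fourier_mass f) - fourier_mass f n)) -> x = 0.
Proof.
move=> fL M0 H; apply: eq0_normc; apply/eqP; rewrite -[_ == 0](@expf_eq0 _ _ 2)/=.
rewrite eq_le sqr_ge0 andbT leNgt; apply/negP => x0.
have M10 : 0 < M + 1 by rewrite ltr_wpDl.
have eps0 : 0 < normc x ^+ 2 / (M + 1) by rewrite divr_gt0.
have /cvgrPdist_lt/(_ _ eps0)[k _ /(_ (maxn k m) (leq_maxl _ _))] /= := fourier_mass_cvg fL.
move=> /(le_lt_trans (ler_norm _)); rewrite ltr_pdivlMr// mulrC => h.
have := H (maxn k m) (leq_maxr _ _); rewrite leNgt => /negP; apply.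
apply: le_lt_trans h; rewrite ler_wpM2r ?lerDl// subr_ge0.
by apply: nondecreasing_cvgn_le; [exact: fourier_mass_nd|exact: fourier_mass_cvg].
Qed.

(** For n > i the coefficient of f is also that of its n-th Fourier sum, so the difference is the
    inner product with u_i of a function whose norm is controlled by the tail; Cauchy-Schwarz
    concludes. *)
Lemma inner_bergman_integral_basis f i : inL2 f ->
  inner (bergman_integral f) (e i) = inner f (e i).
Proof.
move=> fL; have [_ BL] := bergman_integral_inA2 fL.
apply/eqP; rewrite -subr_eq0; apply/eqP.
apply: (@small_tail_eq0 f _ 1 i.+1) => // n lin; rewrite mul1r.
have -> : inner (bergman_integral f) (e i) - inner f (e i) =
    inner (fun z => bergman_integral f z - fourier_sum f n z) (e i).
  by rewrite innerBl// inner_fourier_sum_basis lin.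
apply: le_trans (dnorm2_bergman_integralB n fL).
apply: (le_trans (inner_CauchySchwarz _ _)) => //; first exact: inL2B.
have := bergman_basis_orthonormal R i i; rewrite eqxx inner_diag// => /(congr1 (@Re R)).
by move=> /= ->; rewrite mulr1.
Qed.

(** The difference of the two sides is in A^2 and all its coefficients vanish, so completeness
    applies. *)
Lemma bergman_integral_reproducing k : inA2 k ->
  forall z, normc z < 1 -> bergman_integral k z = k z.
Proof.
move=> kA z z1; have [kh kL] := kA; have BA := bergman_integral_inA2 kL.
apply/eqP; rewrite -subr_eq0; apply/eqP.
apply: (bergman_basis_complete (inA2B BA kA)) z1 => n.
by rewrite innerBl ?inner_bergman_integral_basis ?subrr//; case: BA.
Qed.

(** Orthogonality to every u_i must be extended to all of A^2. By the reproducing property k is its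
    own kernel integral, hence the L^2 limit of its Fourier sums, and each of these is orthogonal to
    f minus its kernel integral. *)
Theorem bergman_integral_proj f : inL2 f -> is_bergman_proj f (bergman_integral f).
Proof.
move=> fL; have BA := bergman_integral_inA2 fL; split => // k kA.
have [_ BL] := BA; have [_ kL] := kA; have [_ BkL] := bergman_integral_inA2 kL.
set g := (fun z => _); have gL : inL2 g by exact: inL2B.
have ge i : inner g (e i) = 0.
  by rewrite innerBl// inner_bergman_integral_basis// subrr.
rewrite (@eq_inner _ g g k (bergman_integral k))//; last first.
  by move=> z z1; rewrite bergman_integral_reproducing.
apply: (@small_tail_eq0 k _ (dnorm2 g) 0) => //; first exact: dnorm2_ge0.
move=> n _.
have -> : inner g (bergman_integral k) =
    inner g (fun z => bergman_integral k z - fourier_sum k n z).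
  rewrite innerBr// (innerC (pL k n) gL) inner_fourier_sum_l// big1 ?conjC0 ?subr0// => i _.
  by rewrite (innerC gL (eL i)) ge conjC0 mulr0.
apply: (le_trans (inner_CauchySchwarz gL _)); first exact: inL2B.
by rewrite ler_wpM2l ?dnorm2_ge0// dnorm2_bergman_integralB.
Qed.

End FourierSums.

(** * The canonical solution operator *)

Section CanonicalSolution.
Variable R : realType.
Local Notation Re := complex.Re.
Local Notation leb2 := (@leb2 R).
Local Notation disc := (@disc R).
Local Notation e := (@bergman_basis R).
Implicit Types (f g h k p q : R[i] -> R[i]) (c z : R[i]).

(** Existence of a projection ensures that the choice in [bergman_proj] does not fall back on its
    default 0. *)
Lemma bergman_projP f : inL2 f -> is_bergman_proj f (bergman_proj f).
Proof.
move=> fL.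
exact: (@xgetPex _ (fun=> 0 : R[i]) [set p | is_bergman_proj f p])
  (ex_intro _ _ (bergman_integral_proj fL)).
Qed.

(** Completeness gives equality at every point of the disc, not merely almost everywhere;
    [S1_linear] is pointwise for this reason. *)
Lemma is_bergman_proj_unique f p q : inL2 f -> is_bergman_proj f p ->
  is_bergman_proj f q -> forall z, normc z < 1 -> p z = q z.
Proof.
move=> fL [pA po] [qA qo] z z1; apply/eqP; rewrite -subr_eq0; apply/eqP.
apply: (bergman_basis_complete (inA2B pA qA)) z1 => n.
have [_ pL] := pA; have [_ qL] := qA; have eA := bergman_basis_inA2 R n; have [_ eL] := eA.
have := qo _ eA; have := po _ eA; rewrite !innerBl// => /eqP + /eqP.
by rewrite !subr_eq0 => /eqP <- /eqP <-; rewrite subrr.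
Qed.

Lemma is_bergman_projD (c : R[i]) f g p q : inL2 f -> inL2 g ->
  is_bergman_proj f p -> is_bergman_proj g q ->
  is_bergman_proj (fun z => c * f z + g z) (fun z => c * p z + q z).
Proof.
move=> fL gL [pA po] [qA qo]; split; first exact: (inA2D (inA2Z c pA) qA).
move=> k kA; have [_ pL] := pA; have [_ qL] := qA; have [_ kL] := kA.
have fpL := inL2B fL pL; have gqL := inL2B gL qL.
transitivity (inner (fun z => c * (f z - p z) + (g z - q z)) k).
  by apply: eq_inner => // z _; ring.
rewrite (innerDl (inL2Z c fpL) gqL kL) (innerZl c fpL kL).
by rewrite po// qo// mulr0 addr0.
Qed.

(** Pythagoras for f - q = (f - p) - (q - p), with p the projection. Any q in A^2 thus yields an
    upper bound on the norm of [S1]. *)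
Lemma dnorm2_bergman_proj_le f q : inL2 f -> inA2 q ->
  dnorm2 (fun z => f z - bergman_proj f z) <= dnorm2 (fun z => f z - q z).
Proof.
move=> fL qA; have [pA po] := bergman_projP fL.
set p := bergman_proj f in pA po *; have [_ pL] := pA; have [_ qL] := qA.
rewrite (@eq_dnorm2 _ (fun z => f z - q z) (fun z => (f z - p z) - (q z - p z))); last first.
  by move=> z _; ring.
rewrite [leRHS]dnorm2B; [|exact: inL2B|exact: inL2B].
by rewrite po ?mulr0 ?subr0 ?lerDl ?dnorm2_ge0//; exact: inA2B.
Qed.

Lemma S1_inL2 f : inA2 f -> inL2 (S1 f).
Proof.
move=> [_ fL]; have zL := inL2_conjM fL; have [[_ pL] _] := bergman_projP zL.
exact: inL2B zL pL.
Qed.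

Lemma S1_linear (c : R[i]) f g z : inA2 f -> inA2 g -> normc z < 1 ->
  S1 (fun z => c * f z + g z) z = c * S1 f z + S1 g z.
Proof.
move=> [_ fL] [_ gL] z1; have zf := inL2_conjM fL; have zg := inL2_conjM gL.
have E : (fun z => z^* * (c * f z + g z)) = (fun z => c * (z^* * f z) + z^* * g z).
  by apply/funext => w; ring.
rewrite /S1 E; have zfg := inL2D (inL2Z c zf) zg.
rewrite (is_bergman_proj_unique zfg (bergman_projP zfg)
  (is_bergman_projD c zf zg (bergman_projP zf) (bergman_projP zg)) z1).
by ring.
Qed.

Lemma inA2_0 : inA2 (fun=> 0 : R[i]).
Proof.
have := inA2B (monomial_inA2 (R := R) 0) (monomial_inA2 0).
by congr inA2; apply/funext => z; rewrite subrr.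
Qed.

(** Comparison with q = 0, together with |zbar| < 1 on the disc. *)
Lemma dnorm2_S1_le f : inA2 f -> dnorm2 (S1 f) <= dnorm2 f.
Proof.
move=> [_ fL]; have zf := inL2_conjM fL.
apply: (le_trans (dnorm2_bergman_proj_le zf inA2_0)).
apply: le_Rintegral; first exact: measurable_disc.
- exact: (inL2_sqr_integrable (inL2B zf (@inL2_0 R))).
- exact: inL2_sqr_integrable.
move=> w wD; rewrite subr0 normcM normc_conj exprMn ler_piMl ?sqr_ge0//.
by rewrite expr_le1 ?normcge0// ltW.
Qed.

Lemma normL2_sqr f : inL2 f -> (normL2 f ^+ 2)%E = (dnorm2 f)%:E.
Proof.
by move=> fL; rewrite /normL2 dnorm2E// sqr_sqrte// lee_fin dnorm2_ge0.
Qed.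

(* The comparison function is the projection itself,
   [n / (n + 1) z ^ (n - 1)] up to normalisation. *)
Lemma dnorm2_S1_basis_le n : dnorm2 (S1 (e n)) <= (n.+1%:R * n.+2%:R)^-1.
Proof.
set t : R := Num.sqrt (n.+1%:R / pi); have t2 : t ^+ 2 = n.+1%:R / pi by exact: sqr_basis_coef.
have pi_neq0 : pi != 0 :> R by rewrite gt_eqF// pi_gt0.
have mL m := monomial_inL2 (R := R) m.
have zL := inL2_conjM (mL n).
have n10 : n.+1%:R != 0 :> R by rewrite pnatr_eq0.
have n20 : n.+2%:R != 0 :> R by rewrite pnatr_eq0.
(* For n > 0 this is <zbar z^n, z^(n-1)> / ||z^(n-1)||^2, the quotient of pi / (n + 1) by pi / n. *)
pose c : R := n%:R / n.+1%:R.
have qA : inA2 (fun z : R[i] => t%:C * (c%:C * z ^+ n.-1)).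
  by do 2 apply: inA2Z; exact: monomial_inA2.
have [_ eL] := bergman_basis_inA2 R n.
apply: (le_trans (dnorm2_bergman_proj_le (inL2_conjM eL) qA)).
rewrite (@eq_dnorm2 _ _ (fun z => t%:C * (z^* * z ^+ n - c%:C * z ^+ n.-1))); last first.
  by move=> z _; rewrite /bergman_basis -/t; ring.
have qL : inL2 (fun z : R[i] => c%:C * z ^+ n.-1) by exact: inL2Z.
rewrite dnorm2Z; last exact: inL2B.
rewrite normc_real real_normK ?num_real// t2 dnorm2B//.
have -> : dnorm2 (fun z : R[i] => z^* * z ^+ n) = pi / n.+2%:R.
  rewrite -dnorm2_monomial; apply: eq_Rintegral => w _.
  by rewrite [cplx w ^+ n.+1]exprS !normcM normc_conj.
rewrite dnorm2Z// dnorm2_monomial normc_real real_normK ?num_real//.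
rewrite innerZr// (_ : (c%:C)^* = c%:C); last first.
  by apply: complex_ext; rewrite !reimE// oppr0.
rewrite ReM ReC ImC mul0r subr0.
(* At n = 0 the truncated exponent [n.-1] does no harm, because c = 0 makes the comparison function
   zero. *)
case: n => [|m] in t t2 mL zL n10 n20 c qA eL qL *.
  rewrite /c mul0r !mul0r expr0n/= mul0r mulr0 subr0 addr0.
  by rewrite mulrA divfK// !mul1r.
have -> : Re (inner (fun z : R[i] => z^* * z ^+ m.+1) (fun z => z ^+ m.+1.-1)) = pi / m.+2%:R.
  rewrite -dnorm2_monomial -[dnorm2 _]ReC -inner_diag//; congr Re.
  rewrite !innerE; apply: eq_cint => w _ /=.
  by rewrite !exprS rmorphM/=; ring.
rewrite le_eqVlt; apply/orP; left; apply/eqP; rewrite /c /=.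
have m10 : m.+1%:R != 0 :> R by rewrite pnatr_eq0.
move: (m.+1) m10 n10 n20 => k k0 n10 n20.
move: pi_neq0; move: (pi : R) => P P0.
have E1 : k.+1%:R = k%:R + 1 :> R by rewrite natr1.
have E2 : k.+2%:R = k%:R + 2 :> R by rewrite -[k.+2]addn2 natrD.
rewrite {}E1 {}E2 in n10 n20 *; move: (k%:R : R) k0 n10 n20 => a a0 a1 a2.
field.
by rewrite a0 a1 a2 P0.
Qed.

Lemma sum_inv_consecutive n : \sum_(i < n) ((i.+1%:R * i.+2%:R)^-1 : R) = 1 - n.+1%:R^-1.
Proof.
elim: n => [|n ih]; first by rewrite big_ord0 invr1 subrr.
have n10 : n.+1%:R != 0 :> R by rewrite pnatr_eq0.
have n20 : n.+2%:R != 0 :> R by rewrite pnatr_eq0.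
rewrite big_ord_recr ih -[LHS]/(1 - n.+1%:R^-1 + (n.+1%:R * n.+2%:R)^-1).
have E2 : n.+2%:R = n.+1%:R + 1 :> R by rewrite -[n.+2]addn1 natrD.
rewrite E2 in n20 *; move: (n.+1%:R) n10 n20 => a a0 a1; field.
by rewrite a0 a1.
Qed.

Lemma S1_basis_summable : (\sum_(0 <= n <oo) normL2 (S1 (e n)) ^+ 2 < +oo)%E.
Proof.
apply: le_lt_trans (ltry 1).
have E n : (normL2 (S1 (e n)) ^+ 2)%E = (dnorm2 (S1 (e n)))%:E.
  by rewrite normL2_sqr//; apply: S1_inL2; exact: bergman_basis_inA2.
apply: lime_le.
  by apply: is_cvg_nneseries => n _ _; rewrite E lee_fin dnorm2_ge0.
near=> N; rewrite big_mkord.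
apply: (@le_trans _ _ (\sum_(i < N) ((i.+1%:R * i.+2%:R)^-1 : R)%:E)%E).
  by apply: lee_sum => i _; rewrite E lee_fin dnorm2_S1_basis_le.
by rewrite sumEFin lee_fin sum_inv_consecutive lerBlDr lerDl invr_ge0.
Unshelve. all: by end_near. Qed.

End CanonicalSolution.

Theorem proposition6 (R : realType) :
  (\sum_(0 <= n <oo) normL2 (S1 (@bergman_basis R n)) ^+ 2 < +oo)%E /\
  hilbert_schmidt (@S1 R).
Proof.
split; first exact: S1_basis_summable.
split.
- exact: S1_inL2.
- by move=> c f g fA gA; apply: aeW => w wD; exact: S1_linear.
- exists 1 => f fA; rewrite mul1e /normL2 (dnorm2E (S1_inL2 fA)) (dnorm2E fA.2).
  by rewrite lee_sqrt ?lee_fin ?dnorm2_ge0// dnorm2_S1_le.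
exists (@bergman_basis R); last exact: S1_basis_summable.
split.
- exact: bergman_basis_inA2.
- exact: bergman_basis_orthonormal.
- move=> f fA f0; apply: aeW => w wD; exact: bergman_basis_complete f0 _ wD.
Qed.
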